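(* Let $H\in\mathcal{G}$, let $\Gamma$ be a compact family in Poly, and let $G=\langle H,\Gamma\rangle$ be the polynomial semigroup generated by $H$ and $\Gamma$. Suppose (1) $G\in\mathcal{G}_{dis}$; (2) $J(\gamma)\cap J_{\min}(G)=\emptyset$ for each $\gamma\in\Gamma$; and (3) $H$ is semi-hyperbolic. Then $G$ is semi-hyperbolic.
   Context: A polynomial semigroup is a semigroup of non-constant complex polynomials, regarded as self-maps of $\hat{\mathbb{C}}$, under composition. For such $G$, $F(G)$ is the set of points having a neighborhood on which $G$ is normal, $J(G)=\hat{\mathbb{C}}\setminus F(G)$, $J(g)=J(\langle g\rangle)$. $P(G)$ is the closure of the set of all critical values of all $g\in G$, $P^*(G)=P(G)\setminus\{\infty\}$. $\mathcal{G}$: polynomial semigroups all of whose elements have degree $\ge2$ and with $P^*(G)$ bounded in $\mathbb{C}$; $\mathcal{G}_{dis}$: those $G\in\mathcal{G}$ with $J(G)$ disconnected. $\hat K(G)=\{z\in\mathbb{C}:\{g(z):g\in G\}\text{ bounded}\}$. For $G\in\mathcal{G}_{dis}$, $J_{\min}(G)$ is the unique connected component of $J(G)$ (not containing $\infty$) which meets $\partial\hat K(G)$. Poly is the set of all polynomials as maps $\hat{\mathbb{C}}\to\hat{\mathbb{C}}$ with the topology of uniform convergence on $\hat{\mathbb{C}}$ with respect to the spherical metric. A rational semigroup $H$ is semi-hyperbolic if for each $z\in J(H)$ there exist a neighborhood $U$ of $z$ and $N\in\mathbb{N}$ such that for every $g\in H$ and every connected component $V$ of $g^{-1}(U)$,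 $\deg(g:V\to U)\le N$. *)

(* Defs.v *)
From HB Require Import structures.
From mathcomp Require Import all_boot all_order all_algebra.
From mathcomp Require Import complex.
From mathcomp Require Import reals.
Set Implicit Arguments. Unset Strict Implicit. Unset Printing Implicit Defensive.
Import Order.TTheory GRing.Theory Num.Theory.
Local Open Scope ring_scope.

Section Dyn.
Variable R : realType.
Local Notation C := R[i].

Definition cmod (z : C) : R :=
  Num.sqrt (complex.Re z ^+ 2 + complex.Im z ^+ 2).

(* Riemann sphere: None is the point at infinity *)
Definition sphere := option C.

Definition chord (z w : sphere) : R :=
  match z, w with
  | Some a, Some b => 2 * cmod (a - b) /
        Num.sqrt ((1 + cmod a ^+ 2) * (1 + cmod b ^+ 2))
  | Some a, None | None, Some a => 2 / Num.sqrt (1 + cmod a ^+ 2)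
  | None, None => 0
  end.

Definition sball (z : sphere) (r : R) : sphere -> Prop :=
  fun w => chord z w < r.

Definition sopen (U : sphere -> Prop) : Prop :=
  forall z, U z -> exists2 r, 0 < r & forall w, sball z r w -> U w.

Definition sclosure (A : sphere -> Prop) : sphere -> Prop :=
  fun z => forall e, 0 < e -> exists2 a, A a & chord z a < e.

Definition sconnected (A : sphere -> Prop) : Prop :=
  ~ exists U V : sphere -> Prop,
      [/\ sopen U /\ sopen V, (forall z, A z -> U z \/ V z),
          (exists2 z, A z & U z), (exists2 z, A z & V z) &
          (forall z, A z -> U z -> V z -> False)].

Definition scomponent (A : sphere -> Prop) (x : sphere) : sphere -> Prop :=
  fun y => exists B : sphere -> Prop,
      [/\ sconnected B, (forall z, B z -> A z), B x & B y].

Definition is_component (A K : sphere -> Prop) : Prop :=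
  exists2 x, A x & K = scomponent A x.

Definition peval (p : {poly C}) (z : sphere) : sphere :=
  match z with
  | Some a => Some p.[a]
  | None => if (size p <= 1)%N then Some p`_0 else None
  end.

Definition closed_comp (S : {poly C} -> Prop) : Prop :=
  forall p q, S p -> S q -> S (p \Po q).

Definition poly_semigroup (G : {poly C} -> Prop) : Prop :=
  [/\ exists g, G g, (forall g, G g -> (1 < size g)%N) & closed_comp G].

Definition gen (S : {poly C} -> Prop) : {poly C} -> Prop :=
  fun g => forall T : {poly C} -> Prop,
      (forall p, S p -> T p) -> closed_comp T -> T g.

Definition normal_on (G : {poly C} -> Prop) (U : sphere -> Prop) : Prop :=
  forall f : nat -> {poly C}, (forall n, G (f n)) ->
  exists phi : nat -> nat, (forall n, (phi n < phi n.+1)%N) /\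
  exists lim : sphere -> sphere,
    forall z, U z -> exists2 r, 0 < r &
      forall e, 0 < e -> exists N, forall n, (N <= n)%N ->
        forall w, U w -> sball z r w ->
          chord (peval (f (phi n)) w) (lim w) < e.

Definition Fatou (G : {poly C} -> Prop) : sphere -> Prop :=
  fun z => exists2 r, 0 < r & normal_on G (sball z r).

Definition Julia (G : {poly C} -> Prop) : sphere -> Prop :=
  fun z => ~ Fatou G z.

Definition Julia1 (g : {poly C}) : sphere -> Prop :=
  Julia (gen (fun p => p = g)).

(* critical values of g on the sphere (infinity is a critical point, hence
   a critical value, of every polynomial of degree >= 2) *)
Definition critval (g : {poly C}) : sphere -> Prop :=
  fun w => (exists2 c : C, (g^`()).[c] = 0 & w = Some g.[c])
           \/ ((1 < size g)%N /\ w = None).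

Definition postcrit (G : {poly C} -> Prop) : sphere -> Prop :=
  sclosure (fun w => exists2 g, G g & critval g w).

Definition in_calG (G : {poly C} -> Prop) : Prop :=
  [/\ poly_semigroup G, (forall g, G g -> (2 < size g)%N) (* deg g >= 2 *) &
   exists M : R, forall z : C, postcrit G (Some z) -> cmod z <= M].

Definition in_calG_dis (G : {poly C} -> Prop) : Prop :=
  in_calG G /\ ~ sconnected (Julia G).

Definition Khat (G : {poly C} -> Prop) : C -> Prop :=
  fun z => exists M : R, forall g, G g -> cmod g.[z] <= M.

Definition cboundary (A : C -> Prop) : C -> Prop :=
  fun z => forall e, 0 < e ->
    (exists2 a, A a & cmod (z - a) < e) /\
    (exists2 a, ~ A a & cmod (z - a) < e).

Definition is_Jmin (G : {poly C} -> Prop) (K : sphere -> Prop) : Prop :=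
  [/\ is_component (Julia G) K, ~ K None &
      exists2 z, cboundary (Khat G) z & K (Some z)].

(* compactness in Poly (uniform convergence on the sphere, spherical
   metric), as sequential compactness of this metric space *)
Definition poly_compact (Gam : {poly C} -> Prop) : Prop :=
  forall f : nat -> {poly C}, (forall n, Gam (f n)) ->
  exists phi : nat -> nat, (forall n, (phi n < phi n.+1)%N) /\
  exists2 g, Gam g &
    forall e, 0 < e -> exists N, forall n, (N <= n)%N ->
      forall z, chord (peval (f (phi n)) z) (peval g z) < e.

Definition locdeg (g : {poly C}) (v : sphere) : nat :=
  match v with
  | Some a => mup a (g - g.[a]%:P)
  | None => (size g).-1
  end.

(* deg(g : V -> U) <= N : every fibre over a point of U, counted with
   multiplicity, has at most N points in V *)
Definition deg_le (g : {poly C}) (V U : sphere -> Prop) (N : nat) : Prop :=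
  forall w, U w -> forall s : seq sphere, uniq s ->
    (forall v, v \in s -> V v /\ peval g v = w) ->
    (\sum_(v <- s) locdeg g v <= N)%N.

Definition semi_hyperbolic (G : {poly C} -> Prop) : Prop :=
  forall z, Julia G z -> exists U : sphere -> Prop, exists N : nat,
    [/\ sopen U, U z &
      forall g, G g -> forall V, is_component (fun v => U (peval g v)) V ->
        deg_le g V U N].

End Dyn.

(* Main.v *)
(* The main point is that [gamma (Khat G)] misses [J(G)] for [gamma] in [Gam].  Level sets
   [|g| = r0] with large [r0] are connected, so any two points of [J(G)] in [Khat G] are joined
   by arbitrarily fine chains in [J(G)].  If [gamma x] were in [J(G)] with [x] in [Khat G],
   lifting chains through [gamma], whose Julia set is disjoint from [J_min(G)], would give maps
   [g^m gamma^n] without zeros on a fixed disc around a point of [J(gamma)]; averaging over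
   circles and a capacity estimate then bound [gamma^n] there by an exponential in [n], but
   escaping orbits grow faster.  (If [Khat G] is a point, all of [G] is totally ramified there,
   which semi-hyperbolicity of [H] forbids.)

   By compactness a uniform neighbourhood of [gamma (Khat G)] lies in [Khat G], so [J(G)] meets
   [Khat G] only inside [J(H)].  There, an element of [G] outside [H] is [h gamma w] with [h] in
   [H], and components of preimages of small discs under [h gamma] are so small and so far from
   the critical values of [w] that [w] is injective over them. *)

(* Degrees in [G] are unbounded, so every estimate must be uniform over the semigroup. A radius [r0]
   beyond which all elements at least double the modulus comes from the generators alone: infinity
   is totally ramified, so semi-hyperbolicity puts it in the Fatou set of [H], and compactness makes
   [Gam] equicontinuous there. Boundedness of the finite postcritical set then places all critical
   values in [Khat G], strictly inside radius [r0], so [r0] itself is an admissible level. In the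
   growth argument the map applied after the iterate [gamma^n] has an uncontrolled degree [M]. All
   bounds are therefore constants to the power [M], and an [M]-th root removes it. Averaging over
   [n d + 1] points, [d] being the degree of [gamma], keeps the error factor at most [2^M]. What
   remains is a bound [B^(n d + 1)] up to a constant, while degree at least two lets escaping orbits
   outgrow any prescribed geometric rate. Connectedness is handled through fine chains: they pass to
   limits and to preimages more easily than components, and in a compact set they recover them. *)
Require Import Defs.
From HB Require Import structures.
From mathcomp Require Import all_boot all_order all_algebra.
From mathcomp Require Import complex reals boolp classical_sets ring lra zify.
Set Implicit Arguments. Unset Strict Implicit. Unset Printing Implicit Defensive.
Import Order.TTheory GRing.Theory Num.Theory.
Local Open Scope ring_scope.

(** * Polynomials and the modulus *)

Section Modulus.
Variable R : realType.
Local Notation C := R[i].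
Implicit Types (x y z u w p q : C) (f : {poly C}).

Lemma cmodE z : cmod z = ComplexField.Normc.normc z.
Proof. by case: z. Qed.

Lemma cmod_ge0 z : 0 <= cmod z. Proof. exact: sqrtr_ge0. Qed.

Lemma cmodM z w : cmod (z * w) = cmod z * cmod w.
Proof. by rewrite !cmodE ComplexField.Normc.normcM. Qed.

Lemma cmodN z : cmod (- z) = cmod z.
Proof. by rewrite !cmodE normcN. Qed.

Lemma cmodD z w : cmod (z + w) <= cmod z + cmod w.
Proof. by rewrite !cmodE le_normcD. Qed.

Lemma cmod0 : cmod (0 : C) = 0.
Proof. by rewrite cmodE ComplexField.Normc.normc0. Qed.

Lemma cmod1 : cmod (1 : C) = 1.
Proof. by rewrite cmodE ComplexField.Normc.normc1. Qed.

Lemma cmod_eq0 z : (cmod z == 0) = (z == 0).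
Proof.
apply/eqP/eqP => [|->]; last exact: cmod0.
by rewrite cmodE => /ComplexField.Normc.eq0_normc.
Qed.

Lemma cmod_gt0 z : (0 < cmod z) = (z != 0).
Proof. by rewrite lt_def cmod_ge0 andbT cmod_eq0. Qed.

Lemma cmodX z n : cmod (z ^+ n) = cmod z ^+ n.
Proof. by elim: n => [|n IH]; rewrite ?expr0 ?cmod1 // !exprS cmodM IH. Qed.

Lemma cmodBC z w : cmod (z - w) = cmod (w - z).
Proof. by rewrite -cmodN opprB. Qed.

Lemma cmodB z w : cmod (z - w) <= cmod z + cmod w.
Proof. by rewrite -(cmodN w) cmodD. Qed.

Lemma cmod_tri y x z : cmod (x - z) <= cmod (x - y) + cmod (y - z).
Proof. by rewrite (_ : x - z = (x - y) + (y - z)) ?cmodD //; ring. Qed.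

Lemma cmod_le_sub x y : cmod x <= cmod (x - y) + cmod y.
Proof. by rewrite {1}(_ : x = (x - y) + y) ?cmodD //; ring. Qed.

Lemma cmodC (t : R) : cmod (t%:C)%C = `|t|.
Proof. by rewrite /cmod /= expr0n addr0 sqrtr_sqr. Qed.

Lemma cmod_prod (T : Type) (s : seq T) (F : T -> C) :
  cmod (\prod_(i <- s) F i) = \prod_(i <- s) cmod (F i).
Proof. by elim/big_rec2: _ => [|i a b _ <-]; rewrite ?cmod1 ?cmodM. Qed.

Lemma cmod_sqr z : cmod z ^+ 2 = complex.Re z ^+ 2 + complex.Im z ^+ 2.
Proof. by rewrite sqr_sqrtr // addr_ge0 // sqr_ge0. Qed.

Lemma Re_le_cmod z : `|complex.Re z| <= cmod z.
Proof. by rewrite -sqrtr_sqr ler_wsqrtr // lerDl sqr_ge0. Qed.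

Lemma Im_le_cmod z : `|complex.Im z| <= cmod z.
Proof. by rewrite -sqrtr_sqr ler_wsqrtr // lerDr sqr_ge0. Qed.

Lemma cmod_le_ReIm z : cmod z <= `|complex.Re z| + `|complex.Im z|.
Proof.
rewrite -(@ler_pXn2r _ 2) ?nnegrE ?cmod_ge0 ?addr_ge0 // cmod_sqr sqrrD !real_normK ?num_real //.
by rewrite -addrA lerD2l lerDr mulrn_wge0 // mulr_ge0.
Qed.

Lemma prod_ge_exp (T : eqType) (s : seq T) (F : T -> R) e :
  0 <= e -> (forall i, i \in s -> e <= F i) -> e ^+ size s <= \prod_(i <- s) F i.
Proof.
move=> e0; elim: s => [|a s IH] h; first by rewrite big_nil.
rewrite big_cons /= exprS ler_pM ?exprn_ge0 ?h ?mem_head //.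
by apply: IH => i si; apply: h; rewrite inE si orbT.
Qed.

Lemma prod_le_exp (T : eqType) (s : seq T) (F : T -> R) e :
  (forall i, i \in s -> 0 <= F i <= e) -> \prod_(i <- s) F i <= e ^+ size s.
Proof.
elim: s => [|a s IH] h; first by rewrite big_nil.
have /andP[a0 ae] := h a (mem_head _ _).
rewrite big_cons /= exprS; apply: ler_pM => //.
  rewrite big_seq prodr_ge0 // => i si.
  by have /h/andP[] : i \in a :: s by rewrite inE si orbT.
by apply: IH => i si; apply: h; rewrite inE si orbT.
Qed.

Lemma prod_lt_exists (T : eqType) (s : seq T) (F : T -> R) e :
  0 <= e -> \prod_(i <- s) F i < e ^+ size s -> exists2 i, i \in s & F i < e.
Proof.
move=> e0 lt; apply: contrapT => ne.
suff /le_lt_trans/(_ lt) : e ^+ size s <= \prod_(i <- s) F i by rewrite ltxx.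
apply: prod_ge_exp => // i si; rewrite leNgt; apply/negP => h; apply: ne; by exists i.
Qed.

Lemma poly_split f : f != 0 ->
  exists s : seq C, f = lead_coef f *: \prod_(z <- s) ('X - z%:P) /\ size s = (size f).-1.
Proof.
move=> f0; have [s fE] := closed_field_poly_normal f; exists s; split => //.
rewrite fE size_scale ?lead_coef_eq0 //.
by rewrite size_prod_XsubC.
Qed.

Lemma horner_split f s x : f = lead_coef f *: \prod_(z <- s) ('X - z%:P) ->
  cmod f.[x] = cmod (lead_coef f) * \prod_(z <- s) cmod (x - z).
Proof.
move=> {1}->; rewrite hornerZ cmodM horner_prod cmod_prod.
by congr (_ * _); apply: eq_bigr => z _; rewrite hornerXsubC.
Qed.

Lemma root_split f s z : f = lead_coef f *: \prod_(z <- s) ('X - z%:P) -> z \in s -> f.[z] = 0.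
Proof.
move=> -> zs; rewrite hornerZ; apply/eqP; rewrite mulf_eq0 orbC; apply/orP; left.
by rewrite -rootE root_prod_XsubC.
Qed.

Lemma size_subC f u : (1 < size f)%N -> size (f - u%:P) = size f.
Proof. by move=> h; rewrite size_polyDl // size_polyN; apply: leq_ltn_trans (size_polyC_leq1 u) h. Qed.

Lemma lead_subC f u : (1 < size f)%N -> lead_coef (f - u%:P) = lead_coef f.
Proof. by move=> h; rewrite lead_coefDl // size_polyN; apply: leq_ltn_trans (size_polyC_leq1 u) h. Qed.

Lemma subC_split f u : (1 < size f)%N ->
  exists s : seq C, [/\ size s = (size f).-1, (forall z, z \in s -> f.[z] = u) &
   forall x, cmod (f.[x] - u) = cmod (lead_coef f) * \prod_(z <- s) cmod (x - z)].
Proof.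
move=> h; have f0 : f - u%:P != 0 by rewrite -size_poly_eq0 size_subC //; case: size h.
have [s [fE sz]] := poly_split f0; exists s; split.
- by rewrite sz size_subC.
- by move=> z /(root_split fE)/eqP; rewrite hornerD hornerN hornerC subr_eq0 => /eqP.
by move=> x; rewrite -(lead_subC u h) -(horner_split x fE) !hornerE.
Qed.

(** The modulus on the left is the leading coefficient times the product of the distances from [p]
    to the roots of [f - u], so one distance must fall below [e]. *)
Lemma root_close f p u (e : R) : (1 < size f)%N -> 0 <= e ->
  cmod (f.[p] - u) < cmod (lead_coef f) * e ^+ (size f).-1 ->
  exists2 q, f.[q] = u & cmod (q - p) < e.
Proof.
move=> h e0; have [s [sz rt ->]] := subC_split u h.
rewrite ltr_pM2l; last by rewrite cmod_gt0 lead_coef_eq0 -size_poly_eq0; case: size h.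
rewrite -sz => /prod_lt_exists-/(_ e0)[z zs lt]; exists z; first exact: rt.
by rewrite cmodBC.
Qed.

Lemma lead_gt0 f : (1 < size f)%N -> 0 < cmod (lead_coef f).
Proof. by move=> h; rewrite cmod_gt0 lead_coef_eq0 -size_poly_eq0; case: size h. Qed.

(** The radius depends on [f] and [e] alone, not on [p]. This uniform openness lets sets and chains
    be lifted in steps of a fixed size. *)
Lemma open_map f e : (1 < size f)%N -> 0 < e ->
  exists2 d, 0 < d & forall p u, cmod (f.[p] - u) < d -> exists2 q, f.[q] = u & cmod (q - p) < e.
Proof.
move=> h e0; exists (cmod (lead_coef f) * e ^+ (size f).-1).
  by rewrite mulr_gt0 ?lead_gt0 ?exprn_gt0.
by move=> p u; apply: root_close => //; apply: ltW.
Qed.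

Lemma poly_bounded f (M : R) : exists2 B, 0 < B & forall x, cmod x <= M -> cmod f.[x] <= B.
Proof.
have [M0|M0] := ltP M 0.
  by exists 1 => // x /le_lt_trans/(_ M0); rewrite ltNge cmod_ge0.
elim/poly_ind: f => [|f c [B B0 IH]]; first by exists 1 => // x _; rewrite horner0 cmod0.
exists (B * M + cmod c + 1); first by rewrite ltr_wpDl // addr_ge0 ?cmod_ge0 ?mulr_ge0 // ltW.
move=> x xM; rewrite hornerMXaddC; apply: le_trans (cmodD _ _) _; rewrite cmodM.
rewrite -addrA lerD ?ler_pM ?cmod_ge0 ?IH // lerDl //.
Qed.

(** Strict differentiability with one constant on a disc. The base point [p] is kept apart from [x]
    and [y], so that a lower bound for the derivative at [p] controls [f] on a whole neighbourhood
    of [p]. *)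
Lemma poly_taylor1 f (M : R) : exists2 B, 0 < B & forall p x y,
  cmod p <= M -> cmod x <= M -> cmod y <= M ->
  cmod (f.[x] - f.[y] - f^`().[p] * (x - y)) <= B * (cmod (x - p) + cmod (y - p)) * cmod (x - y).
Proof.
have [M0|M0] := ltP M 0.
  by exists 1 => // p x y /le_lt_trans/(_ M0); rewrite ltNge cmod_ge0.
elim/poly_ind: f => [|f c [B B0 IH]].
  exists 1 => // p x y *; rewrite derivC !horner0 mul0r !subr0 cmod0.
  by rewrite !mulr_ge0 ?addr_ge0 ?cmod_ge0.
have [D D0 hD] := poly_bounded f^`() M.
exists (B * M + 2 * D + 2 * M * B); first by rewrite ltr_wpDr ?mulr_ge0 ?(ltW B0) // ltr_wpDl ?mulr_ge0 ?(ltW B0) //; nra.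
move=> p x y pM xM yM; rewrite !hornerMXaddC derivD derivC addr0 derivM derivX mulr1 !hornerE.
have h1 := IH p x y pM xM yM; have h2 := IH p y p pM yM pM; have h3 := hD p pM.
set A := f.[x] - f.[y] - _ in h1; set A' := f.[y] - f.[p] - _ in h2.
rewrite (_ : _ - _ = A * x + f^`().[p] * (x - y) * (x - p) + (f^`().[p] * (y - p) + A') * (x - y)); last by rewrite /A /A'; ring.
apply: le_trans (cmodD _ _) _; apply: le_trans (lerD (cmodD _ _) (lexx _)) _.
rewrite !cmodM.
have h4 := cmodD (f^`().[p] * (y - p)) A'; rewrite cmodM in h4.
rewrite subrr cmod0 addr0 in h2.
have ? := cmod_ge0 A; have ? := cmod_ge0 A'; have ? := cmod_ge0 f^`().[p].
have ? := cmod_ge0 (x - y).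
have xp0 := cmod_ge0 (x - p). have yp0 := cmod_ge0 (y - p).
have yp : cmod (y - p) <= 2 * M by apply: le_trans (cmodB _ _) _; lra.
set X := cmod (x - y) in h1 *; set a := cmod (x - p) in h1 xp0 *; set b := cmod (y - p) in yp0 h1 h2 h4 yp *.
have t1 : cmod A * cmod x <= B * (a + b) * X * M by apply: ler_pM => //; apply: cmod_ge0.
have t2 : cmod f^`().[p] * X * a <= D * X * a by rewrite !ler_wpM2r.
have t3 : cmod (f^`().[p] * (y - p) + A') <= D * b + B * (2 * M) * b.
  apply: le_trans h4 _; apply: lerD; first by rewrite ler_wpM2r.
  apply: le_trans h2 _; rewrite -[B * b * b]mulrA mulrAC -[leRHS]mulrA ler_wpM2l ?(ltW B0) //; nra.
have t4 : cmod (f^`().[p] * (y - p) + A') * X <= (D * b + B * (2 * M) * b) * X by rewrite ler_wpM2r.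
apply: le_trans (lerD (lerD t1 t2) t4) _.
have -> : (B * M + 2 * D + 2 * M * B) * (a + b) * X =
  B * (a + b) * X * M + D * X * a + (D * b + B * (2 * M) * b) * X + (D * (a + b) * X + 2 * M * B * a * X) by ring.
rewrite lerDl addr_ge0 // !mulr_ge0 ?addr_ge0 // ltW //.
Qed.

Lemma poly_lip f (M : R) : exists2 L, 0 < L & forall x y,
  cmod x <= M -> cmod y <= M -> cmod (f.[x] - f.[y]) <= L * cmod (x - y).
Proof.
have [B B0 hB] := poly_taylor1 f M; have [D D0 hD] := poly_bounded f^`() M.
have [M0|M0] := ltP M 0.
  by exists 1 => // x y /le_lt_trans/(_ M0); rewrite ltNge cmod_ge0.
exists (B * (2 * M) + D); first by rewrite ltr_wpDl // !mulr_ge0 // ltW.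
move=> x y xM yM; have := hB y x y yM xM yM; rewrite subrr cmod0 addr0 => h.
have h1 := hD y yM.
have -> : f.[x] - f.[y] = (f.[x] - f.[y] - f^`().[y] * (x - y)) + f^`().[y] * (x - y) by ring.
apply: le_trans (cmodD _ _) _; rewrite mulrDl; apply: lerD.
  apply: le_trans h _; rewrite ler_wpM2r ?cmod_ge0 // ler_wpM2l ?(ltW B0) //.
  apply: le_trans (cmodB _ _) _; lra.
by rewrite cmodM ler_wpM2r ?cmod_ge0.
Qed.

Lemma poly_unif f (M e : R) : 0 < e ->
  exists2 d, 0 < d & forall x y, cmod x <= M -> cmod (y - x) < d -> cmod (f.[y] - f.[x]) < e.
Proof.
move=> e0; have [L L0 hL] := poly_lip f (M + 1).
exists (Num.min 1 (e / L)); first by rewrite lt_min ltr01 divr_gt0.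
move=> x y xM; rewrite lt_min ltr_pdivlMr // mulrC => /andP[h1 h2].
by apply: le_lt_trans (hL y x _ _) h2; have := cmod_le_sub y x; lra.
Qed.

Lemma poly_cont f x e : 0 < e ->
  exists2 d, 0 < d & forall y, cmod (y - x) < d -> cmod (f.[y] - f.[x]) < e.
Proof. by move=> /(poly_unif f (cmod x))[d d0 hd]; exists d => // y; apply: hd. Qed.

End Modulus.

(** * Compactness and extremum principles *)

Section Sequences.
Variable R : realType.
Local Notation C := R[i].
Implicit Types (x y q a b l : C) (f : {poly C}) (e d r M : R).

Definition incr (phi : nat -> nat) := forall n, (phi n < phi n.+1)%N.

Lemma incr_ltn phi m n : incr phi -> (m < n)%N -> (phi m < phi n)%N.
Proof.
move=> h; elim: n => // n IH; rewrite ltnS leq_eqVlt => /orP[/eqP->//|/IH lt].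
exact: ltn_trans lt (h n).
Qed.

Lemma incr_ge phi n : incr phi -> (n <= phi n)%N.
Proof. by move=> h; elim: n => // n IH; apply: leq_ltn_trans IH (h n). Qed.

Lemma incr_comp phi psi : incr phi -> incr psi -> incr (phi \o psi).
Proof. by move=> h1 h2 n; exact: (incr_ltn h1 (h2 n)). Qed.

Lemma subseq_choose (P : nat -> nat -> Prop) :
  (forall k N, exists2 n, (N <= n)%N & P k n) -> exists2 phi, incr phi & forall k, P k (phi k).
Proof.
move=> h; have /choice[F hF] : forall kN : nat * nat, exists n, (kN.2 <= n)%N /\ P kN.1 n.
  by move=> [k N]; have [n ? ?] := h k N; exists n.
pose phi := fix phi k := if k is k'.+1 then F (k, (phi k').+1) else F (0%N, 0%N).
exists phi => [n|[|k]]; [by case: (hF (n.+1, (phi n).+1)) | by case: (hF (0%N, 0%N))|].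
by case: (hF (k.+1, (phi k).+1)).
Qed.

Lemma inv_small (e : R) : 0 < e -> exists N, forall n, (N <= n)%N -> n.+1%:R^-1 < e.
Proof.
move=> e0; have e1 : 0 <= e^-1 by rewrite invr_ge0 ltW.
have := archi_boundP e1; set N := Num.bound _ => h; exists N => n Nn.
rewrite invf_plt ?posrE // ?ltr0Sn //; apply: lt_le_trans h _.
by rewrite ler_nat; apply: leq_trans Nn _.
Qed.

Lemma inv_nat_gt0 n : 0 < n.+1%:R^-1 :> R.
Proof. by rewrite invr_gt0 ltr0Sn. Qed.

Lemma inv_nat_le m n : (m <= n)%N -> n.+1%:R^-1 <= m.+1%:R^-1 :> R.
Proof. by move=> h; rewrite lef_pV2 ?posrE ?ltr0Sn // ler_nat. Qed.

Lemma bolzano_weierstrass_real (s : nat -> R) M : (forall n, `|s n| <= M) ->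
  exists2 phi, incr phi & exists t, forall e, 0 < e ->
    exists N, forall n, (N <= n)%N -> `|s (phi n) - t| < e.
Proof.
(* [S] collects the levels reached infinitely often; its supremum is the upper limit of [s], hence a
   cluster value. *)
move=> sM; pose S : set R := [set t | forall N, exists2 n, (N <= n)%N & t <= s n]%classic.
have sM' n : - M <= s n <= M by rewrite -ler_norml.
have hS : has_sup S.
  split; first by exists (- M) => N; exists N => //; case/andP: (sM' N).
  by exists M => t /(_ 0%N)[n _ tn]; apply: le_trans tn _; case/andP: (sM' n).
have cl (e : R) N : 0 < e -> exists2 n, (N <= n)%N & `|s n - sup S| < e.
  move=> e0; have [t St lt] := sup_adherent e0 hS.
  have : ~ S (sup S + e / 2).
    move=> /(sup_upper_bound hS) h; have : 0 < e / 2 by rewrite divr_gt0. by lra.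
  move=> /existsNP[N1 hN1]; have [n Nn tn] := St (maxn N N1); exists n.
    by apply: leq_trans Nn; apply: leq_maxl.
  have : s n < sup S + e / 2.
    rewrite ltNge; apply/negP => h; apply: hN1; exists n => //.
    by apply: leq_trans Nn; apply: leq_maxr.
  rewrite ltr_norml; move=> ?; apply/andP; split; lra.
have [phi hphi h] := @subseq_choose (fun k n => `|s n - sup S| < k.+1%:R^-1)
   (fun k N => cl _ N (inv_nat_gt0 k)).
exists phi => //; exists (sup S) => e /inv_small[N hN]; exists N => n /hN.
by apply: lt_trans.
Qed.

Definition ccvg (s : nat -> C) l := forall e, 0 < e ->
  exists N, forall n, (N <= n)%N -> cmod (s n - l) < e.

Lemma bolzano_weierstrass (s : nat -> C) M : (forall n, cmod (s n) <= M) ->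
  exists2 phi, incr phi & exists l, ccvg (s \o phi) l.
Proof.
move=> sM; have [|p1 i1 [t1 h1]] := @bolzano_weierstrass_real (fun n => complex.Re (s n)) M.
  by move=> n; apply: le_trans (sM n); apply: Re_le_cmod.
have [|p2 i2 [t2 h2]] := @bolzano_weierstrass_real (fun n => complex.Im (s (p1 n))) M.
  by move=> n; apply: le_trans (sM _); apply: Im_le_cmod.
exists (p1 \o p2); first exact: incr_comp.
exists (t1 +i* t2)%C => e e0; have e20 : 0 < e / 2 by rewrite divr_gt0.
have [N1 hN1] := h1 _ e20; have [N2 hN2] := h2 _ e20.
exists (maxn N1 N2) => n; rewrite geq_max => /andP[n1 n2] /=.
apply: le_lt_trans (cmod_le_ReIm _) _; rewrite [X in _ < X](_ : e = e / 2 + e / 2); last by lra.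
have := hN1 (p2 n) (leq_trans n1 (incr_ge _ i2)); have := hN2 n n2.
case: (s (p1 (p2 n))) => /= x y; by move=> *; apply: ltrD.
Qed.

Definition cclosed (A : C -> Prop) := forall x,
  (forall e, 0 < e -> exists2 y, A y & cmod (y - x) < e) -> A x.

Definition ccompact (A : C -> Prop) := cclosed A /\ exists M, forall x, A x -> cmod x <= M.

Lemma ccompact_seq A (s : nat -> C) : ccompact A -> (forall n, A (s n)) ->
  exists2 phi, incr phi & exists2 l, A l & ccvg (s \o phi) l.
Proof.
move=> [cA [M AM]] sA; have [phi ip [l h]] := bolzano_weierstrass (fun n => AM _ (sA n)).
exists phi => //; exists l => //; apply: cA => e /h[N /(_ N (leqnn _)) hN].
by exists (s (phi N)).
Qed.

Lemma ccvg_inv s l : ccvg s l -> forall e, 0 < e ->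
  exists N, forall n, (N <= n)%N -> cmod (s n - l) < e /\ n.+1%:R^-1 < e.
Proof.
move=> h e e0; have [N1 h1] := h e e0; have [N2 h2] := inv_small e0.
exists (maxn N1 N2) => n; rewrite geq_max => /andP[? ?]; split; auto.
Qed.

(* Applied with [P e x] saying that a uniform statement with constant [e] fails at [x]. *)
Lemma compact_cluster A (P : R -> C -> Prop) : ccompact A ->
  (forall e, 0 < e -> exists2 x, A x & P e x) ->
  exists2 l, A l & forall d, 0 < d ->
    exists e x, [/\ 0 < e, e < d, cmod (x - l) < d, A x & P e x].
Proof.
move=> cA h; have /choice[s hs] : forall n, exists x, A x /\ P (n.+1%:R^-1) x.
  by move=> n; have [x ? ?] := h _ (inv_nat_gt0 n); exists x.
have [phi ip [l Al cv]] := ccompact_seq cA (fun n => (hs n).1).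
exists l => // d d0; have [N hN] := ccvg_inv cv d0; have [h1 h2] := hN N (leqnn _).
exists (phi N).+1%:R^-1, (s (phi N)); split => //; try exact: inv_nat_gt0.
- by apply: le_lt_trans h2; apply/inv_nat_le/incr_ge.
- by case: (hs (phi N)).
by case: (hs (phi N)).
Qed.

Lemma min_attained A (F : C -> R) : ccompact A -> (exists x, A x) ->
  (forall x, A x -> forall e, 0 < e -> exists2 d, 0 < d &
     forall y, A y -> cmod (y - x) < d -> `|F y - F x| < e) ->
  exists2 m, A m & forall x, A x -> F m <= F x.
Proof.
move=> cA [x0 Ax0] cF; pose S : set R := [set t | exists2 x, A x & t = - F x]%classic.
have hS : has_sup S.
  split; first by exists (- F x0), x0.
  apply: contrapT => nb.
  have [|l Al hl] := @compact_cluster A (fun e x => F x < - e^-1) cA.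
    move=> e e0; apply: contrapT => ne; apply: nb; exists e^-1 => _ [x Ax ->].
    rewrite leNgt; apply/negP => h; apply: ne; exists x => //; lra.
  have [d d0 hd] := cF l Al 1 ltr01.
  have k0 : 0 < `|F l| + 1 by rewrite ltr_wpDl.
  have [|e [x [e0 /ltW e1 e2 Ax e3]]] := hl (Num.min d (`|F l| + 1)^-1).
    by rewrite lt_min d0 invr_gt0.
  move: e1 e2; rewrite le_min lt_min => /andP[_ e1] /andP[e2 _].
  have := hd x Ax e2; rewrite ltr_norml => /andP[]; have := ler_norm (- F l); rewrite normrN.
  have : (`|F l| + 1) <= e^-1 by rewrite -lef_pV2 ?posrE ?invrK ?invr_gt0.
  by lra.
have [|l Al hl] := @compact_cluster A (fun e x => sup S - e < - F x) cA.
  by move=> e e0; have [_ [x Ax ->] h] := sup_adherent e0 hS; exists x.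
exists l => // x Ax; rewrite leNgt; apply/negP => lt.
have e0 : 0 < (F l - F x) / 2 by rewrite divr_gt0 // subr_gt0.
have [d d0 hd] := cF l Al _ e0.
have [|e [y [e1 e2 e3 Ay e4]]] := hl (Num.min d ((F l - F x) / 2)); first by rewrite lt_min d0.
move: e2 e3; rewrite !lt_min => /andP[_ e2] /andP[e3 _].
have := hd y Ay e3; rewrite ltr_norml => /andP[? ?].
have : - F x <= sup S by apply: sup_upper_bound => //; exists x.
by lra.
Qed.

Lemma poly_norm_cont f x e : 0 < e -> exists2 d, 0 < d &
  forall y, cmod (y - x) < d -> `|cmod f.[y] - cmod f.[x]| < e.
Proof.
move=> e0; have [d d0 h] := poly_cont f x e0; exists d => // y /h lt.
have := cmod_le_sub f.[y] f.[x]; have := cmod_le_sub f.[x] f.[y].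
rewrite (cmodBC f.[x]) => ? ?; rewrite ltr_norml; lra.
Qed.

Lemma poly_min_attained A f : ccompact A -> (exists x, A x) ->
  exists2 m, A m & forall x, A x -> cmod f.[m] <= cmod f.[x].
Proof.
move=> cA nA; apply: (@min_attained A (fun x => cmod f.[x]) cA nA) => x Ax e e0.
by have [d d0 h] := poly_norm_cont f x e0; exists d => // y _ /h.
Qed.

Lemma poly_max_attained A f : ccompact A -> (exists x, A x) ->
  exists2 m, A m & forall x, A x -> cmod f.[x] <= cmod f.[m].
Proof.
move=> cA nA; have [|m Am hm] := @min_attained A (fun x => - cmod f.[x]) cA nA.
  move=> x Ax e e0; have [d d0 h] := poly_norm_cont f x e0; exists d => // y _ /h.
  by rewrite -normrN opprD !opprK.
by exists m => // x /hm; rewrite lerN2.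
Qed.

Lemma poly_preim_closed f M : cclosed (fun x => cmod f.[x] <= M).
Proof.
move=> x h; rewrite leNgt; apply/negP => lt.
have e0 : 0 < cmod f.[x] - M by rewrite subr_gt0.
have [d d0 hd] := poly_norm_cont f x e0; have [y yM /hd] := h d d0.
rewrite ltr_norml; lra.
Qed.

Lemma cclosedI A B : cclosed A -> cclosed B -> cclosed (fun x => A x /\ B x).
Proof.
move=> cA cB x h; split; [apply: cA|apply: cB] => e /h[y [? ?] ?]; by exists y.
Qed.

Lemma ball_compact c r : ccompact (fun x => cmod (x - c) <= r).
Proof.
split; last by exists (r + cmod c) => x h; have := cmod_le_sub x c; lra.
have := @poly_preim_closed ('X - c%:P) r; congr cclosed; apply/funext => x.
by rewrite !hornerE.
Qed.

Definition interior_pt (A : C -> Prop) x := exists2 e, 0 < e & forall y, cmod (y - x) < e -> A y.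

Lemma boundaryP A x : A x -> ~ interior_pt A x -> cboundary A x.
Proof.
move=> Ax nI e e0; split; first by exists x => //; rewrite subrr cmod0.
apply: contrapT => h; apply: nI; exists e => // y ye; apply: contrapT => nA; apply: h.
by exists y => //; rewrite cmodBC.
Qed.

Lemma boundary_interior A x : cboundary A x -> ~ interior_pt A x.
Proof.
move=> bA [e e0 h]; have [_ [a na]] := bA e e0; rewrite cmodBC => /h; exact: na.
Qed.

Lemma boundary_closed A x : cclosed A -> cboundary A x -> A x.
Proof. by move=> cA bA; apply: cA => e /bA[[a Aa]]; rewrite cmodBC; exists a. Qed.

(** By openness the value at [m] can be shrunk radially while moving [m] arbitrarily little; this
    rules out a nonzero interior minimum of the modulus. *)
Lemma open_map_scale f m (e t : R) : (1 < size f)%N -> 0 < e -> f.[m] != 0 -> 0 < t ->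
  exists2 q, cmod (q - m) < e & exists2 s, 0 < s & s < t /\
    (f.[q] = (1 - s)%:C%C * f.[m]).
Proof.
move=> sf e0 f0 t0; have [d d0 hd] := open_map sf e0.
have fm : 0 < cmod f.[m] by rewrite cmod_gt0.
pose s := Num.min (t / 2) (d / 2 / cmod f.[m]).
have s0 : 0 < s by rewrite lt_min !divr_gt0.
have [|q fq qm] := hd m ((1 - s)%:C%C * f.[m]).
  rewrite -{1}[f.[m]]mul1r -mulrBl cmodM.
  rewrite (_ : 1 - (1 - s)%:C%C = s%:C%C); last by rewrite rmorphB /= rmorph1; ring.
  rewrite cmodC ger0_norm ?(ltW s0) //.
  apply: (@le_lt_trans _ _ (d / 2)); last by lra.
  by rewrite -ler_pdivlMr // ge_min lexx orbT.
exists q => //; exists s => //; split => //.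
by apply: (@le_lt_trans _ _ (t / 2)); [rewrite ge_min lexx | lra].
Qed.

Lemma open_map_away f m (e : R) : (1 < size f)%N -> 0 < e ->
  exists2 q, cmod (q - m) < e & cmod f.[m] < cmod f.[q].
Proof.
move=> sf e0; have [f0|f0] := eqVneq f.[m] 0.
  have [d d0 hd] := open_map sf e0.
  have [|q fq qm] := hd m (d / 2)%:C%C.
    by rewrite f0 sub0r cmodN cmodC ger0_norm; lra.
  by exists q => //; rewrite fq f0 cmod0 cmodC gtr0_norm; lra.
have [d d0 hd] := open_map sf e0.
have fm : 0 < cmod f.[m] by rewrite cmod_gt0.
pose s := (d / 2 / cmod f.[m]).
have s0 : 0 < s by rewrite !divr_gt0.
have [|q fq qm] := hd m ((1 + s)%:C%C * f.[m]).
  rewrite -{1}[f.[m]]mul1r -mulrBl cmodM.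
  rewrite (_ : 1 - (1 + s)%:C%C = - s%:C%C); last by rewrite rmorphD /= rmorph1; ring.
  rewrite cmodN cmodC ger0_norm ?(ltW s0) // /s mulfVK ?gt_eqF //; lra.
exists q => //; rewrite fq cmodM cmodC ger0_norm; last by lra.
by rewrite ltr_pMl //; lra.
Qed.

Lemma bounded_has_boundary A x M : A x -> (forall y, A y -> cmod y <= M) -> cclosed A ->
  exists2 b, A b & ~ interior_pt A b.
Proof.
move=> Ax AM cA; have cpt : ccompact A by split => //; exists M.
have [m Am hm] := poly_max_attained 'X cpt (ex_intro _ x Ax).
exists m => // -[e e0 he]; have [|q qm] := @open_map_away 'X m e _ e0; first by rewrite size_polyX.
by rewrite ltNge hm //; apply: he.
Qed.

Lemma max_principle A f x : ccompact A -> A x ->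
  exists2 b, A b & ~ interior_pt A b /\ cmod f.[x] <= cmod f.[b].
Proof.
move=> cA Ax; have [sf|sf] := ltnP 1 (size f).
  have [m Am hm] := poly_max_attained f cA (ex_intro _ x Ax).
  exists m => //; split; last exact: hm.
  by move=> [e e0 he]; have [q /he/hm] := open_map_away m sf e0; rewrite leNgt => /negP.
(* For a constant [f] any boundary point serves; one exists because a point of largest modulus
   cannot be interior. *)
have [cl [M AM]] := cA; have [b Ab nb] := bounded_has_boundary Ax AM cl.
by exists b => //; split => //; rewrite (size1_polyC sf) !hornerC.
Qed.

Lemma min_principle A f x : ccompact A -> A x ->
  (forall y, A y -> interior_pt A y -> f.[y] != 0) ->
  exists2 b, A b & ~ interior_pt A b /\ cmod f.[b] <= cmod f.[x].
Proof.
move=> cA Ax nz; have [sf|sf] := ltnP 1 (size f).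
  have [m Am hm] := poly_min_attained f cA (ex_intro _ x Ax).
  exists m => //; split; last exact: hm.
  move=> Im; have [e e0 he] := Im; have f0 := nz m Am Im.
  have [q /he/hm le [s s0 [s1 fq]]] := open_map_scale sf e0 f0 ltr01.
  move: le; rewrite fq cmodM cmodC ger0_norm; last by lra.
  by rewrite ler_pMl ?cmod_gt0 //; lra.
have [cl [M AM]] := cA; have [b Ab nb] := bounded_has_boundary Ax AM cl.
by exists b => //; split => //; rewrite (size1_polyC sf) !hornerC.
Qed.

End Sequences.

(** * Connected sets and the Riemann sphere *)

Section Connectedness.
Variable R : realType.
Local Notation C := R[i].
Implicit Types (x y z u v w p q a b l : C) (f : {poly C}) (e d r t : R).

Definition locconst (A P : C -> Prop) := forall x, A x ->
  exists2 e, 0 < e & forall y, A y -> cmod (y - x) < e -> (P x <-> P y).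

(** Connectedness, read as: a predicate locally constant on [A] is constant on [A]. In this form it
    serves as an induction principle, the predicate being chosen to suit. *)
Definition lconn (A : C -> Prop) := forall P, locconst A P ->
  forall x y, A x -> A y -> P x -> P y.

Lemma interval_connected (P : R -> Prop) :
  (forall t, 0 <= t <= 1 -> exists2 e, 0 < e &
     forall s, 0 <= s <= 1 -> `|s - t| < e -> (P t <-> P s)) ->
  P 0 -> P 1.
Proof.
move=> h P0; pose S : set R := [set t | 0 <= t <= 1 /\ forall s, 0 <= s <= t -> P s]%classic.
have S0 : S 0 by split; [rewrite lexx ler01 | move=> s h0; have -> : s = 0 by apply/eqP; rewrite eq_le andbC].
have hS : has_sup S by split; [exists 0 | exists 1 => t [/andP[]]].
have s01 : 0 <= sup S <= 1.
  apply/andP; split; first exact: sup_upper_bound.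
  by apply: ge_sup => [|t [/andP[]]//]; exists 0.
have [e e0 he] := h _ s01.
have [t [t01 tP] tS] := sup_adherent e0 hS.
have tle : t <= sup S by apply: sup_upper_bound.
have Pt : P t by apply: tP; case/andP: t01 => ->; rewrite lexx.
have Ps : P (sup S) by apply/(he t t01) => //; rewrite ltr_norml; lra.
have Pe s : 0 <= s <= 1 -> s < sup S + e -> P s.
  move=> s1 lt; have [st|ts] := leP s t; first by apply: tP; case/andP: s1 => ->.
  by apply/(he s s1) => //; rewrite ltr_norml; lra.
have [lt|] := ltP (sup S + e / 2) 1; last first.
  by move=> le; apply: Pe; [rewrite ler01 lexx | lra].
have : S (sup S + e / 2).
  split; first by have : 0 < e / 2 by [lra]; lra.
  by move=> s s1; apply: Pe; lra.
move=> /(sup_upper_bound hS); lra.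
Qed.

Definition seg x y t : C := x + t%:C%C * (y - x).

Lemma seg0 x y : seg x y 0 = x. Proof. by rewrite /seg rmorph0 mul0r addr0. Qed.
Lemma seg1 x y : seg x y 1 = y. Proof. by rewrite /seg rmorph1; ring. Qed.

Lemma seg_sub x y s t : cmod (seg x y s - seg x y t) = `|s - t| * cmod (y - x).
Proof.
rewrite -cmodC -cmodM rmorphB /=; congr cmod; rewrite /seg; ring.
Qed.

Lemma seg_dist_l x y t : 0 <= t <= 1 -> cmod (seg x y t - x) <= cmod (y - x).
Proof.
move=> /andP[t0 t1]; rewrite -{2}(seg0 x y) seg_sub subr0 ger0_norm //.
by rewrite ler_piMl ?cmod_ge0.
Qed.

Lemma seg_dist_r x y t : 0 <= t <= 1 -> cmod (seg x y t - y) <= cmod (y - x).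
Proof.
move=> /andP[t0 t1]; rewrite -{2}(seg1 x y) seg_sub -normrN opprB ger0_norm ?subr_ge0 //.
by rewrite ler_piMl ?cmod_ge0 // lerBlDr lerDl.
Qed.

Lemma seg_ball c r x y t : 0 <= t <= 1 -> cmod (x - c) < r -> cmod (y - c) < r ->
  cmod (seg x y t - c) < r.
Proof.
move=> /andP[t0 t1] hx hy.
have -> : seg x y t - c = (1 - t)%:C%C * (x - c) + t%:C%C * (y - c).
  by rewrite /seg rmorphB rmorph1; ring.
apply: le_lt_trans (cmodD _ _) _; rewrite !cmodM !cmodC !ger0_norm ?subr_ge0 //.
have [->|tn] := eqVneq t 0; first by rewrite subr0 mul1r mul0r addr0.
have : 0 < t by rewrite lt_def tn.
nra.
Qed.

Lemma seg_locconst (A P : C -> Prop) x y : locconst A P ->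
  (forall t, 0 <= t <= 1 -> A (seg x y t)) -> P x -> P y.
Proof.
move=> lc hA; have := @interval_connected (fun t => P (seg x y t)); rewrite seg0 seg1; apply.
move=> t t01; have [e e0 he] := lc _ (hA t t01).
have k0 : 0 < cmod (y - x) + 1 by rewrite ltr_wpDl ?cmod_ge0.
exists (e / (cmod (y - x) + 1)); first by rewrite divr_gt0.
move=> s s01 lt; apply: he; first exact: hA.
rewrite seg_sub; move: lt; rewrite ltr_pdivlMr //; apply: le_lt_trans.
by rewrite ler_wpM2l // lerDl.
Qed.

Lemma convex_lconn A : (forall x y t, A x -> A y -> 0 <= t <= 1 -> A (seg x y t)) -> lconn A.
Proof. by move=> h P lc x y Ax Ay; apply: (seg_locconst lc) => t; apply: h. Qed.

Lemma ball_lconn c r : lconn (fun x => cmod (x - c) < r).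
Proof. by apply: convex_lconn => x y t hx hy t01; apply: seg_ball. Qed.

Lemma lconn_image A (F : C -> C) :
  (forall x, A x -> forall e, 0 < e -> exists2 d, 0 < d &
     forall y, A y -> cmod (y - x) < d -> cmod (F y - F x) < e) ->
  lconn A -> lconn (fun y => exists2 x, A x & y = F x).
Proof.
move=> cF cA P lc _ _ [x Ax ->] [y Ay ->]; apply: (cA (P \o F)) => // z Az.
have [|e e0 he] := lc (F z); first by exists z.
have [d d0 hd] := cF z Az e e0; exists d => // w Aw wz; apply: he; last exact: hd.
by exists w.
Qed.

Lemma lconn_poly_image A f : lconn A -> lconn (fun y => exists2 x, A x & y = f.[x]).
Proof.
apply: lconn_image => x _ e e0; have [d d0 hd] := poly_cont f x e0.
by exists d => // y _; apply: hd.
Qed.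

Lemma lconn_union A B x : lconn A -> lconn B -> A x -> B x -> lconn (fun y => A y \/ B y).
Proof.
move=> cA cB Ax Bx P lc.
have lA : locconst A P.
  by move=> z Az; have [|e e0 he] := lc z; [left|exists e => // y Ay; apply: he; left].
have lB : locconst B P.
  by move=> z Az; have [|e e0 he] := lc z; [right|exists e => // y Ay; apply: he; right].
move=> u v; case=> hu; case=> hv Pu.
- exact: (cA P lA u).
- by apply: (cB P lB x) => //; apply: (cA P lA u).
- by apply: (cA P lA x) => //; apply: (cB P lB u).
exact: (cB P lB u).
Qed.

Lemma segment_boundary A x y : A x -> ~ A y ->
  exists2 t, 0 <= t <= 1 & cboundary A (seg x y t).
Proof.
move=> Ax nAy; apply: contrapT => h; apply: nAy.
apply: (@seg_locconst (fun z => exists2 t, 0 <= t <= 1 & z = seg x y t) A x y) Ax; last first.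
  by move=> t t01; exists t.
move=> _ [t t01 ->]; have : ~ cboundary A (seg x y t) by move=> ?; apply: h; exists t.
move=> nb; apply: contrapT => ne; apply: nb => e e0; split; apply: contrapT => h1.
- apply: ne; exists e => // z zt lt; rewrite cmodBC in lt.
  have h2 w : cmod (seg x y t - w) < e -> ~ A w by move=> lw Aw; apply: h1; exists w.
  have : ~ A z by apply: h2.
  have : ~ A (seg x y t) by apply: h2; rewrite subrr cmod0.
  by [].
- apply: ne; exists e => // z zt lt; rewrite cmodBC in lt.
  have h2 w : cmod (seg x y t - w) < e -> A w.
    by move=> lw; apply: contrapT => nA; apply: h1; exists w.
  have : A z by apply: h2.
  have : A (seg x y t) by apply: h2; rewrite subrr cmod0.
  by [].
Qed.

Lemma seg_norm_ivt (F : C -> R) x y r :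
  (forall t, 0 <= t <= 1 -> forall e, 0 < e -> exists2 d, 0 < d &
     forall s, 0 <= s <= 1 -> `|s - t| < d -> `|F (seg x y s) - F (seg x y t)| < e) ->
  F x <= r -> r <= F y -> exists2 t, 0 <= t <= 1 & F (seg x y t) = r.
Proof.
move=> cF xr ry; apply: contrapT => h.
have ne t : 0 <= t <= 1 -> F (seg x y t) <> r by move=> t01 E; apply: h; exists t.
have := @interval_connected (fun t => F (seg x y t) < r).
rewrite seg0 seg1 => H.
have : F y < r.
  apply: H => [t t01|]; last first.
    rewrite lt_neqAle xr andbT; apply/eqP => E; apply: (ne 0); rewrite ?lexx ?ler01 ?seg0 //.
  have n0 : 0 < `|F (seg x y t) - r| by rewrite normr_gt0 subr_eq0; apply/eqP/ne.
  have [d d0 hd] := cF t t01 _ n0; exists d => // s s01 /(hd s s01).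
  have := ne s s01; move=> ?.
  by rewrite ltr_norml; case: (ltrgtP (F (seg x y t)) r) => hh; rewrite ?ltr0_norm ?gtr0_norm ?subr_gt0 ?subr_lt0 //; move=> ?; split=> ?; lra.
by rewrite ltNge ry.
Qed.

Lemma poly_seg_ivt f x y r : cmod f.[x] <= r -> r <= cmod f.[y] ->
  exists2 t, 0 <= t <= 1 & cmod f.[seg x y t] = r.
Proof.
apply: (@seg_norm_ivt (fun z => cmod f.[z])) => t t01 e e0.
have [d d0 hd] := poly_norm_cont f (seg x y t) e0.
have k0 : 0 < cmod (y - x) + 1 by rewrite ltr_wpDl ?cmod_ge0.
exists (d / (cmod (y - x) + 1)); first by rewrite divr_gt0.
move=> s s01 lt; apply: hd.
rewrite seg_sub; move: lt; rewrite ltr_pdivlMr //; apply: le_lt_trans.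
by rewrite ler_wpM2l // lerDl.
Qed.

Inductive chain (J : C -> Prop) (e : R) (x : C) : C -> Prop :=
| chain_refl : J x -> chain J e x x
| chain_step y z : chain J e x y -> J z -> cmod (z - y) < e -> chain J e x z.

Lemma chain_in J e x y : chain J e x y -> J x /\ J y.
Proof. by elim=> [//|{}y z _ []]. Qed.

Lemma chain_trans J e y x z : chain J e x y -> chain J e y z -> chain J e x z.
Proof. by move=> h; elim=> // u v _ h1 Jv uv; apply: chain_step h1 Jv uv. Qed.

Lemma chain1 J e x y : J x -> J y -> cmod (y - x) < e -> chain J e x y.
Proof. by move=> Jx; apply: chain_step; apply: chain_refl. Qed.

Lemma chain_sym J e x y : chain J e x y -> chain J e y x.
Proof.
elim=> [h|{}y z h1 h2 Jz lt]; first exact: chain_refl.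
apply: chain_trans h2; apply: chain1 => //; last by rewrite cmodBC.
by have [] := chain_in h1.
Qed.

Lemma chain_le J e d x y : e <= d -> chain J e x y -> chain J d x y.
Proof.
move=> ed; elim=> [h|{}y z h1 h2 Jz lt]; first exact: chain_refl.
by apply: chain_step h2 Jz _; apply: lt_le_trans ed.
Qed.

Lemma chain_sub (J J' : C -> Prop) e x y : (forall z, J z -> J' z) -> chain J e x y -> chain J' e x y.
Proof.
move=> JJ; elim=> [h|{}y z h1 h2 Jz lt]; first by apply/chain_refl/JJ.
by apply: chain_step h2 (JJ _ Jz) _.
Qed.

Lemma lconn_chain A e x y : lconn A -> 0 < e -> A x -> A y -> chain A e x y.
Proof.
move=> cA e0 Ax Ay; apply: (cA (chain A e x) _ x y) => //; last exact: chain_refl.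
move=> z Az; exists e => // w Aw lt; split=> h; first exact: chain_step h Aw lt.
by apply: chain_step h Az _; rewrite cmodBC.
Qed.

(* The points that are [e]-chained to [x] for all [e] form its quasi-component. *)
Lemma chain_lconn J x : ccompact J -> J x -> exists B,
  [/\ lconn B, (forall z, B z -> J z) &
      forall y, B y <-> (forall e, 0 < e -> chain J e x y)].
Proof.
move=> cJ Jx; pose B y := forall e, 0 < e -> chain J e x y.
have BJ z : B z -> J z by move=> h; have [] := chain_in (h 1 ltr01).
exists B; split => //; move=> P lc a b Ba Bb Pa; apply: contrapT => nPb.
have clB q : J q -> (forall e, 0 < e -> exists2 y, B y & cmod (y - q) < e) -> B q.
  by move=> Jq h e e0; have [y By lt] := h e e0; apply: chain_step (By e e0) Jq _; rewrite cmodBC.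
(* By compactness a gap of width [3 * e0] separates the part of [B] where [P] holds from the part
   where it fails. *)
have [e0 e00 sep] : exists2 e0, 0 < e0 & forall q q', B q -> B q' -> P q -> cmod (q' - q) < 3 * e0 -> P q'.
  apply: contrapT => nh.
  have [|l Jl hl] := @compact_cluster R J (fun e q => [/\ B q, P q & exists q', [/\ B q', ~ P q' & cmod (q' - q) < 3 * e]]) cJ.
    move=> e e0; apply: contrapT => ne; apply: nh; exists e => // q q' Bq Bq' Pq lt.
    by apply: contrapT => nP; apply: ne; exists q; [exact: BJ|split => //; exists q'].
  have Bl : B l.
    by apply: clB => // e /hl[_ [q [_ _ ? _ [? _ _]]]]; exists q.
  have [e e0 he] := lc l Bl.
  have [|d [q [d0 de ql _ [Bq Pq [q' [Bq' nPq' lt]]]]]] := hl (e / 4); first by lra.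
  apply: nPq'; apply/(he q' Bq'); last by apply/(he q Bq) => //; lra.
  by have := cmod_tri q q' l; lra.
(* Fine chains from [a] to [b] must leave the [e0]-neighbourhood of the [P]-part of [B]. First exit
   points cluster at some [l] in [B]; being within [3 * e0] of the [P]-part, [l] belongs to it,
   although exit points near [l] keep distance [e0] from that part. *)
have [|l Jl hl] := @compact_cluster R J (fun e p => chain J e x p /\
    (exists2 q, B q /\ P q & cmod (p - q) < e0 + e) /\ forall q, B q -> P q -> e0 <= cmod (p - q)) cJ.
  move=> e ep; apply: contrapT => ne.
  have [q [Bq Pq] bq] : exists2 q, B q /\ P q & cmod (b - q) < e0.
    have cab : chain J e a b by apply: chain_trans (chain_sym (Ba e ep)) (Bb e ep).
    elim: cab => [|y z cy [q [Bq Pq] yq] Jz lt].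
      by exists a => //; rewrite subrr cmod0.
    apply: contrapT => nq; apply: ne; exists z => //; split; first exact: chain_trans (Ba e ep) (chain_step cy Jz lt).
    split; first by exists q => //; have := cmod_tri y z q; lra.
    by move=> q' Bq' Pq'; rewrite leNgt; apply/negP => h; apply: nq; exists q'.
  by apply: nPb; apply: (sep q b) => //; lra.
have Bl : B l.
  move=> e ep; have [d [p [d0 de pl Jp [cp _]]]] := hl e ep.
  apply: chain_step (chain_le (ltW de) cp) Jl _; by rewrite cmodBC.
have [d [p [d0 de pl Jp [cp [[q [Bq Pq] pq] far]]]]] := hl e0 e00.
have Pl : P l by apply: (sep q l) => //; have := cmod_tri p l q; rewrite (cmodBC l p); lra.
by have := far l Bl Pl; rewrite leNgt pl.
Qed.

End Connectedness.

Section Sphere.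
Variable R : realType.
Local Notation C := R[i].
Implicit Types (x y z v w a b : C) (e r M t : R) (s : sphere R).

Lemma sq1_gt0 a : 0 < 1 + cmod a ^+ 2.
Proof. by rewrite ltr_wpDr ?sqr_ge0. Qed.

Definition sq1 a : R := Num.sqrt (1 + cmod a ^+ 2).

Lemma sq1_pos a : 0 < sq1 a. Proof. by rewrite sqrtr_gt0 sq1_gt0. Qed.

Lemma sq1_sqr a : sq1 a ^+ 2 = 1 + cmod a ^+ 2.
Proof. by rewrite sqr_sqrtr // ltW // sq1_gt0. Qed.

Lemma sq1_ge1 a : 1 <= sq1 a.
Proof. by rewrite -(@ler_pXn2r _ 2) ?nnegrE ?ler01 ?(ltW (sq1_pos _)) // sq1_sqr expr1n lerDl sqr_ge0. Qed.

Lemma sq1_ge a : cmod a <= sq1 a.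
Proof.
rewrite -(@ler_pXn2r _ 2) ?nnegrE ?cmod_ge0 ?(ltW (sq1_pos _)) // sq1_sqr.
by rewrite lerDr.
Qed.

Lemma sq1_le a : sq1 a <= 1 + cmod a.
Proof.
have := cmod_ge0 a => h; rewrite -(@ler_pXn2r _ 2) ?nnegrE ?(ltW (sq1_pos _)) ?addr_ge0 // sq1_sqr.
by rewrite sqrrD expr1n mul1r; lra.
Qed.

Lemma sq1_tri a b : sq1 a <= cmod (a - b) + sq1 b.
Proof.
have := cmod_ge0 (a - b); have := sq1_pos b => h1 h2.
rewrite -(@ler_pXn2r _ 2) ?nnegrE ?(ltW (sq1_pos _)) ?addr_ge0 //; last by lra.
have := sq1_sqr b; have := sq1_sqr a; have := sq1_ge b; have := cmod_le_sub a b.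
have := cmod_ge0 a; have := cmod_ge0 b.
set A := cmod a; set B := cmod b; set D := cmod (a - b) in h2 *; set S := sq1 b in h1 *; set T := sq1 a.
rewrite !expr2; nra.
Qed.

Lemma chordE a b : chord (Some a) (Some b) = 2 * cmod (a - b) / (sq1 a * sq1 b).
Proof. by rewrite /= sqrtrM // ltW // sq1_gt0. Qed.

Lemma chord_inf a : chord (Some a) None = 2 / sq1 a. Proof. by []. Qed.
Lemma chord_inf' a : chord None (Some a) = 2 / sq1 a. Proof. by []. Qed.

Lemma chordC s s' : chord s s' = chord s' s.
Proof. by case: s s' => [a|] [b|] //; rewrite !chordE cmodBC [sq1 a * _]mulrC. Qed.

Lemma chord_refl s : chord s s = 0.
Proof. by case: s => // a; rewrite chordE subrr cmod0 mulr0 mul0r. Qed.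

Lemma chord_le a b : chord (Some a) (Some b) <= 2 * cmod (a - b).
Proof.
rewrite chordE ler_pdivrMr ?mulr_gt0 ?sq1_pos // ler_peMr ?mulr_ge0 ?cmod_ge0 //.
by have := sq1_ge1 a; have := sq1_ge1 b; nra.
Qed.

(** Cauchy-Schwarz for the vectors [(1, b)] and [(1, c)]; the squares of the two sides differ by the
    squared modulus of [b - c]. *)
Lemma cs_bound b c : cmod (1 + c^*%C * b) <= sq1 b * sq1 c.
Proof.
rewrite -(@ler_pXn2r _ 2) ?nnegrE ?cmod_ge0 ?mulr_ge0 ?(ltW (sq1_pos _)) // exprMn !sq1_sqr.
rewrite !cmod_sqr; case: b c => [b1 b2] [c1 c2] /=.
rewrite -subr_ge0 (_ : _ - _ = (b1 - c1) ^+ 2 + (b2 - c2)^+2); last by ring.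
by rewrite addr_ge0 ?sqr_ge0.
Qed.

(* [(a - b)(1 + |c|^2) = (a - c)(1 + c^* b) + (c - b)(1 + c^* a)], with
   Cauchy-Schwarz for the factors [1 + c^* b] and [1 + c^* a]. *)
Lemma chord_tri_fin a b c : cmod (a - b) * sq1 c <= cmod (a - c) * sq1 b + cmod (c - b) * sq1 a.
Proof.
have h : cmod (a - b) * sq1 c ^+ 2 <= (cmod (a - c) * sq1 b + cmod (c - b) * sq1 a) * sq1 c.
  have -> : cmod (a - b) * sq1 c ^+ 2 = cmod ((a - c) * (1 + c^*%C * b) + (c - b) * (1 + c^*%C * a)).
    rewrite sq1_sqr -(ger0_norm (ltW (sq1_gt0 c))) -cmodC -cmodM; congr cmod.
    rewrite (_ : (1 + cmod c ^+ 2)%:C%C = 1 + c * c^*%C); first by ring.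
    rewrite rmorphD rmorph1 cmod_sqr; congr (_ + _); case: c => c1 c2 /=.
    apply/eqP; rewrite eq_complex /=; apply/andP; split; apply/eqP; ring.
  apply: le_trans (cmodD _ _) _; rewrite !cmodM mulrDl -!mulrA.
  by apply: lerD; rewrite ler_wpM2l ?cmod_ge0 ?cs_bound.
by move: h; rewrite expr2 mulrA ler_pM2r ?sq1_pos.
Qed.

Lemma chord_tri s2 s1 s3 : chord s1 s3 <= chord s1 s2 + chord s2 s3.
Proof.
have inf a c : chord (Some a) None <= chord (Some a) (Some c) + chord (Some c) None.
  have := sq1_tri c a; rewrite chordE !chord_inf cmodBC => h.
  have := sq1_pos a; have := sq1_pos c => hc ha; rewrite -(ler_pM2r (mulr_gt0 ha hc)).
  have -> : 2 / sq1 a * (sq1 a * sq1 c) = 2 * sq1 c by field; rewrite !gt_eqF.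
  have -> : (2 * cmod (a - c) / (sq1 a * sq1 c) + 2 / sq1 c) * (sq1 a * sq1 c) = 2 * (cmod (a - c) + sq1 a) by field; rewrite !gt_eqF.
  lra.
case: s1 s2 s3 => [a|] [c|] [b|] //; rewrite ?chord_refl ?addr0 ?add0r //.
- have := chord_tri_fin a b c; rewrite !chordE => h.
  have := sq1_pos a; have := sq1_pos b; have := sq1_pos c => hc hb ha.
  rewrite -(ler_pM2r (mulr_gt0 (mulr_gt0 ha hb) hc)).
  have -> : 2 * cmod (a - b) / (sq1 a * sq1 b) * (sq1 a * sq1 b * sq1 c) = 2 * (cmod (a - b) * sq1 c).
    by field; rewrite !gt_eqF.
  have -> : (2 * cmod (a - c) / (sq1 a * sq1 c) + 2 * cmod (c - b) / (sq1 c * sq1 b)) * (sq1 a * sq1 b * sq1 c) = 2 * (cmod (a - c) * sq1 b + cmod (c - b) * sq1 a).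
    by field; rewrite !gt_eqF.
  lra.
- have := sq1_ge a; have := sq1_ge b; have := cmodB a b; rewrite chordE chord_inf chord_inf' => h1 h2 h3.
  have := sq1_pos a; have := sq1_pos b => hb ha.
  rewrite -(ler_pM2r (mulr_gt0 ha hb)).
  have -> : 2 * cmod (a - b) / (sq1 a * sq1 b) * (sq1 a * sq1 b) = 2 * cmod (a - b) by field; rewrite !gt_eqF.
  have -> : (2 / sq1 a + 2 / sq1 b) * (sq1 a * sq1 b) = 2 * (sq1 a + sq1 b) by field; rewrite !gt_eqF.
  lra.
- by have := inf b c; rewrite (chordC (Some b) None) (chordC (Some b) (Some c)) (chordC (Some c) None) addrC.
- by rewrite chord_inf' chord_inf addr_ge0 // divr_ge0 // ltW // sq1_pos.
Qed.

(** Chordal closeness to a point of a bounded set gives Euclidean closeness, uniformly, and excludes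
    infinity; the reverse comparison [chord_le] is global. *)
Lemma chord_small M e : 0 < e -> exists2 r, 0 < r & forall a s, cmod a <= M ->
  chord (Some a) s < r -> exists2 b, s = Some b & cmod (b - a) < e.
Proof.
move=> e0; have [M0|M0] := ltP M 0.
  by exists 1 => // a s /le_lt_trans/(_ M0); rewrite ltNge cmod_ge0.
have K0 : 0 < 1 + M by lra.
have L0 : 0 < 1 + M + e by lra.
exists (2 * e / ((1 + M) * (1 + M + e))); first by rewrite divr_gt0 ?mulr_gt0.
move=> a s aM; have hA : sq1 a <= 1 + M by have := sq1_le a; lra.
have a0 := sq1_pos a.
case: s => [b|].
  rewrite chordE => lt; exists b => //; rewrite ltNge; apply/negP => le.
  have b0 := sq1_pos b.
  have := sq1_tri b a => hb.
  move: lt; rewrite ltr_pdivrMr ?mulr_gt0 // mulrAC ltr_pdivlMr ?mulr_gt0 // ltNge => /negP; apply.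
  rewrite (cmodBC a); set t := cmod (b - a) in le hb *.
  have h1 : sq1 b <= t + (1 + M) by lra.
  have h2 : sq1 a * sq1 b <= (1 + M) * (t + (1 + M)) by apply: ler_pM => //; lra.
  apply: (@le_trans _ _ (2 * e * ((1 + M) * (t + (1 + M))))); first by rewrite ler_wpM2l //; lra.
  rewrite -subr_ge0 (_ : _ - _ = 2 * (1 + M) * (1 + M) * (t - e)); last by ring.
  by rewrite !mulr_ge0 ?subr_ge0 // ltW.
rewrite chord_inf => lt; exfalso; move: lt; rewrite ltr_pdivrMr // mulrAC ltr_pdivlMr ?mulr_gt0 // ltNge => /negP; apply.
by nra.
Qed.

Lemma chord_inf_big M : exists2 r, 0 < r & forall a, chord (Some a) None < r -> M < cmod a.
Proof.
exists (2 / (1 + `|M|)); first by rewrite divr_gt0 // ltr_wpDr.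
move=> a; rewrite chord_inf ltr_pM2l // ltf_pV2 ?posrE ?sq1_pos ?ltr_wpDr // => h.
have := sq1_le a; have := ler_norm M; lra.
Qed.

Lemma big_chord_inf r : 0 < r -> exists2 M, 0 < M & forall a, M <= cmod a -> chord (Some a) None < r.
Proof.
move=> r0; exists (4 / r); first by rewrite divr_gt0.
move=> a h; rewrite chord_inf ltr_pdivrMr ?sq1_pos //.
have : 4 / r <= sq1 a by apply: le_trans h (sq1_ge _).
by rewrite ler_pdivrMr // mulrC; lra.
Qed.

Definition emb (A : C -> Prop) : sphere R -> Prop :=
  fun s => if s is Some x then A x else False.

Lemma sopen_emb A : (forall x, A x -> interior_pt A x) -> sopen (emb A).
Proof.
move=> oA [x|//] /= /oA[e e0 he]; have [r r0 hr] := chord_small (cmod x) e0.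
by exists r => // w /hr[//|b -> /he].
Qed.

Lemma emb_ball_open z r : sopen (emb (fun x => cmod (x - z) < r)).
Proof.
apply: sopen_emb => x xz; exists (r - cmod (x - z)); first by rewrite subr_gt0.
by move=> y yx; have := cmod_tri x y z; lra.
Qed.

Lemma sopen_interior (U : sphere R -> Prop) x : sopen U -> U (Some x) ->
  interior_pt (fun y => U (Some y)) x.
Proof.
move=> oU /oU[r r0 hr]; exists (r / 2); first by rewrite divr_gt0.
move=> y yx; apply: hr; apply: le_lt_trans (chord_le _ _) _; rewrite cmodBC; lra.
Qed.

Lemma lconn_sconnected A : lconn A -> sconnected (emb A).
Proof.
move=> cA [U [V [[oU oV] cov [[x|//] Ax Ux] [[y|//] Ay Vy] dis]]].
apply: (dis (Some y) Ay) => //; move: Ux; apply: (cA (fun z => U (Some z)) _ x y) => //.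
move=> z Az; have [Uz|Vz] := cov (Some z) Az.
  have [e e0 he] := sopen_interior oU Uz; exists e => // w Aw /he Uw; by split.
have [e e0 he] := sopen_interior oV Vz; exists e => // w Aw /he Vw; split=> Uw.
  by case: (dis (Some z)).
by case: (dis (Some w)).
Qed.

Lemma sconnected_lconn (S : sphere R -> Prop) : ~ S None -> sconnected S ->
  lconn (fun x => S (Some x)).
Proof.
move=> nS cS P lc x y Sx Sy Px; apply: contrapT => nPy; apply: cS.
(* The union of balls centred in [Q] on which [Q] persists within [S]: open, and within [S] it stays
   in [Q]. Disjointness is demanded only on [S], so radii need not be halved. *)
pose W (Q : C -> Prop) : C -> Prop := fun w => exists a e, [/\ S (Some a), Q a, 0 < e,
  (forall y, S (Some y) -> cmod (y - a) < e -> Q y) & cmod (w - a) < e].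
have oW Q : sopen (emb (W Q)).
  apply: sopen_emb => w [a [e [Sa Qa e0 he wa]]]; exists (e - cmod (w - a)); first by rewrite subr_gt0.
  by move=> v vw; exists a, e; split => //; have := cmod_tri w v a; lra.
have Win Q a : S (Some a) -> (exists2 e, 0 < e & forall y, S (Some y) -> cmod (y - a) < e -> Q y) -> W Q a.
  move=> Sa [e e0 he]; exists a, e; rewrite subrr cmod0; split => //.
  by apply: he => //; rewrite subrr cmod0.
have WQ Q a : S (Some a) -> W Q a -> Q a by move=> Sa [b [e [_ _ _ h1 h2]]]; apply: h1.
have WP a : S (Some a) -> P a -> W P a.
  by move=> Sa Pa; apply: Win => //; have [e e0 he] := lc a Sa; exists e => // z Sz /he -/(_ Sz)[]; auto.
have WnP a : S (Some a) -> ~ P a -> W (fun a => ~ P a) a.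
  by move=> Sa Pa; apply: Win => //; have [e e0 he] := lc a Sa; exists e => // z Sz /he -/(_ Sz)[]; auto.
exists (emb (W P)), (emb (W (fun a => ~ P a))); split => //.
- move=> [z Sz|//]; have [Pz|nPz] := pselect (P z); [left; exact: WP | right; exact: WnP].
- by exists (Some x) => //; apply: WP.
- by exists (Some y) => //; apply: WnP.
- by move=> [z|//] Sz /= /WQ Pz /WQ nPz; apply: nPz => //; apply: Pz.
Qed.

Lemma scomponent_lconn (A : sphere R -> Prop) (x : sphere R) y z : ~ A None ->
  scomponent A x (Some y) -> scomponent A x (Some z) ->
  exists B : C -> Prop, [/\ lconn B, (forall v, B v -> A (Some v)), B y & B z].
Proof.
move=> nA [B1 [c1 s1 x1 y1]] [B2 [c2 s2 x2 z2]].
case: x x1 x2 => [x|] x1 x2; last by case: nA; apply: s1.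
exists (fun v => B1 (Some v) \/ B2 (Some v)); split; [|by move=> v [/s1|/s2]|by left|by right].
apply: (@lconn_union R (fun v => B1 (Some v)) (fun v => B2 (Some v)) x) => //.
  by apply: sconnected_lconn c1 => /s1.
by apply: sconnected_lconn c2 => /s2.
Qed.

Lemma lconn_scomponent (A : sphere R -> Prop) (B : C -> Prop) x y : lconn B ->
  (forall v, B v -> A (Some v)) -> B x -> B y -> scomponent A (Some x) (Some y).
Proof.
move=> cB BA Bx By; exists (emb B); split => //; first exact: lconn_sconnected.
by move=> [v /BA|].
Qed.

Lemma scomponent_sub (A : sphere R -> Prop) (x y : sphere R) : scomponent A x y -> A y.
Proof. by move=> [B [_ BA _ By]]; apply: BA. Qed.

Lemma scomponent_refl (A : sphere R -> Prop) (x : sphere R) : A x -> scomponent A x x.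
Proof.
move=> Ax; exists (fun y : sphere R => y = x); split => // [|z ->//].
by move=> [U [V [_ _ [_ -> Ux] [_ -> Vx] dis]]]; apply: (dis x).
Qed.

End Sphere.

(** * Normal families of polynomials *)

Section Normality.
Variable R : realType.
Local Notation C := R[i].
Implicit Types (x y z u v w p q a b l : C) (f g : {poly C}) (e d r M t : R) (s : sphere R).
Implicit Types (S : {poly C} -> Prop).

Lemma poly_infty f M : (1 < size f)%N -> exists2 K, 0 < K & forall x, K <= cmod x -> M <= cmod f.[x].
Proof.
move=> sf; have [s [sz _ hs]] := subC_split 0 sf.
have [K K0 hK] : exists2 K, 0 <= K & forall z, z \in s -> cmod z <= K.
  elim: s {sz hs} => [|z s [K K0 IH]]; first by exists 0.
  exists (K + cmod z); first by rewrite addr_ge0 ?cmod_ge0.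
  move=> w; rewrite inE => /orP[/eqP->|/IH]; first by rewrite lerDr.
  by move=> h; apply: le_trans h _; rewrite lerDl cmod_ge0.
have a0 := lead_gt0 sf; set a := cmod _ in a0.
have M0 := normr_ge0 M.
exists (K + (1 + `|M| / a)); first by rewrite ltr_wpDl // ltr_wpDr ?divr_ge0 ?(ltW a0).
move=> x hx; rewrite -[f.[x]]subr0 hs -/a.
apply: le_trans (ler_norm M) _.
have c1 : 1 <= 1 + `|M| / a by rewrite lerDl divr_ge0 // ltW.
apply: (@le_trans _ _ (a * (1 + `|M| / a))); first by rewrite mulrDr mulr1 mulrCA divff ?gt_eqF // mulr1 lerDr ltW.
rewrite ler_wpM2l ?(ltW a0) //.
apply: (@le_trans _ _ ((1 + `|M| / a) ^+ size s)).
  have : (0 < size s)%N by rewrite sz; case: size sf => [|[]].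
  by case: (size s) => // n _; rewrite exprS ler_peMr ?exprn_ege1 // (le_trans ler01).
apply: prod_ge_exp => [|z /hK zK]; first exact: le_trans ler01 c1.
have := cmod_le_sub x z; lra.
Qed.

Lemma peval_cont f s e : 0 < e -> exists2 d : R, 0 < d &
  forall s', chord s s' < d -> chord (peval f s) (peval f s') < e.
Proof.
move=> e0; case: s => [a|].
  have [d d0 hd] := poly_cont f a (divr_gt0 e0 (ltr0n R 2)).
  have [r r0 hr] := chord_small (cmod a) d0.
  exists r => // s' /hr-/(_ (lexx _))[b -> /hd lt] /=.
  by apply: le_lt_trans (chord_le _ _) _; rewrite cmodBC; lra.
have [sf|sf] := leqP (size f) 1.
  exists 1 => // s' _; have -> : peval f s' = Some f`_0.
    by case: s' => [b|] /=; rewrite ?sf // {1}(size1_polyC sf) hornerC.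
  by rewrite /= sf chord_refl.
have [T T0 hT] := big_chord_inf e0; have [K K0 hK] := poly_infty T sf.
have [r r0 hr] := chord_inf_big K.
have pN : peval f None = None by rewrite /peval leqNgt sf.
exists r => // -[b|] lt; rewrite pN ?chord_refl // chordC.
by apply/hT/hK/ltW/hr; rewrite chordC.
Qed.

Definition scvg (u : nat -> sphere R) (l : sphere R) := forall e, 0 < e ->
  exists N, forall n, (N <= n)%N -> chord (u n) l < e.

Lemma sphere_compact (u : nat -> sphere R) :
  exists2 phi, incr phi & exists l : sphere R, scvg (u \o phi) l.
Proof.
have [[k [N h]]|h] := pselect (exists k N, forall n, (N <= n)%N -> exists2 a, u n = Some a & cmod a <= k%:R).
  have /choice[v hv] : forall n, exists a, u (N + n)%N = Some a /\ cmod a <= k%:R.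
    by move=> n; have [|a ? ?] := h (N + n)%N; [exact: leq_addr | exists a].
  have [phi ip [l hl]] := bolzano_weierstrass (fun n => (hv n).2).
  exists (fun n => (N + phi n)%N); first by move=> n; rewrite ltn_add2l.
  exists (Some l) => e e0; have [M hM] := hl (e / 2) (divr_gt0 e0 (ltr0n R 2)).
  exists M => n /hM /= lt; rewrite (hv (phi n)).1.
  by apply: le_lt_trans (chord_le _ _) _; lra.
have [phi ip hp] : exists2 phi, incr phi & forall k, ~ (exists2 a, u (phi k) = Some a & cmod a <= k%:R).
  apply: (@subseq_choose (fun k n => ~ (exists2 a, u n = Some a & cmod a <= k%:R))) => k N.
  apply: contrapT => ne; apply: h; exists k, N => n Nn; apply: contrapT => h1; apply: ne; by exists n.
exists phi => //; exists None => e e0; have [T T0 hT] := big_chord_inf e0.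
exists (Num.bound T) => n hn /=; have := hp n; case: (u (phi n)) => [a|] ne; last by rewrite chord_refl.
apply: hT; rewrite leNgt; apply/negP => lt; apply: ne; exists a => //.
apply: ltW; apply: lt_le_trans lt _; apply: le_trans (ltW (archi_boundP (ltW T0))) _.
by rewrite ler_nat.
Qed.

Lemma sphere_complete (u : nat -> sphere R) :
  (forall e, 0 < e -> exists N, forall m n, (N <= m)%N -> (N <= n)%N -> chord (u m) (u n) < e) ->
  exists l : sphere R, scvg u l.
Proof.
move=> h; have [phi ip [l hl]] := sphere_compact u; exists l => e e0.
have e20 : 0 < e / 2 by rewrite divr_gt0.
have [N1 h1] := h _ e20; have [N2 h2] := hl _ e20; exists N1 => n Nn.
pose m := maxn N1 N2.
have a1 := h1 n (phi m) Nn (leq_trans (leq_maxl _ _) (incr_ge m ip)).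
have a2 := h2 m (leq_maxr _ _).
by apply: le_lt_trans (chord_tri (u (phi m)) _ _) _; move: a2 => /=; lra.
Qed.

Lemma diagonal (u : nat -> nat -> sphere R) :
  exists2 phi, incr phi & forall k, exists l : sphere R, scvg (fun n => u (phi n) k) l.
Proof.
have /choice[Psi hPsi] : forall kp : nat * (nat -> nat), exists psi, incr psi /\
    exists l : sphere R, scvg (fun n => u (kp.2 (psi n)) kp.1) l.
  move=> [k phi]; have [psi ip [l hl]] := sphere_compact (fun n => u (phi n) k).
  by exists psi; split => //; exists l.
pose Phi := fix Phi k : nat -> nat := if k is k'.+1 then Phi k' \o Psi (k', Phi k') else id.
have iP k : incr (Phi k).
  by elim: k => [|k IH] //=; apply: incr_comp => //; have [] := hPsi (k, Phi k).
have sub k m : exists2 th, incr th & forall n, Phi (k + m)%N n = Phi k (th n).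
  elim: m => [|m [th ith hth]]; first by exists id => // n; rewrite addn0.
  have [ip _] := hPsi ((k + m)%N, Phi (k + m)%N).
  exists (th \o Psi ((k + m)%N, Phi (k + m)%N)); first exact: incr_comp.
  by move=> n; rewrite addnS /= hth.
exists (fun n => Phi n n).
  move=> n /=; apply: incr_ltn => //.
  by have [ip _] := hPsi (n, Phi n); exact: (incr_ge n.+1 ip).
move=> k; have [_ [l hl]] := hPsi (k, Phi k); exists l => e /hl[N hN].
exists (maxn N k.+1) => n; rewrite geq_max => /andP[n1 n2].
have [th ith hth] := sub k.+1 (n - k.+1)%N; rewrite subnKC // in hth.
by rewrite hth; apply: hN; apply: leq_trans n1 (incr_ge _ ith).
Qed.

Definition dense_seq k : C :=
  if unpickle k is Some ab then ((ratr (ab : rat * rat).1) +i* (ratr ab.2))%C else 0.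

Lemma dense_seqP x e : 0 < e -> exists k, cmod (dense_seq k - x) < e.
Proof.
move=> e0; case: x => x1 x2; have e20 : 0 < e / 2 by rewrite divr_gt0.
have [|a] := @rat_in_itvoo R x1 (x1 + e / 2); first by rewrite ltrDl.
have [|b] := @rat_in_itvoo R x2 (x2 + e / 2); first by rewrite ltrDl.
rewrite !in_itv /= => /andP[b1 b2] /andP[a1 a2]; exists (pickle (a, b)).
rewrite /dense_seq pickleK; apply: le_lt_trans (cmod_le_ReIm _) _ => /=.
rewrite !gtr0_norm ?subr_gt0 //; lra.
Qed.

Lemma dense_sphere s e : 0 < e -> exists k, chord s (Some (dense_seq k)) < e.
Proof.
move=> e0; case: s => [x|].
  have [k hk] := dense_seqP x (divr_gt0 e0 (ltr0n R 2)); exists k.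
  by apply: le_lt_trans (chord_le _ _) _; rewrite cmodBC; lra.
have [T T0 hT] := big_chord_inf e0; have [k hk] := dense_seqP ((T + 1)%:C%C : C) ltr01; exists k.
rewrite chordC; apply: hT; have := cmod_le_sub ((T + 1)%:C%C : C) (dense_seq k).
rewrite cmodC (cmodBC _ (dense_seq k)) gtr0_norm; lra.
Qed.

(** Follows from [Fatou] at the point ([fatou_equicont]) and gives [Fatou] back once it holds on a
    ball ([ascoli]); later estimates work with this form. *)
Definition equicont S s := forall e, 0 < e -> exists2 d : R, 0 < d &
  forall f s', S f -> chord s s' < d -> chord (peval f s) (peval f s') < e.

Lemma ascoli S s r : (forall s', sball s r s' -> equicont S s') -> normal_on S (sball s r).
Proof.
move=> eq f Sf; have [phi ip hphi] := diagonal (fun n k => peval (f n) (Some (dense_seq k))).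
exists phi; split => //.
have cau (w : sphere R) e : sball s r w -> 0 < e -> exists2 d : R, 0 < d & exists N, forall (v : sphere R) m n,
    chord w v < d -> (N <= m)%N -> (N <= n)%N -> chord (peval (f (phi m)) v) (peval (f (phi n)) v) < e.
  move=> Uw e0; have e6 : 0 < e / 6 by rewrite divr_gt0.
  have [d d0 hd] := eq w Uw _ e6.
  have [k hk] := dense_sphere w d0.
  have [l hl] := hphi k; have [N hN] := hl _ e6.
  exists d => //; exists N => v m n wv Nm Nn.
  have h1 := hd _ _ (Sf (phi m)) wv; have h2 := hd _ _ (Sf (phi n)) wv.
  have h3 := hd _ _ (Sf (phi m)) hk; have h4 := hd _ _ (Sf (phi n)) hk.
  have h5 := hN m Nm; have h6 := hN n Nn; move: h1 h2 h3 h4 h5 h6.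
  set qm := peval _ (Some (dense_seq k)); set qn := peval (f (phi n)) (Some (dense_seq k)).
  set wm := peval _ w; set wn := peval (f (phi n)) w.
  set vm := peval _ v; set vn := peval (f (phi n)) v => h1 h2 h3 h4 h5 h6.
  have := chord_tri wm vm vn; have := chord_tri qm wm vn; have := chord_tri l qm vn.
  have := chord_tri qn l vn; have := chord_tri wn qn vn.
  rewrite (chordC vm wm) (chordC qn wn) (chordC l qn); lra.
have lim_ex (w : sphere R) : exists l : sphere R, sball s r w -> scvg (fun n => peval (f (phi n)) w) l.
  have [Uw|nU] := pselect (sball s r w); last by exists None.
  have [|l hl] := @sphere_complete (fun n => peval (f (phi n)) w); last by exists l.
  move=> e e0; have [d d0 [N hN]] := cau w e Uw e0; exists N => m n; apply: hN.
  by rewrite chord_refl.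
have [lim hlim] := choice lim_ex; exists lim => z Uz.
(* Half the distance to the rim, so that limits of points of this smaller ball stay in the ball
   around [s], where [cl] applies. *)
pose r1 := (r - chord s z) / 2.
have r10 : 0 < r1 by rewrite divr_gt0 // subr_gt0.
have cl (w : sphere R) : sball s r w -> forall e, 0 < e -> exists2 d : R, 0 < d & exists N, forall (v : sphere R) n,
    sball s r v -> chord w v < d -> (N <= n)%N -> chord (peval (f (phi n)) v) (lim v) < e.
  move=> Uw e e0; have [d d0 [N hN]] := cau w (e / 2) Uw (divr_gt0 e0 (ltr0n R 2)).
  exists d => //; exists N => v n Uv wv Nn.
  have [N' hN'] := hlim v Uv (e / 2) (divr_gt0 e0 (ltr0n R 2)).
  have h1 := hN v n (maxn N N') wv Nn (leq_maxl _ _).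
  have h2 := hN' (maxn N N') (leq_maxr _ _).
  by apply: le_lt_trans (chord_tri (peval (f (phi (maxn N N'))) v) _ _) _; lra.
exists r1 => // e e0; apply: contrapT => ne.
have /choice[w hw] : forall N, exists w : sphere R, [/\ sball s r w, sball z r1 w &
    exists2 n, (N <= n)%N & e <= chord (peval (f (phi n)) w) (lim w)].
  move=> N; apply: contrapT => h; apply: ne; exists N => n Nn w Uw zw.
  by rewrite ltNge; apply/negP => le; apply: h; exists w; split => //; exists n.
have [psi ips [l hl]] := sphere_compact w.
have Ul : sball s r l.
  have [N hN] := hl r1 r10; have := hN N (leqnn _); have [_ h1 _] := hw (psi N).
  move: h1; rewrite /sball /= => h1 h2.
  have := chord_tri z s l; have := chord_tri (w (psi N)) z l; rewrite /r1 in h1 h2 *; lra.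
have [d d0 [N hN]] := cl l Ul e e0.
have [N' hN'] := hl d d0; pose k := maxn N N'.
have [h1 h2 [n kn]] := hw (psi k); rewrite leNgt => /negP; apply; apply: hN => //.
  by rewrite chordC; apply: hN'; apply: leq_maxr.
by apply: leq_trans kn; apply: leq_trans (incr_ge _ ips); apply: leq_maxl.
Qed.

Lemma fatou_equicont S s : Fatou S s -> equicont S s.
Proof.
move=> [r r0 nr] e e0; apply: contrapT => ne.
have e5 : 0 < e / 5 by rewrite divr_gt0.
have /choice[fw hfw] : forall n : nat, exists fw : {poly C} * sphere R, [/\ S fw.1, chord s fw.2 < n.+1%:R^-1 &
    e <= chord (peval fw.1 s) (peval fw.1 fw.2)].
  move=> n; apply: contrapT => h; apply: ne; exists n.+1%:R^-1; first exact: inv_nat_gt0.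
  move=> f s' Sf lt; rewrite ltNge; apply/negP => le; apply: h; by exists (f, s').
have [phi [ip [lim hlim]]] := nr (fun n => (fw n).1) (fun n => let: And3 h _ _ := hfw n in h).
have Us : sball s r s by rewrite /sball chord_refl.
have [r1 r10 hr1] := hlim s Us; have [N hN] := hr1 _ e5.
have [d d0 hd] := peval_cont (fw (phi N)).1 s e5.
have m0 : 0 < Num.min d (Num.min r r1) by rewrite !lt_min d0 r0 r10.
have [N2 hN2] := inv_small m0.
pose k := maxn N N2.
have [_ h1 h2] := hfw (phi k).
have : chord s (fw (phi k)).2 < Num.min d (Num.min r r1).
  by apply: lt_trans h1 _; apply: hN2; apply: leq_trans (leq_maxr _ _) (incr_ge _ ip).
rewrite !lt_min => /and3P[w1 w2 w3].
set w := (fw (phi k)).2 in w1 w2 w3 h2.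
have s1 : sball s r1 s by rewrite /sball chord_refl.
have a1 := hN k (leq_maxl _ _) w w2 w3.
have a2 := hN k (leq_maxl _ _) s Us s1.
have a3 := hN N (leqnn _) w w2 w3.
have a4 := hN N (leqnn _) s Us s1.
have a5 := hd w w1.
move: a1 a2 a3 a4 a5 h2.
set kw := peval _ w; set ks := peval (fw (phi k)).1 s.
set Nw := peval _ w; set Ns := peval (fw (phi N)).1 s => a1 a2 a3 a4 a5 h2.
have := chord_tri (lim s) ks kw; have := chord_tri Ns (lim s) kw; have := chord_tri Nw Ns kw.
have := chord_tri (lim w) Nw kw; rewrite (chordC (lim s) Ns) (chordC (lim w) kw); lra.
Qed.

Lemma fatou_ball S s : Fatou S s -> exists2 r : R, 0 < r & forall s', chord s s' < r -> Fatou S s'.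
Proof.
move=> [r r0 nr]; exists r => // s' ss'.
exists (r - chord s s'); first by rewrite subr_gt0.
have sub (w : sphere R) : sball s' (r - chord s s') w -> sball s r w.
  by rewrite /sball; have := chord_tri s' s w; lra.
move=> f Sf; have [phi [ip [lim hlim]]] := nr f Sf; exists phi; split => //; exists lim.
move=> z Uz; have [r1 r10 h] := hlim z (sub _ Uz); exists r1 => // e /h[N hN].
by exists N => n Nn w Uw; apply: hN => //; apply: sub.
Qed.

Lemma equicont_fatou S s r : 0 < r -> (forall s', chord s s' < r -> equicont S s') -> Fatou S s.
Proof. by move=> r0 h; exists r => //; apply: ascoli. Qed.

Lemma equicont_fin S a : (forall e, 0 < e -> exists2 d, 0 < d & forall f b, S f ->
  cmod (b - a) < d -> chord (Some f.[a]) (Some f.[b]) < e) -> equicont S (Some a).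
Proof.
move=> h e /h[d d0 hd]; have [r r0 hr] := chord_small (cmod a) d0.
by exists r => // f s' Sf /hr-/(_ (lexx _))[b -> lt] /=; apply: hd.
Qed.

Lemma equicont_bounded S a M : equicont S (Some a) -> (forall f, S f -> cmod f.[a] <= M) ->
  forall e, 0 < e -> exists2 d, 0 < d & forall f b, S f -> cmod (b - a) < d -> cmod (f.[b] - f.[a]) < e.
Proof.
move=> eq bd e e0; have [r r0 hr] := chord_small M e0.
have [d d0 hd] := eq r r0; exists (d / 2); first by rewrite divr_gt0.
move=> f b Sf lt; have [|c [->]//] := hr f.[a] (Some f.[b]) (bd f Sf).
apply: (hd f (Some b) Sf); apply: le_lt_trans (chord_le _ _) _; rewrite cmodBC; lra.
Qed.

(** The criterion by which boundary points of filled sets are shown to be Julia points: on the disc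
    of radius [M] chordal closeness implies Euclidean closeness, so a jump of modulus by one at
    arbitrarily small distance contradicts equicontinuity. *)
Lemma julia_escape S z M : 
  (forall d, 0 < d -> exists f p, [/\ S f, cmod (p - z) < d, cmod f.[z] <= M & M + 1 <= cmod f.[p]]) ->
  Julia S (Some z).
Proof.
move=> h F; have eq := fatou_equicont F.
have [r r0 hr] := chord_small M (ltr01 : 0 < 1 :> R).
have [d d0 hd] := eq r r0; have [f [p [Sf pz fz fp]]] := h (d / 2) (divr_gt0 d0 (ltr0n R 2)).
have [|c [E]] := hr f.[z] (Some f.[p]) fz.
  by apply: (hd f (Some p) Sf); apply: le_lt_trans (chord_le _ _) _; rewrite cmodBC; lra.
by rewrite -E; have := cmod_le_sub f.[p] f.[z]; lra.
Qed.

(** By openness points near [g.[x]] are images of points near [x], and there [f] becomes [f \Po g],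
    which is again in [S]. *)
Lemma fatou_forward S g x : (1 < size g)%N -> (forall f, S f -> S (f \Po g)) ->
  Fatou S (Some x) -> Fatou S (Some g.[x]).
Proof.
move=> sg Sg /fatou_ball[r r0 hr].
have [d d0 hd] := open_map sg (divr_gt0 r0 (ltr0n R 2)).
have [t t0 ht] := chord_small (cmod g.[x]) d0.
apply: (equicont_fatou t0) => s' /ht-/(_ (lexx _))[b -> {s'} bx].
have [|u <- ux] := hd x b; first by rewrite cmodBC.
have Fu : Fatou S (Some u).
  by apply: hr; apply: le_lt_trans (chord_le _ _) _; rewrite cmodBC; lra.
apply: equicont_fin => e e0; have [d1 d10 hd1] := fatou_equicont Fu e0.
have [d2 d20 hd2] := open_map sg (divr_gt0 d10 (ltr0n R 2)).
exists d2 => // f v Sf; rewrite cmodBC => /hd2[w <- wu].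
have := hd1 (f \Po g) (Some w) (Sg f Sf); rewrite /= !horner_comp; apply.
by apply: le_lt_trans (chord_le _ _) _; rewrite cmodBC; lra.
Qed.

(* Cauchy estimate, through the maximum principle for the difference quotient. *)
Lemma poly_lip_disc f x r M : 0 < r -> (forall y, cmod (y - x) <= r -> cmod f.[y] <= M) ->
  forall y, cmod (y - x) <= r -> cmod (f.[y] - f.[x]) <= 2 * M / r * cmod (y - x).
Proof.
move=> r0 fM y yx.
have /factor_theorem[q qE] : root (f - f.[x]%:P) x by rewrite rootE !hornerE subrr.
have E z : f.[z] - f.[x] = q.[z] * (z - x).
  by have /(congr1 (fun h => h.[z])) := qE; rewrite !hornerE.
have M0 : 0 <= M by apply: le_trans (fM x _); rewrite ?cmod_ge0 // subrr cmod0 ltW.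
rewrite E cmodM ler_wpM2r ?cmod_ge0 //.
have [b bx [nb le]] := max_principle q (ball_compact x r) yx.
apply: le_trans le _; rewrite ler_pdivlMr //.
have br : cmod (b - x) = r.
  apply/eqP; rewrite eq_le bx leNgt; apply/negP => lt; apply: nb.
  exists (r - cmod (b - x)); first by rewrite subr_gt0.
  by move=> c cb; have := cmod_tri b c x; lra.
rewrite -{1}br -cmodM -E; apply: le_trans (cmodB _ _) _.
have := fM b bx; have := fM x; rewrite subrr cmod0 => /(_ (ltW r0)); lra.
Qed.

(** Montel for a bounded family: the Cauchy estimate [poly_lip_disc] gives one Lipschitz constant
    near [z] for all members. *)
Lemma fatou_interior S (A : C -> Prop) z M : (forall f x, S f -> A x -> cmod f.[x] <= M) ->
  interior_pt A z -> Fatou S (Some z).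
Proof.
move=> bd [r r0 hr]; have r20 : 0 < r / 2 by rewrite divr_gt0.
have [t t0 ht] := chord_small (cmod z) r20.
apply: (equicont_fatou t0) => s' /ht-/(_ (lexx _))[a -> {s'} az].
apply: equicont_fin => e e0; pose L := 2 * M / (r / 4) + 1.
have fM f : S f -> forall y, cmod (y - a) <= r / 4 -> cmod f.[y] <= M.
  by move=> Sf y ya; apply: bd => //; apply: hr; have := cmod_tri a y z; lra.
have [[f0 Sf0]|nS] := pselect (exists f, S f); last first.
  by exists 1 => // f b Sf; case: nS; exists f.
have M0 : 0 <= M by apply: le_trans (cmod_ge0 _) (fM f0 Sf0 a _); rewrite subrr cmod0; lra.
have L0 : 0 < L by rewrite ltr_wpDl // divr_ge0 ?mulr_ge0 //; lra.
exists (Num.min (r / 4) (e / (2 * L))); first by rewrite lt_min !divr_gt0 // mulr_gt0.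
move=> f b Sf; rewrite lt_min => /andP[h1 h2].
apply: le_lt_trans (chord_le _ _) _; rewrite cmodBC.
have r40 : 0 < r / 4 by rewrite divr_gt0.
have := poly_lip_disc r40 (fM f Sf) (ltW h1).
move: h2; rewrite ltr_pdivlMr ?mulr_gt0 //; have := cmod_ge0 (b - a); rewrite /L => *; nra.
Qed.

End Normality.

(** * Lifting connected sets through polynomials *)

Section Lifting.
Variable R : realType.
Local Notation C := R[i].
Implicit Types (x y z u v w p q a b c : C) (f : {poly C}) (e d r M t : R).

Lemma preim_bounded f M : (1 < size f)%N -> exists B, forall x, cmod f.[x] <= M -> cmod x <= B.
Proof.
move=> sf; have [K K0 hK] := poly_infty (M + 1) sf; exists K => x fx.
by rewrite leNgt; apply/negP => /ltW/hK; lra.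
Qed.

Lemma preim_compact f M : (1 < size f)%N -> ccompact (fun x => cmod f.[x] <= M).
Proof. by move=> sf; split; [exact: poly_preim_closed | exact: preim_bounded]. Qed.

Lemma preim_disc_compact f c M : (1 < size f)%N -> ccompact (fun x => cmod (f.[x] - c) <= M).
Proof.
move=> sf; have := @preim_compact (f - c%:P) M; rewrite size_subC // => /(_ sf).
by congr ccompact; apply/funext => x; rewrite !hornerE.
Qed.

Definition locinv f (A : C -> Prop) d K := forall p x y, A p -> cmod (x - p) < d -> cmod (y - p) < d ->
  cmod (x - y) <= K * cmod (f.[x] - f.[y]).

Lemma unif_locinv f A : ccompact A -> (forall p, A p -> f^`().[p] != 0) ->
  exists d K, [/\ 0 < d, 0 < K & locinv f A d K].
Proof.
move=> cA nz; have [[p0 Ap0]|nA] := pselect (exists p, A p); last first.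
  by exists 1, 1; split => // p x y Ap; case: nA; exists p.
have [m Am hm] := poly_min_attained f^`() cA (ex_intro _ p0 Ap0).
have m0 : 0 < cmod f^`().[m] by rewrite cmod_gt0 nz.
set k := cmod _ in m0 hm.
have [_ [M AM]] := cA; have [B B0 hB] := poly_taylor1 f (M + 1).
(* Within this radius the Taylor error is at most [k / 2] times the displacement, [k] being the
   least modulus of the derivative on [A]. *)
exists (Num.min 1 (k / (4 * B))), (2 / k); split; rewrite ?lt_min ?ltr01 ?divr_gt0 ?mulr_gt0 //.
move=> p x y Ap; rewrite !lt_min => /andP[x1 x2] /andP[y1 y2].
have pM := AM p Ap.
have xM : cmod x <= M + 1 by have := cmod_le_sub x p; lra.
have yM : cmod y <= M + 1 by have := cmod_le_sub y p; lra.
have h := hB p x y (_ : cmod p <= M + 1) xM yM; have {h} := h (ltac:(lra)).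
have hp := hm p Ap.
set D := f.[x] - f.[y]; set E := f^`().[p] * (x - y) => h.
have := cmodB D (D - E); rewrite subKr.
rewrite {1}/E cmodM => h1.
have h2 : B * (cmod (x - p) + cmod (y - p)) <= k / 2.
  move: x2 y2; rewrite !ltr_pdivlMr ?mulr_gt0 // => x2 y2; lra.
have h3 := ler_wpM2r (cmod_ge0 (x - y)) h2.
have h4 := ler_wpM2r (cmod_ge0 (x - y)) hp.
by rewrite mulrAC ler_pdivlMr //; lra.
Qed.

(** A displacement of the values by less than [n] lifts to a displacement of the points by less than
    [d / 2]. Lifts of nearby points then share a ball of radius [d] on which [locinv] holds, which
    makes the lift continuous. *)
Lemma shift_lift f A d K n (S : C -> Prop) (tau : C -> C) : 0 < d -> 0 < K -> locinv f A d K ->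
  (forall p u, cmod (f.[p] - u) < n -> exists2 q, f.[q] = u & cmod (q - p) < d / 2) ->
  (forall x, S x -> A x) ->
  (forall x, S x -> cmod (f.[x] - tau f.[x]) < n) ->
  (forall x, S x -> forall e, 0 < e -> exists2 d, 0 < d &
     forall y, S y -> cmod (y - x) < d -> cmod (tau f.[y] - tau f.[x]) < e) ->
  exists sg : C -> C, (forall x, S x -> cmod (sg x - x) < d / 2 /\ f.[sg x] = tau f.[x]) /\
   (forall x, S x -> forall e, 0 < e -> exists2 d, 0 < d &
     forall y, S y -> cmod (y - x) < d -> cmod (sg y - sg x) < e).
Proof.
move=> d0 K0 inv op SA near ct.
have /choice[sg hsg] : forall x, exists q, S x -> cmod (q - x) < d / 2 /\ f.[q] = tau f.[x].
  move=> x; have [Sx|nS] := pselect (S x); last by exists x.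
  by have [q ? ?] := op x _ (near x Sx); exists q.
exists sg; split => // x Sx e e0.
have [r r0 hr] := ct x Sx (e / K) (divr_gt0 e0 K0).
exists (Num.min r (d / 2)); first by rewrite lt_min r0 divr_gt0.
move=> y Sy; rewrite lt_min => /andP[y1 y2].
have [h1 E1] := hsg x Sx; have [h2 E2] := hsg y Sy.
have := inv x (sg y) (sg x) (SA x Sx); rewrite E1 E2 => h.
apply: le_lt_trans (h _ _) _; [|by lra|].
  by have := cmod_tri y (sg y) x; lra.
by rewrite mulrC -ltr_pdivlMr //; apply: hr.
Qed.

(** In place of a monodromy theorem, the values are contracted towards [c] and [S] is lifted along.
    Equal values stay equal, and over [c] itself a connected set lies in a discrete fibre, so it is
    a point; local injectivity carries equality back step by step. *)
Lemma injective_over_disc f c r (S : C -> Prop) : (1 < size f)%N ->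
  (forall x, cmod (f.[x] - c) <= r -> f^`().[x] != 0) ->
  lconn S -> (forall x, S x -> cmod (f.[x] - c) <= r) ->
  forall x y, S x -> S y -> f.[x] = f.[y] -> x = y.
Proof.
move=> sf nz cS Sr.
have cA := preim_disc_compact c r sf; set A := fun x => _ in cA.
have [d [K [d0 K0 inv]]] := unif_locinv cA nz.
have [n n0 op] := open_map sf (divr_gt0 d0 (ltr0n R 2)).
have fib p x y : A p -> cmod (x - p) < d -> cmod (y - p) < d -> f.[x] = f.[y] -> x = y.
  move=> Ap xp yp E; have := inv p x y Ap xp yp; rewrite E subrr cmod0 mulr0.
  by rewrite le_eqVlt ltNge cmod_ge0 orbF cmod_eq0 subr_eq0 => /eqP.
have main (k : nat) : forall rho (S : C -> Prop), rho <= r -> rho <= k%:R * (n / 2) -> lconn S ->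
    (forall x, S x -> cmod (f.[x] - c) <= rho) -> forall x y, S x -> S y -> f.[x] = f.[y] -> x = y.
  elim: k => [|k IH] rho {cS Sr}S rr rk cS Sr x y Sx Sy E.
    have fc z : S z -> f.[z] = c.
      move=> /Sr h; apply/eqP; rewrite -subr_eq0 -cmod_eq0 eq_le cmod_ge0 andbT.
      by apply: le_trans h _; rewrite mul0r in rk.
    suff : y = x by [].
    apply: (cS (fun z => z = x) _ x y) => // z Sz; exists d => // v Sv vz.
    have Az : A z by apply: le_trans (Sr z Sz) rr.
    have -> : v = z by apply: (fib z) => //; rewrite ?subrr ?cmod0 ?fc.
    by [].
  have [rho0|rho0] := leP rho 0.
    by apply: (IH rho S) => //; apply: le_trans rho0 _; rewrite mulr_ge0 // divr_ge0 // ltW.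
  (* The radius drops by [n / 2], less than the liftable step [n]; [lam] is the contraction factor
     that achieves it. *)
  pose rho' := Num.max 0 (rho - n / 2); pose lam := rho' / rho.
  have r'0 : 0 <= rho' by rewrite le_max lexx.
  have r'le : rho' <= rho by rewrite ge_max ltW //= lerBlDr lerDl divr_ge0 // ltW.
  have l0 : 0 <= lam by rewrite divr_ge0 // ltW.
  have l1 : lam <= 1 by rewrite ler_pdivrMr // mul1r.
  have lr : lam * rho = rho' by rewrite divfK // gt_eqF.
  pose tau u := c + lam%:C%C * (u - c).
  have SA z : S z -> A z by move=> Sz; apply: le_trans (Sr z Sz) rr.
  have [|z Sz e e0|sg [hsg csg]] := @shift_lift f A d K n S tau d0 K0 inv op SA.
  - move=> z Sz; have -> : f.[z] - tau f.[z] = (1 - lam)%:C%C * (f.[z] - c).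
      by rewrite /tau rmorphB rmorph1; ring.
    rewrite cmodM cmodC ger0_norm ?subr_ge0 //.
    apply: (@le_lt_trans _ _ ((1 - lam) * rho)); first by rewrite ler_wpM2l ?subr_ge0 ?Sr.
    rewrite mulrBl mul1r lr ltrBlDl -ltrBlDr lt_max; apply/orP; right; lra.
  - have [d1 d10 hd1] := poly_cont f z e0; exists d1 => // v Sv /hd1 lt.
    rewrite (_ : _ - _ = lam%:C%C * (f.[v] - f.[z])); last by rewrite /tau; ring.
    rewrite cmodM cmodC ger0_norm //; apply: le_lt_trans lt; by rewrite ler_piMl ?cmod_ge0.
  have [hx Ex] := hsg x Sx; have [hy Ey] := hsg y Sy.
  have sgE : sg x = sg y.
    apply: (IH rho' (fun v => exists2 x, S x & v = sg x)) => //.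
    - exact: le_trans r'le rr.
    - rewrite ge_max; apply/andP; split; first by rewrite mulr_ge0 // divr_ge0 // ltW.
      by move: rk; rewrite -natr1 mulrDl mul1r; lra.
    - exact: lconn_image.
    - move=> _ [v Sv ->]; have [_ ->] := hsg v Sv; rewrite /tau addrC addKr cmodM cmodC ger0_norm //.
      by rewrite -lr ler_wpM2l ?Sr.
    - by exists x.
    - by exists y.
    by rewrite Ex Ey E.
  have As : A (sg x).
    rewrite /A Ex /tau addrC addKr cmodM cmodC ger0_norm //.
    by apply: le_trans (SA x Sx); rewrite ler_piMl ?cmod_ge0.
  apply: (fib (sg x)) => //; rewrite cmodBC; first by lra.
  by rewrite sgE; lra.
have n20 : 0 < n / 2 by rewrite divr_gt0.
have rb : 0 <= `|r| / (n / 2) by rewrite divr_ge0 // ltW.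
apply: (main (Num.bound (`|r| / (n / 2))) r S) => //.
apply: le_trans (ler_norm r) _; rewrite -ler_pdivrMr //; apply: ltW; exact: archi_boundP.
Qed.

(** A segment between points not on one real line through [0] avoids [0]. If the real part of [x]
    times the conjugate of [y] is nonzero, the route goes through ['i%C * x], which is collinear
    with neither. *)
Lemma punctured_lconn : lconn (fun x : C => x != 0).
Proof.
move=> P lc x y x0 y0 Px.
have im a b : complex.Im (b * a^*%C) = complex.Im b * complex.Re a - complex.Re b * complex.Im a.
  by case: a => a1 a2; case: b => b1 b2 /=; ring.
have step a b : P a -> a != 0 -> complex.Im (b * a^*%C) != 0 -> P b.
  move=> Pa a0 ab; apply: (seg_locconst lc _ Pa) => t _; apply/eqP => E; move: ab; rewrite im.
  have [t0|t0] := eqVneq t 0; first by move: a0; rewrite -E t0 seg0 eqxx.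
  apply/negP; rewrite negbK -(mulrI_eq0 _ (mulfI t0)); move: E; rewrite /seg.
  case: (a) => a1 a2; case: (b) => b1 b2 /eqP; rewrite eq_complex /= => /andP[/eqP h1 /eqP h2].
  apply/eqP; have : a1 * (a2 + (t * (b2 - a2) + 0 * (b1 - a1))) - a2 * (a1 + (t * (b1 - a1) - 0 * (b2 - a2))) = 0.
    by rewrite h1 h2; ring.
  by move=> <-; ring.
have [re0|re0] := eqVneq (complex.Re (x * y^*%C)) 0.
  apply: (step x) => //; rewrite im; apply: contra_neq x0 => im0.
  have : cmod x ^+ 2 * cmod y ^+ 2 = 0; last first.
    by move=> /eqP; rewrite mulf_eq0 !expf_eq0 !cmod_eq0 (negPf y0) orbF => /eqP.
  rewrite !cmod_sqr; move: re0 im0; case: (x) => x1 x2; case: (y) => y1 y2 /= h1 h2.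
  have <- : (x1 * y1 - x2 * - y2) ^+ 2 + (y2 * x1 - y1 * x2) ^+ 2 = 0 by rewrite h1 h2; ring.
  by ring.
have ix0 : 'i%C * x != 0 by rewrite mulf_neq0 // eq_complex /= oner_eq0 andbF.
apply: (step ('i%C * x)) => //; last first.
  by move: re0; rewrite !im; case: (x) => x1 x2; case: (y) => y1 y2 /=; apply: contra_neq => E; lra.
apply: (step x) => //; have := cmod_gt0 x; rewrite x0 im => xp.
have : 0 < cmod x ^+ 2 by rewrite exprn_gt0.
by rewrite cmod_sqr; case: (x) => x1 x2 /= h; rewrite gt_eqF //; lra.
Qed.
(** Half the derivative in [t] of the squared distance is [t * cmod x ^+ 2] minus the real part of
    [x] times the conjugate of [z], nonnegative once the ray has passed radius [r]. *)
Lemma ray_increasing (z x : C) (t t' r : R) : cmod z <= r -> r <= t * cmod x -> x != 0 ->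
  0 <= t -> t < t' -> cmod (t%:C%C * x - z) < cmod (t'%:C%C * x - z).
Proof.
move=> zr rt x0 t0 tt'; rewrite -(@ltr_pXn2r _ 2) ?nnegrE ?cmod_ge0 //.
have xp : 0 < cmod x by rewrite cmod_gt0.
have dot : complex.Re (x * z^*%C) <= t * cmod x ^+ 2.
  apply: le_trans (ler_norm _) _; apply: le_trans (Re_le_cmod _) _.
  rewrite cmodM (_ : cmod z^*%C = cmod z); last by rewrite /cmod; case: (z) => a b /=; rewrite sqrrN.
  rewrite expr2 mulrCA [t * _]mulrC mulrC [_ * cmod x]mulrC ler_wpM2l ?cmod_ge0 //.
  by apply: le_trans zr _; rewrite mulrC in rt *.
have xx : 0 < cmod x ^+ 2 by rewrite exprn_gt0.
move: dot xx; rewrite !cmod_sqr; case: (x) => x1 x2; case: (z) => z1 z2 /=.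
rewrite !mul0r !addr0 !subr0 => dot xx.
rewrite -subr_gt0 (_ : _ - _ = (t' - t) * ((t' + t) * (x1 ^+ 2 + x2 ^+ 2) - 2 * (x1 * z1 - x2 * - z2))); last by ring.
rewrite mulr_gt0 ?subr_gt0 //; nra.
Qed.

Lemma prod_lt (T : eqType) (s : seq T) (F G : T -> R) : (0 < size s)%N ->
  (forall i, i \in s -> 0 <= F i < G i) -> \prod_(i <- s) F i < \prod_(i <- s) G i.
Proof.
move=> s0 h; rewrite big_seq [ltRHS]big_seq; apply: ltr_prod => //.
by apply/hasP; case: s s0 {h} => // a s _; exists a; rewrite mem_head.
Qed.

(** Beyond a disc holding all zeros the modulus of [f] increases strictly along rays, so a high
    level set is a radial graph: a continuous image of the punctured plane, with [tt x] the factor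
    that moves [x] onto it. *)
Lemma level_connected_large f : (1 < size f)%N ->
  exists r0, forall r, r0 < r -> lconn (fun x => cmod f.[x] = r).
Proof.
move=> sf; have [s [sz _ hs]] := subC_split 0 sf.
have [k k0 hk] : exists2 k, 0 < k & forall z, z \in s -> cmod z <= k.
  elim: s {sz hs} => [|z s [k k0 IH]]; first by exists 1.
  exists (k + cmod z); first by rewrite ltr_wpDr ?cmod_ge0.
  move=> w; rewrite inE => /orP[/eqP->|/IH]; first by rewrite lerDr ltW.
  by move=> h; apply: le_trans h _; rewrite lerDl cmod_ge0.
have mono x t t' : x != 0 -> 0 <= t -> k <= t * cmod x -> t < t' -> cmod f.[t%:C%C * x] < cmod f.[t'%:C%C * x].
  move=> x0 t0 kt tt'; have H y : cmod f.[y] = cmod (f.[y] - 0) by rewrite subr0.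
  rewrite H [ltRHS]H !hs ltr_pM2l ?lead_gt0 //; apply: prod_lt.
    by rewrite sz; case: size sf => [|[]].
  by move=> z /hk zk; rewrite cmod_ge0 /=; apply: ray_increasing kt _ t0 tt'.
have [r0 _ hr0] := poly_bounded f k; exists r0 => r rr.
have out x : cmod f.[x] = r -> k < cmod x.
  by move=> E; rewrite ltNge; apply/negP => /hr0; rewrite E leNgt rr.
have ivt x t0 t1 : 0 <= t0 -> t0 <= t1 -> cmod f.[t0%:C%C * x] <= r -> r <= cmod f.[t1%:C%C * x] ->
    exists2 t, t0 <= t <= t1 & cmod f.[t%:C%C * x] = r.
  move=> h0 h1 h2 h3; have [u /andP[u0 u1] E] := poly_seg_ivt h2 h3.
  exists (t0 + u * (t1 - t0)); last by rewrite -E /seg rmorphD rmorphM rmorphB /=; congr (cmod f.[_]); ring.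
  have d0 : 0 <= t1 - t0 by rewrite subr_ge0.
  apply/andP; split; first by rewrite lerDl mulr_ge0.
  by have := ler_wpM2r d0 u1; rewrite mul1r; lra.
have uniq x t t' : x != 0 -> 0 <= t -> 0 <= t' -> cmod f.[t%:C%C * x] = r -> cmod f.[t'%:C%C * x] = r -> t = t'.
  move=> x0 p p' E E'; have K := out _ E; have K' := out _ E'.
  rewrite cmodM cmodC ger0_norm // in K; rewrite cmodM cmodC ger0_norm // in K'.
  apply/eqP; case: (ltrgtP t t') => // lt.
    by have := mono x t t' x0 p (ltW K) lt; rewrite E E' ltxx.
  by have := mono x t' t x0 p' (ltW K') lt; rewrite E E' ltxx.
have /choice[tt htt] : forall x, exists t, x != 0 -> 0 <= t /\ cmod f.[t%:C%C * x] = r.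
  move=> x; have [->|x0] := eqVneq x 0; first by exists 0.
  have xp : 0 < cmod x by rewrite cmod_gt0.
  have [T T0 hT] := poly_infty r sf.
  have [||||t /andP[p q] E] := ivt x 0 (T / cmod x); rewrite ?lexx ?divr_ge0 ?(ltW xp) ?(ltW T0) //.
  - by rewrite rmorph0 mul0r; apply: le_trans (hr0 _ _) (ltW rr); rewrite cmod0 ltW.
  - by apply: hT; rewrite cmodM cmodC ger0_norm ?divfK ?gt_eqF // divr_ge0 // ltW.
  by exists t.
move=> P lc u v Eu Ev Pu.
have nz x : cmod f.[x] = r -> x != 0.
  by move=> /out h; rewrite -cmod_gt0; apply: lt_trans h.
have ret x : cmod f.[x] = r -> (tt x)%:C%C * x = x.
  move=> E; have [p Et] := htt x (nz x E).
  by rewrite (uniq x (tt x) 1 (nz x E) p ler01 Et) ?rmorph1 ?mul1r.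
rewrite -(ret v Ev); rewrite -(ret u Eu) in Pu.
suff lcQ : locconst (fun x : C => x != 0) (fun x => P ((tt x)%:C%C * x)).
  exact: (punctured_lconn lcQ (nz u Eu) (nz v Ev) Pu).
move=> x x0.
have [t0 Et] := htt x x0; have [e e0 he] := lc _ Et.
have xp : 0 < cmod x by rewrite cmod_gt0.
have kt := out _ Et; rewrite cmodM cmodC ger0_norm // in kt.
set t := tt x in t0 Et kt he *.
have tp : 0 < t by rewrite lt_neqAle t0 andbT; apply: contraTneq kt => <-; rewrite mul0r -leNgt ltW.
(* A parameter change of [s1] moves the point by at most [e / 2] and keeps it outside the disc of
   zeros, where monotonicity holds. *)
pose s1 := Num.min (e / (2 * cmod x)) (t - k / cmod x).
have s10 : 0 < s1 by rewrite lt_min divr_gt0 ?mulr_gt0 //= subr_gt0 ltr_pdivrMr.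
have s1e : s1 * cmod x <= e / 2.
  apply: (@le_trans _ _ (e / (2 * cmod x) * cmod x)); first by rewrite ler_pM2r // ge_min lexx.
  by rewrite invfM mulrA divfK ?gt_eqF.
have s1k : k / cmod x <= t - s1.
  have : s1 <= t - k / cmod x by rewrite ge_min lexx orbT. by lra.
have ts1 : 0 <= t - s1 by apply: le_trans s1k; rewrite divr_ge0 // ltW.
have lo : cmod f.[(t - s1)%:C%C * x] < r.
  by rewrite -Et; apply: mono => //; [rewrite -ler_pdivrMr | lra].
have hi : r < cmod f.[(t + s1)%:C%C * x].
  by rewrite -{1}Et; apply: mono => //; [exact: ltW | lra].
have cts (a n : R) : 0 < n -> exists2 d, 0 < d & forall y, cmod (y - x) < d -> `|cmod f.[a%:C%C * y] - cmod f.[a%:C%C * x]| < n.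
  move=> n0; have [d d0 hd] := poly_norm_cont f (a%:C%C * x) n0.
  have a1 : 0 < `|a| + 1 by rewrite ltr_wpDl.
  exists (d / (`|a| + 1)); first by rewrite divr_gt0.
  move=> y; rewrite ltr_pdivlMr // => lt; apply: hd; rewrite -mulrBr cmodM cmodC.
  by apply: le_lt_trans lt; rewrite mulrC ler_wpM2l ?cmod_ge0 // lerDl.
have n1 : 0 < r - cmod f.[(t - s1)%:C%C * x] by rewrite subr_gt0.
have n2 : 0 < cmod f.[(t + s1)%:C%C * x] - r by rewrite subr_gt0.
have [d1 d10 hd1] := cts (t - s1) _ n1; have [d2 d20 hd2] := cts (t + s1) _ n2.
have tsp : 0 < t + s1 by rewrite addr_gt0.
exists (Num.min d1 (Num.min d2 (e / (2 * (t + s1))))).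
  by rewrite !lt_min d10 d20 divr_gt0 // mulr_gt0.
move=> y y0; rewrite !lt_min => /and3P[/hd1 y1 /hd2 y2 y3]; move: y1 y2.
rewrite !ltr_norml => /andP[_ y1] /andP[y2 _].
have [||||t' /andP[p q] E'] := ivt y (t - s1) (t + s1) => //; [by lra..|].
have tp' : 0 <= t' by apply: le_trans p.
have [q0 Eq] := htt y y0.
have tE : tt y = t' by apply: (uniq y).
rewrite tE; apply: he => //.
have -> : t'%:C%C * y - t%:C%C * x = t'%:C%C * (y - x) + (t' - t)%:C%C * x by rewrite rmorphB /=; ring.
apply: le_lt_trans (cmodD _ _) _; rewrite !cmodM !cmodC (ger0_norm tp').
have a1 : `|t' - t| * cmod x <= s1 * cmod x by rewrite ler_wpM2r ?cmod_ge0 // ler_norml; lra.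
have a2 : t' * cmod (y - x) <= (t + s1) * cmod (y - x) by rewrite ler_wpM2r ?cmod_ge0.
have a3 : (t + s1) * cmod (y - x) < e / 2.
  by move: y3; rewrite ltr_pdivlMr ?mulr_gt0 //; lra.
lra.
Qed.

(** A connected high level [T] is deformed down to [r]. No critical point lies between, so rescaling
    of the values lifts in steps shorter than [n] and carries level onto level; [interval_connected]
    joins the steps. *)
Lemma level_connected f r : (1 < size f)%N -> 0 < r ->
  (forall x, f^`().[x] = 0 -> cmod f.[x] < r) -> lconn (fun x => cmod f.[x] = r).
Proof.
move=> sf r0 cr; have [r1 hr1] := level_connected_large sf.
pose T := Num.max r (r1 + 1).
have rT : r <= T by rewrite le_max lexx.
have cT : lconn (fun x => cmod f.[x] = T).
  by apply: hr1; rewrite lt_max; apply/orP; right; lra.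
pose A x := cmod f.[x] <= T /\ r <= cmod f.[x].
have cA : ccompact A.
  have [cl [M hM]] := preim_compact T sf; split; last by exists M => x [/hM].
  apply: cclosedI => // x h; rewrite leNgt; apply/negP => lt.
  have e0 : 0 < r - cmod f.[x] by rewrite subr_gt0.
  have [d d0 hd] := poly_norm_cont f x e0; have [y yr /hd] := h d d0; rewrite ltr_norml; lra.
have nc p : A p -> f^`().[p] != 0.
  by move=> [_ rp]; apply: contraTneq rp => /cr; rewrite ltNge.
have [d [K [d0 K0 inv]]] := unif_locinv cA nc.
have [n n0 op] := open_map sf (divr_gt0 d0 (ltr0n R 2)).
have step s s' : r <= s <= T -> r <= s' <= T -> `|s - s'| < n ->
    lconn (fun x => cmod f.[x] = s) -> lconn (fun x => cmod f.[x] = s').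
  move=> /andP[rs sT] /andP[rs' s'T] ss cs.
  have s0 : 0 < s by apply: lt_le_trans rs.
  have s'0 : 0 < s' by apply: lt_le_trans rs'.
  pose tau u : C := (s' / s)%:C%C * u.
  have ms x : cmod f.[x] = s -> cmod (tau f.[x]) = s'.
    by move=> E; rewrite /tau cmodM cmodC E ger0_norm ?divfK ?gt_eqF // divr_ge0 // ltW.
  have [||x Sx e e0|sg [hsg csg]] := @shift_lift f A d K n (fun x => cmod f.[x] = s) tau d0 K0 inv op.
  - by move=> x E; rewrite /A E.
  - move=> x E; rewrite (_ : _ - _ = (1 - s' / s)%:C%C * f.[x]); last by rewrite /tau rmorphB rmorph1; ring.
    rewrite cmodM cmodC E -{2}(ger0_norm (ltW s0)) -normrM.
    by rewrite mulrBl mul1r divfK ?gt_eqF.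
  - have [k k0 hk] := poly_cont f x (divr_gt0 e0 (divr_gt0 s'0 s0)); exists k => // y _ /hk lt.
    rewrite /tau -mulrBr cmodM cmodC ger0_norm ?divr_ge0 ?(ltW s0) ?(ltW s'0) //.
    by rewrite mulrC -ltr_pdivlMr // divr_gt0.
  have := lconn_image csg cs; congr lconn; apply/funext => y; apply/propext; split.
    by move=> [x E ->]; have [_ ->] := hsg x E; apply: ms.
  (* The lift is onto: from [y] go to a nearby [p] on level [s]; then [sg p] and [y] have the same
     value and are both close to [p], so they agree. *)
  move=> E; have [|p pE py] := op y ((s / s')%:C%C * f.[y]).
    rewrite (_ : _ - _ = (1 - s / s')%:C%C * f.[y]); last by rewrite rmorphB rmorph1; ring.
    rewrite cmodM cmodC E -{2}(ger0_norm (ltW s'0)) -normrM.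
    by rewrite mulrBl mul1r divfK ?gt_eqF // distrC.
  have Ep : cmod f.[p] = s.
    by rewrite pE cmodM cmodC E ger0_norm ?divfK ?gt_eqF // divr_ge0 // ltW.
  exists p => //; have [sp fsp] := hsg p Ep.
  have Ap : A p by rewrite /A Ep.
  have := inv p y (sg p) Ap; rewrite (cmodBC y) => hh; have {hh} := hh (ltac:(lra)) (ltac:(lra)).
  rewrite fsp /tau pE mulrA -rmorphM /= mulrA divfK ?gt_eqF // divff ?gt_eqF // rmorph1 mul1r.
  rewrite subrr cmod0 mulr0 le_eqVlt ltNge cmod_ge0 orbF cmod_eq0 subr_eq0 => /eqP //.
pose s t := T + t * (r - T).
have sI t : 0 <= t <= 1 -> r <= s t <= T by move=> /andP[t0 t1]; rewrite /s; nra.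
have Tr : 0 < T - r + 1 by lra.
have := @interval_connected R (fun t => lconn (fun x => cmod f.[x] = s t)).
have [-> ->] : s 0 = T /\ s 1 = r by rewrite /s; split; lra.
apply=> // t t01.
exists (n / (T - r + 1)); first by rewrite divr_gt0.
move=> t' t'01; rewrite ltr_pdivlMr // => lt.
have near : `|s t - s t'| < n.
  rewrite /s opprD addrACA subrr add0r -mulrBl normrM distrC [`|r - T|]distrC (@ger0_norm _ (T - r)) ?subr_ge0 //.
  by apply: le_lt_trans lt; rewrite ler_wpM2l // lerDl.
by split; apply: step; rewrite ?sI // distrC.
Qed.

Lemma level_connected_at f c r : (1 < size f)%N -> 0 < r ->
  (forall x, f^`().[x] = 0 -> cmod (f.[x] - c) < r) -> lconn (fun x => cmod (f.[x] - c) = r).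
Proof.
move=> sf r0 cr; have := @level_connected (f - c%:P) r; rewrite size_subC // => /(_ sf r0).
rewrite (_ : (fun x => cmod (f - c%:P).[x] = r) = fun x => cmod (f.[x] - c) = r); last first.
  by apply/funext => x; rewrite !hornerE.
by apply=> x; rewrite !derivE subr0 !hornerE; apply: cr.
Qed.

End Lifting.

(** * Capacity and diameter *)

Section Estimates.
Variable R : realType.
Local Notation C := R[i].
Implicit Types (x y z u v w p q a b c : C) (f : {poly C}) (e d r t : R).

Lemma lconn_ivt (S : C -> Prop) (F : C -> R) x y t : lconn S ->
  (forall x, S x -> forall e, 0 < e -> exists2 d, 0 < d &
     forall y, S y -> cmod (y - x) < d -> `|F y - F x| < e) ->
  S x -> S y -> F x <= t -> t <= F y -> exists2 v, S v & F v = t.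
Proof.
move=> cS cF Sx Sy xt ty; apply: contrapT => h.
have ne v : S v -> F v != t by move=> Sv; apply/eqP => E; apply: h; exists v.
have : F y < t.
  apply: (cS (fun v => F v < t) _ x y) => //; last by rewrite lt_neqAle ne.
  move=> v Sv; have n0 : 0 < `|F v - t| by rewrite normr_gt0 subr_eq0 ne.
  have [d d0 hd] := cF v Sv _ n0; exists d => // w Sw /(hd w Sw).
  have := ne w Sw; have := ne v Sv; rewrite ltr_norml.
  case: (ltrgtP (F v) t) => // hv _; case: (ltrgtP (F w) t) => // hw _.
    by move=> /andP[? ?]; exfalso; lra.
  by move=> /andP[? ?]; exfalso; lra.
by rewrite ltNge ty.
Qed.

Lemma dist_cont c x e : 0 < e -> exists2 d, 0 < d & forall y, cmod (y - x) < d ->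
  `|cmod (y - c) - cmod (x - c)| < e.
Proof.
move=> e0; exists e => // y lt; rewrite ltr_norml.
have := cmod_tri x y c; have := cmod_tri y x c; rewrite (cmodBC x y); lra.
Qed.

(** Two points further apart would force points of [S] at distances [0], [2r], [4r] and so on from
    [x], one more than there are balls, and no two of them in one ball. *)
Lemma lconn_covered_diam (S : C -> Prop) (s : seq C) r : lconn S -> 0 < r ->
  (forall x, S x -> exists2 z, z \in s & cmod (x - z) < r) ->
  forall x y, S x -> S y -> cmod (y - x) < 2 * r * (size s)%:R.
Proof.
move=> cS r0 cov x y Sx Sy; rewrite ltNge; apply/negP => le.
have /choice[v hv] : forall k : nat, exists v, (k <= size s)%N -> S v /\ cmod (v - x) = 2 * r * k%:R.
  move=> k; have [ks|] := leqP k (size s); last by exists x.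
  have [|||||v Sv E] := @lconn_ivt S (fun v => cmod (v - x)) x y (2 * r * k%:R) cS.
  - by move=> u Su e e0; have [d d0 hd] := dist_cont x u e0; exists d => // w _; apply: hd.
  - by [].
  - by [].
  - by rewrite subrr cmod0 mulr_ge0 // mulr_ge0 // ltW.
  - by apply: le_trans le; rewrite ler_wpM2l ?mulr_ge0 ?ler_nat // ltW.
  by exists v.
have /choice[z hz] : forall k : nat, exists z, (k <= size s)%N -> z \in s /\ cmod (v k - z) < r.
  move=> k; have [ks|] := leqP k (size s); last by exists x.
  by have [z ? ?] := cov _ (hv k ks).1; exists z.
have : uniq (map z (iota 0 (size s).+1)).
  rewrite map_inj_in_uniq ?iota_uniq // => k k'; rewrite !mem_iota /= !add0n !ltnS => ks ks' E.
  have [_ vk] := hv k ks; have [_ vk'] := hv k' ks'.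
  have [_ zk] := hz k ks; have [_ zk'] := hz k' ks'; rewrite -E in zk'.
  have h1 : cmod (v k - v k') < 2 * r.
    by have := cmod_tri (z k) (v k) (v k'); rewrite (cmodBC (z k)); lra.
  have h2 := cmod_tri (v k') (v k) x; have h3 := cmod_tri (v k) (v k') x.
  rewrite (cmodBC (v k') (v k)) in h3.
  apply/eqP; rewrite eqn_leq; apply/andP; split; rewrite leqNgt; apply/negP => lt.
    have : k'%:R + 1 <= k%:R :> R by rewrite natr1 ler_nat.
    by rewrite vk vk' in h2; nra.
  have : k%:R + 1 <= k'%:R :> R by rewrite natr1 ler_nat.
  by rewrite vk vk' in h3; nra.
move=> /uniq_leq_size h; have := h s; rewrite size_map size_iota ltnn => h'.
suff : false by [].
by apply: h' => _ /mapP[k + ->]; rewrite mem_iota /= add0n ltnS => /hz[].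
Qed.

Section FiniteDifference.
Variable h : R.
Implicit Types P Q : {poly R}.

Definition fdiff P := P \Po ('X + h%:P) - P.

Lemma fdiff_coef n P : (size P <= n.+1)%N ->
  (size (fdiff P) <= n)%N /\ (fdiff P)`_n.-1 = n%:R * h * P`_n.
Proof.
elim: n P => [|n IH] P sP.
  by rewrite /fdiff (size1_polyC sP) comp_polyC subrr size_poly0 coef0 mul0r mul0r.
have [Q [c [PE sQ]]] : exists Q (c : R), P = Q * 'X + c%:P /\ (size Q <= n.+1)%N.
  exists (drop_poly 1 P), P`_0; split; last by rewrite size_drop_poly leq_subLR add1n.
  rewrite -{1}(poly_take_drop 1 P) expr1 addrC; congr (_ + _).
  by rewrite -[take_poly 1 P]/(\poly_(i < 1) _) ; apply/polyP => i; rewrite coef_poly coefC; case: i.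
have [sD cD] := IH Q sQ.
have -> : fdiff P = fdiff Q * 'X + h *: fdiff Q + h *: Q.
  rewrite /fdiff PE comp_polyD comp_polyM comp_polyC comp_polyX -!mul_polyC; ring.
have sh : (size (h *: fdiff Q) <= n.+1)%N by apply: leq_trans (size_scale_leq _ _) _; apply: leq_trans sD _.
split.
  apply: leq_trans (size_polyD _ _) _; rewrite geq_max; apply/andP; split; last first.
    exact: leq_trans (size_scale_leq _ _) sQ.
  apply: leq_trans (size_polyD _ _) _; rewrite geq_max sh andbT.
  have [->|nz] := eqVneq (fdiff Q) 0; first by rewrite mul0r size_poly0.
  by rewrite size_mulX.
have PnE : P`_n.+1 = Q`_n by rewrite PE coefD coefMX coefC /= addr0.
rewrite PnE [n.+1.-1]/= !coefD coefZ coefZ (nth_default _ sD) mulr0 addr0 coefMX.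
case: n {IH sQ sh sP PnE} sD cD => [|n] sD cD /=.
  by rewrite add0r mul1r.
by rewrite cD -[n.+2%:R]natr1; ring.
Qed.

(** The [n]-th difference with step [h] is the top coefficient times [n! h^n]; written out, it is a
    signed sum of [2 ^ n] values counted with repetition. *)
Lemma fdiff_bound n P t (B : R) : 0 <= h -> (size P <= n.+1)%N ->
  (forall k, (k <= n)%N -> `|P.[t + k%:R * h]| <= B) ->
  `|P`_n| * n`!%:R * h ^+ n <= 2 ^+ n * B.
Proof.
move=> h0; elim: n P B => [|n IH] P B sP hB.
  have := hB 0%N (leqnn _); rewrite mul0r addr0 {1}(size1_polyC sP) hornerC.
  by rewrite !expr0 !mul1r !mulr1.
have [sD cD] := fdiff_coef sP.
have := IH (fdiff P) (2 * B) sD; rewrite cD /= => H.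
apply: (@le_trans _ _ (2 ^+ n * (2 * B))); last by rewrite exprS [2 * 2 ^+ n]mulrC mulrA.
apply: le_trans (H _).
  by rewrite !normrM normr_nat (ger0_norm h0) factS natrM exprS le_eqVlt; apply/orP; left; apply/eqP; ring.
move=> k kn; rewrite /fdiff hornerD hornerN horner_comp !hornerE -addrA -{2}(mul1r h) -mulrDl natr1.
apply: le_trans (ler_normB _ _) _; rewrite (_ : 2 * B = B + B); last by ring.
apply: lerD.
  exact: hB.
by apply: hB; apply: leq_trans kn _.
Qed.

End FiniteDifference.

(** The product of the [n] numbers from [n + 1] to [2n] has all factors at least [n], and it is a
    binomial coefficient, at most [4 ^ n], times the factorial. This stands in for Stirling's
    formula. *)
Lemma expn_fact n : (n ^ n <= 4 ^ n * n`!)%N.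
Proof.
apply: (@leq_trans ('C(n + n, n) * n`!)).
  rewrite bin_ffact ffact_prod; apply: (@leq_trans (\prod_(i < n) n)).
    by rewrite prod_nat_const card_ord.
  by apply: leq_prod => i _; rewrite -addnBA ?leq_addr // ltnW.
rewrite leq_pmul2r ?fact_gt0 //.
have -> : (4 ^ n = 2 ^ (n + n))%N by rewrite addnn -mul2n expnM.
have <- : ((1 + 1) ^ (n + n) = 2 ^ (n + n))%N by [].
rewrite expnDn (bigD1 (inord n)) //=.
by rewrite inordK ?ltnS ?leq_addr // !exp1n !muln1 leq_addr.
Qed.

(* A capacity estimate: project the level set to the line through [a] and [b]
   and take finite differences of the projected polynomial. *)
Lemma lead_bound f r a b : (1 < size f)%N -> lconn (fun x => cmod f.[x] = r) ->
  cmod f.[a] <= r -> cmod f.[b] <= r ->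
  cmod (lead_coef f) * cmod (b - a) ^+ (size f).-1 <= 8 ^+ (size f).-1 * r.
Proof.
move=> sf cL ar br; have r0 : 0 <= r by apply: le_trans ar; apply: cmod_ge0.
have [->|ab] := eqVneq b a.
  rewrite subrr cmod0 expr0n; case: (size f) sf => [|[]] // n _.
  by rewrite mulr0 mulr_ge0 ?exprn_ge0.
pose k := b - a; have k0 : 0 < cmod k by rewrite cmod_gt0 subr_eq0.
pose pr x := complex.Re ((x - a) * k^*%C) / cmod k.
have prB x y : pr x - pr y = complex.Re ((x - y) * k^*%C) / cmod k.
  rewrite /pr -mulrBl -raddfB /= -mulrBl; congr (complex.Re (_ * _) / _); ring.
have prle x y : `|pr x - pr y| <= cmod (x - y).
  rewrite prB normrM normfV (gtr0_norm k0) ler_pdivrMr //; apply: le_trans (Re_le_cmod _) _.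
  by rewrite cmodM (_ : cmod k^*%C = cmod k) // /cmod; case: (k) => u v /=; rewrite sqrrN.
have prk t c : pr (c + t%:C%C * k) = pr c + t * cmod k.
  apply/eqP; rewrite -subr_eq0 opprD addrA subr_eq0 prB addrC addKr -mulrA.
  apply/eqP; have : complex.Re (t%:C%C * (k * k^*%C)) = t * cmod k ^+ 2.
    by rewrite cmod_sqr; case: (k) => x y /=; ring.
  by move=> ->; rewrite expr2 mulrA mulfK // gt_eqF.
have pa : pr a = 0 by rewrite /pr subrr mul0r /= mul0r.
have pb : pr b = cmod k by have := prk 1 a; rewrite rmorph1 !mul1r pa add0r /k addrC subrK.
have [T T0 hT] := poly_infty r sf.
(* [a] and [b] need not lie on the level set. Moving outwards along their line reaches points of it
   whose projections enclose the whole interval. *)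
have ray c s : (s = 1 \/ s = -1) -> cmod f.[c] <= r -> exists t, [/\ 0 <= t, cmod f.[c + (s * t)%:C%C * k] = r & True].
  move=> hs cr; pose y := c + (s * ((T + cmod c) / cmod k))%:C%C * k.
  have yr : r <= cmod f.[y].
    apply: hT; have := cmod_le_sub (y - c) (- c); rewrite opprK subrK cmodN /y addrC addKr cmodM cmodC.
    rewrite normrM (_ : `|s| = 1); last by case: hs => ->; rewrite ?normrN normr1.
    by rewrite mul1r ger0_norm ?divfK ?gt_eqF //; [lra | rewrite divr_ge0 ?addr_ge0 ?cmod_ge0 // ltW].
  have [t /andP[t0 t1] E] := poly_seg_ivt cr yr.
  exists (t * ((T + cmod c) / cmod k)); split => //.
    by rewrite mulr_ge0 // divr_ge0 ?addr_ge0 ?cmod_ge0 // ltW.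
  rewrite -E /seg /y; congr (cmod f.[_]); rewrite !rmorphM; ring.
have [s1 [s10 E1 _]] := ray a (-1) (or_intror erefl) ar.
have [s2 [s20 E2 _]] := ray b 1 (or_introl erefl) br.
have onto t : 0 <= t <= cmod k -> exists2 x, cmod f.[x] = r & pr x = t.
  move=> /andP[t0 t1]; apply: (@lconn_ivt (fun x => cmod f.[x] = r) pr _ _ t cL _ E1 E2).
  - move=> x _ e e0; exists e => // y _; apply: le_lt_trans; exact: prle.
  - by rewrite prk pa add0r mulN1r mulNr; apply: le_trans t0; rewrite oppr_le0 mulr_ge0 // ltW.
  - by rewrite prk pb mul1r; apply: le_trans t1 _; rewrite lerDl mulr_ge0 // ltW.
have [s [sz _ hs]] := subC_split 0 sf.
set A := cmod (lead_coef f) in hs *; have A0 : 0 < A by apply: lead_gt0.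
set n := (size f).-1 in sz *.
have n0 : (0 < n)%N by rewrite /n; case: size sf => [|[]].
(* Projection shortens distances, so the polynomial with the projected roots is bounded by [r / A]
   on the whole interval. *)
pose P : {poly R} := \prod_(z <- s) ('X - (pr z)%:P).
have sP : size P = n.+1 by rewrite size_prod_XsubC sz.
have Pn : P`_n = 1.
  have : lead_coef P = 1 by apply/monicP/monic_prod_XsubC.
  by rewrite lead_coefE sP.
have hB t : 0 <= t <= cmod k -> `|P.[t]| <= r / A.
  move=> /onto[x fx <-]; rewrite ler_pdivlMr // -fx -[f.[x]]subr0 hs mulrC ler_wpM2l ?(ltW A0) //.
  rewrite horner_prod normr_prod; apply: ler_prod => z _.
  by rewrite normr_ge0 hornerXsubC /=.
have h0 : 0 <= cmod k / n%:R by rewrite divr_ge0 ?ltW ?ltr0n.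
(* [n] equal steps across the interval; combined with [expn_fact] they produce the constant
   [8 = 2 * 4]. *)
have := @fdiff_bound (cmod k / n%:R) n P 0 (r / A) h0 (eq_leq sP); rewrite Pn normr1 mul1r => H.
have {}H : n`!%:R * (cmod k / n%:R) ^+ n <= 2 ^+ n * (r / A).
  apply: H => j jn; apply: hB; rewrite add0r mulr_ge0 //=.
  by rewrite mulrA ler_pdivrMr ?ltr0n // mulrC ler_wpM2l ?ler_nat // ltW.
have e1 : n%:R ^+ n <= 4 ^+ n * n`!%:R :> R by rewrite -!natrX -natrM ler_nat expn_fact.
have nn0 : 0 < n%:R ^+ n :> R by rewrite exprn_gt0 // ltr0n.
have f0 : 0 < n`!%:R :> R by rewrite ltr0n fact_gt0.
move: H; rewrite exprMn exprVn !mulrA ler_pdivrMr // mulrAC ler_pdivlMr // => H.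
rewrite -(ler_pM2r f0).
have -> : A * cmod k ^+ n * n`!%:R = n`!%:R * cmod k ^+ n * A by ring.
apply: le_trans H _.
have -> : 8 ^+ n * r * n`!%:R = 2 ^+ n * r * (4 ^+ n * n`!%:R).
  rewrite (_ : 8 = 2 * 4 :> R); last by lra. by rewrite exprMn; ring.
by rewrite ler_wpM2l // mulr_ge0 // exprn_ge0.
Qed.

(* If [f] has no zero near [j], then averaging over the [n] points [q] with
   [(q - j)^n = (p - j)^n] compares [|f p|] with [|f j|^n]. *)
Lemma circle_average f j p r n : (1 < size f)%N -> (0 < n)%N -> 0 < r ->
  (forall z, f.[z] = 0 -> 2 * cmod (p - j) <= cmod (z - j)) ->
  (forall q, cmod (q - j) = cmod (p - j) -> r <= cmod f.[q]) ->
  cmod f.[p] * r ^+ n.-1 <= cmod f.[j] ^+ n * (1 + 2 ^- n) ^+ (size f).-1.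
Proof.
move=> sf n0 r0 far low; have [s [sz rt hs]] := subC_split 0 sf.
set A := cmod (lead_coef f) in hs; have A0 : 0 < A by apply: lead_gt0.
have hs' x : cmod f.[x] = A * \prod_(z <- s) cmod (x - z) by rewrite -hs subr0.
pose c := (p - j) ^+ n.
have [w wE] := closed_field_poly_normal ('X^n - c%:P : {poly C}).
have sX : size ('X^n - c%:P : {poly C}) = n.+1 by rewrite size_XnsubC.
have lX : lead_coef ('X^n - c%:P : {poly C}) = 1 by apply/eqP; rewrite -monicE monicXnsubC.
rewrite lX scale1r in wE.
have szw : size w = n by have := congr1 (size \o (@polyseq _)) wE; rewrite /= sX size_prod_XsubC => -[].
have hw z : z ^+ n - c = \prod_(y <- w) (z - y).
  have := congr1 (horner^~ z) wE; rewrite !hornerE horner_prod => ->.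
  by apply: eq_bigr => y _; rewrite hornerXsubC.
have wc y : y \in w -> y ^+ n = c.
  move=> yw; apply/eqP; rewrite -subr_eq0 hw; apply/eqP; rewrite (big_rem y) //= subrr mul0r //.
have wmod y : y \in w -> cmod y = cmod (p - j).
  move=> /wc E; apply/eqP; rewrite -(@eqrXn2 _ n) ?cmod_ge0 // -!cmodX E //.
have pw : p - j \in w.
  have : \prod_(y <- w) ((p - j) - y) == 0 by rewrite -hw subrr.
  by rewrite prodf_seq_eq0 => /hasP[y yw /=]; rewrite subr_eq0 => /eqP ->.
(* The products over the zeros of [f] and over the points of the circle are exchanged; for a fixed
   zero [z] the inner one is [X^n - c] at [z - j]. *)
have E1 : \prod_(y <- w) cmod f.[j + y] = A ^+ n * \prod_(z <- s) cmod ((z - j) ^+ n - c).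
  under eq_bigr => y _ do rewrite hs'.
  rewrite big_split /= big_const_seq count_predT szw -Monoid.iteropE /=; congr (_ * _).
  rewrite exchange_big /=; apply: eq_bigr => z _; rewrite hw cmod_prod; apply: eq_bigr => y _.
  by rewrite cmodBC; congr cmod; ring.
have lo : cmod f.[p] * r ^+ n.-1 <= \prod_(y <- w) cmod f.[j + y].
  rewrite (big_rem _ pw) /= addrC subrK ler_wpM2l ?cmod_ge0 //.
  rewrite -szw -(size_rem pw); apply: prod_ge_exp; first exact: ltW.
  by move=> y /mem_rem/wmod E; apply: low; rewrite addrC addKr.
apply: le_trans lo _; rewrite E1 hs' exprMn -mulrA ler_wpM2l ?exprn_ge0 ?(ltW A0) //.
rewrite -sz; apply: (@le_trans _ _ (\prod_(z <- s) (cmod (j - z) ^+ n * (1 + 2 ^- n)))); last first.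
  by rewrite big_split /= prodrXl big_const_seq count_predT -Monoid.iteropE.
rewrite big_seq [leRHS]big_seq; apply: ler_prod => z zs; rewrite cmod_ge0 /=.
(* A zero is at least twice as far from [j] as [p], so [c] has modulus at most [2^-n] times that of
   [(z - j)^n]. *)
have h := far z (rt z zs).
apply: le_trans (cmodB _ _) _; rewrite /c !cmodX (cmodBC z) mulrDr mulr1 lerD2l.
rewrite ler_pdivlMr ?exprn_gt0 // -exprMn; apply: lerXn2r; rewrite ?nnegrE ?mulr_ge0 ?cmod_ge0 //.
by rewrite (cmodBC j) mulrC.
Qed.

End Estimates.

(** * Julia sets of semigroups escaping to infinity *)

Section EscapeSemigroup.
Variable R : realType.
Local Notation C := R[i].
Implicit Types (x y z u v p a b l c : C) (f g : {poly C}) (e d r t : R) (n m : nat).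

(** Admits the empty word, so that a factor of a composition may be absent. *)
Definition with_id (G : {poly C} -> Prop) f := G f \/ f = 'X.

Definition itp g n : {poly C} := iter n (fun h => g \Po h) 'X.

Lemma itpS g n : itp g n.+1 = g \Po itp g n. Proof. by []. Qed.

Lemma itp_add g n m : itp g (n + m) = itp g n \Po itp g m.
Proof. by elim: n => [|n IH]; rewrite ?comp_polyX // addSn !itpS IH comp_polyA. Qed.

Lemma horner_itpS g n x : (itp g n.+1).[x] = g.[(itp g n).[x]].
Proof. by rewrite itpS horner_comp. Qed.

Lemma with_id_comp (H : {poly C} -> Prop) f g : closed_comp H -> H f -> with_id H g -> H (f \Po g).
Proof. by move=> cH Hf [Hg|->]; [apply: cH | rewrite comp_polyXr]. Qed.

Lemma with_id_comp' (H : {poly C} -> Prop) f g : closed_comp H -> with_id H f -> H g -> H (f \Po g).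
Proof. by move=> cH [Hf|->] Hg; [apply: cH | rewrite comp_polyX]. Qed.

Lemma closed_itp (H : {poly C} -> Prop) g n : closed_comp H -> H g -> H (itp g n.+1).
Proof. by move=> cH Hg; elim: n => [|n IH]; rewrite itpS ?comp_polyXr //; apply: cH. Qed.

Variables (G : {poly C} -> Prop) (r0 : R).

(** The working form of the hypotheses on [G]: one radius for all elements, and boundedness of the
    finite postcritical set restated as membership of critical values in [Khat G]. *)
Definition escaping := [/\ closed_comp G, exists g, G g, (forall g, G g -> (2 < size g)%N) /\ 1 <= r0,
  forall g x, G g -> r0 <= cmod x -> 2 * cmod x <= cmod g.[x] &
  forall g x, G g -> g^`().[x] = 0 -> Khat G g.[x]].

Hypothesis esc : escaping.

Let GC : closed_comp G. Proof. by case: esc. Qed.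

Lemma esc_size g : G g -> (1 < size g)%N.
Proof. by case: esc => _ _ [h _] _ _ /h; apply: ltn_trans. Qed.

Lemma esc_r0 : 1 <= r0. Proof. by case: esc => _ _ []. Qed.

Lemma esc_double g x : G g -> r0 <= cmod x -> 2 * cmod x <= cmod g.[x].
Proof. by case: esc => _ _ _ h _; apply: h. Qed.

Lemma esc_stay g x r : G g -> r0 <= r -> r < cmod x -> r < cmod g.[x].
Proof.
move=> Gg rr rx; have := esc_double Gg (le_trans rr (ltW rx)).
by have := esc_r0; lra.
Qed.

Lemma withG_comp f g : with_id G f -> G g -> G (f \Po g).
Proof. exact: with_id_comp' GC. Qed.

Lemma withG_comp' f g : G f -> with_id G g -> G (f \Po g).
Proof. exact: with_id_comp GC. Qed.

Lemma withG_itp g n : G g -> with_id G (itp g n).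
Proof. by case: n => [|n] Gg; [right | left; apply: closed_itp GC Gg]. Qed.

Lemma G_itpS g n : G g -> G (itp g n.+1).
Proof. exact: closed_itp GC. Qed.

Lemma withG_double g x : with_id G g -> r0 <= cmod x -> cmod x <= cmod g.[x].
Proof.
move=> [Gg|->]; last by rewrite hornerX.
by move=> h; have := esc_double Gg h; have := cmod_ge0 x; lra.
Qed.

Lemma withG_size f : with_id G f -> (1 < size f)%N.
Proof. by move=> [/esc_size//|->]; rewrite size_polyX. Qed.

Lemma itp_grow g x n : G g -> r0 <= cmod x -> n%:R <= cmod (itp g n).[x].
Proof.
move=> Gg xr; suff [] : r0 <= cmod (itp g n).[x] /\ n%:R <= cmod (itp g n).[x] by [].
elim: n => [|n [h1 h2]]; first by rewrite hornerX cmod_ge0.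
rewrite horner_itpS -natr1; have := esc_double Gg h1; have := esc_r0; split; lra.
Qed.

Lemma G_unbounded x g t : G g -> r0 <= cmod x -> exists2 f, G f & t <= cmod f.[x].
Proof.
move=> Gg xr; exists (itp g (Num.bound `|t|).+1); first exact: G_itpS.
apply: le_trans (itp_grow _ Gg xr); apply: le_trans (ler_norm t) _.
by apply: le_trans (ltW (archi_boundP (normr_ge0 t))) _; rewrite ler_nat.
Qed.

Lemma Khat_lt x : Khat G x -> cmod x < r0.
Proof.
move=> [M hM]; rewrite ltNge; apply/negP => le; have [_ [g Gg] _ _ _] := esc.
by have [f Gf] := G_unbounded (M + 1) Gg le; have := hM f Gf; lra.
Qed.

Lemma Khat_forward g x : G g -> Khat G x -> Khat G g.[x].
Proof. by move=> Gg [M hM]; exists M => f Gf; rewrite -horner_comp; apply/hM/GC. Qed.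

(** Images of points of [Khat G] stay in [Khat G], hence below [r0]. One bound for all points
    exhibits [Khat G] as an intersection of closed sets. *)
Lemma KhatP x : Khat G x <-> forall g, G g -> cmod g.[x] <= r0.
Proof.
split=> [Kx g Gg|h]; last by exists r0.
by apply/ltW/Khat_lt/Khat_forward.
Qed.

Lemma withG_Khat g x : with_id G g -> Khat G x -> Khat G g.[x].
Proof. by move=> [|->]; rewrite ?hornerX //; apply: Khat_forward. Qed.

Lemma Khat_closed : cclosed (Khat G).
Proof.
move=> x h; apply/KhatP => g Gg; apply: poly_preim_closed => e /h[y /KhatP Ky yx].
by exists y => //; apply: Ky.
Qed.

Lemma Khat_compact : ccompact (Khat G).
Proof. by split; [exact: Khat_closed | exists r0 => x /Khat_lt/ltW]. Qed.

Lemma crit_Khat g x : with_id G g -> g^`().[x] = 0 -> Khat G g.[x].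
Proof.
case: esc => _ _ _ _ h [/h//|->]; first exact.
by rewrite derivX hornerC => /eqP; rewrite oner_eq0.
Qed.

Local Notation J := (fun x => Julia G (Some x)).

Lemma boundary_Khat_julia x : cboundary (Khat G) x -> J x.
Proof.
move=> bx; apply: (@julia_escape _ _ _ r0) => d d0; have [_ [p np xp]] := bx d d0.
have [g Gg gp] : exists2 g, G g & r0 < cmod g.[p].
  apply: contrapT => h; apply: np; apply/KhatP => g Gg.
  by rewrite leNgt; apply/negP => lt; apply: h; exists g.
have [f Gf fp] := G_unbounded (r0 + 1) Gg (ltW gp).
exists (f \Po g), p; split; rewrite ?horner_comp //; first exact: GC.
  by rewrite cmodBC.
have Kx : Khat G x by apply: boundary_closed bx; exact: Khat_closed.
by apply/ltW/Khat_lt/Khat_forward => //; apply: Khat_forward.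
Qed.

Lemma julia_Khat_boundary x : J x -> Khat G x -> cboundary (Khat G) x.
Proof.
move=> Jx Kx; apply: boundaryP => // Ix; apply: Jx; apply: (fatou_interior _ Ix (M := r0)).
by move=> f y Gf /KhatP; apply.
Qed.

Lemma julia_backward g x : G g -> J g.[x] -> J x.
Proof.
move=> Gg Jg Fx; apply: Jg; apply: fatou_forward Fx; first exact: esc_size.
by move=> f Gf; apply: GC.
Qed.

(* [filled g f] is the preimage under [f] of the filled Julia set of [g]. *)
Definition filled g f x := forall n, cmod (itp g n \Po f).[x] <= r0.

Lemma filled_comp g f h x : filled g f h.[x] <-> filled g (f \Po h) x.
Proof. by split=> K n; have := K n; rewrite !horner_comp. Qed.

Lemma filled_closed g f : cclosed (filled g f).
Proof.
move=> x h n; apply: poly_preim_closed => e /h[y Ky yx]; exists y => //; exact: Ky.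
Qed.

Lemma filled_bound g f x : with_id G f -> filled g f x -> cmod x <= r0.
Proof.
move=> Wf K; rewrite leNgt; apply/negP => lt; have := K 0%N; rewrite /= comp_polyX.
by have := withG_double Wf (ltW lt); lra.
Qed.

Lemma filled_compact g f : with_id G f -> ccompact (filled g f).
Proof. by move=> Wf; split; [exact: filled_closed | exists r0 => x; apply: filled_bound]. Qed.

Lemma Khat_filled g f x : G g -> with_id G f -> Khat G x -> filled g f x.
Proof.
move=> Gg Wf Kx n; rewrite horner_comp; apply/ltW/Khat_lt/withG_Khat; first exact: withG_itp.
exact: withG_Khat.
Qed.

Lemma itp_stay g x n m : G g -> r0 < cmod (itp g n).[x] -> (n <= m)%N -> r0 < cmod (itp g m).[x].
Proof.
move=> Gg h; elim: m => [|m IH]; first by rewrite leqn0 => /eqP <-.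
rewrite leq_eqVlt => /orP[/eqP <-//|/IH lt]; rewrite horner_itpS.
exact: esc_stay.
Qed.

Lemma not_filled g f x : G g -> ~ filled g f x ->
  exists n, forall m, (n <= m)%N -> r0 < cmod (itp g m \Po f).[x].
Proof.
move=> Gg h; apply: contrapT => ne; apply: h => n; rewrite leNgt; apply/negP => lt.
by apply: ne; exists n => m nm; rewrite horner_comp; apply: itp_stay nm => //; rewrite -horner_comp.
Qed.

Lemma filled_boundary_in g f x : cboundary (filled g f) x -> filled g f x.
Proof. by apply: boundary_closed; exact: filled_closed. Qed.

Lemma filled_boundary_escape g f x d : G g -> cboundary (filled g f) x -> 0 < d ->
  forall t, exists n p, cmod (p - x) < d /\ t <= cmod (itp g n.+1 \Po f).[p].
Proof.
move=> Gg bx d0 t; have [_ [p np xp]] := bx d d0; have [n hn] := not_filled Gg np.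
pose k := Num.bound `|t|.
exists (k + n)%N, p; rewrite cmodBC; split => //.
rewrite -addSn itp_add -comp_polyA horner_comp.
apply: le_trans (itp_grow k.+1 Gg (ltW (hn n (leqnn _)))).
apply: le_trans (ler_norm t) _; apply: le_trans (ltW (archi_boundP (normr_ge0 t))) _.
by rewrite ler_nat.
Qed.

Lemma filled_boundary_julia g f x : G g -> with_id G f -> cboundary (filled g f) x -> J x.
Proof.
move=> Gg Wf bx; apply: (@julia_escape _ _ _ r0) => d d0.
have [n [p [px h]]] := filled_boundary_escape Gg bx d0 (r0 + 1).
exists (itp g n.+1 \Po f), p; split => //; first exact: withG_comp' (G_itpS _ Gg) Wf.
exact: filled_boundary_in bx _.
Qed.

(** Ties the Julia set of the single map [g], which is what the hypothesis on [Gam] speaks of, to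
    the sets [filled g 'X]. *)
Lemma filled_boundary_julia1 g x : G g -> cboundary (filled g 'X) x -> Julia1 g (Some x).
Proof.
move=> Gg bx; apply: (@julia_escape _ _ _ r0) => d d0.
have [n [p [px h]]] := filled_boundary_escape Gg bx d0 (r0 + 1).
exists (itp g n.+1), p; rewrite comp_polyXr in h; split => //.
  move=> T gT cT; have Tg : T g by apply: gT.
  by elim: n {h} => [|n IH]; rewrite itpS ?comp_polyXr //; apply: cT.
by have := filled_boundary_in bx n.+1; rewrite comp_polyXr.
Qed.

(** Critical values lie in [Khat G], strictly inside radius [r0], so this one level works for every
    element. *)
Lemma level_G f : G f -> lconn (fun x => cmod f.[x] = r0).
Proof.
move=> Gf; apply: level_connected; first exact: esc_size.
  by apply: lt_le_trans esc_r0.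
by move=> x fx; apply: Khat_lt; apply: crit_Khat => //; left.
Qed.

(* The boundary is a Hausdorff limit of the connected level sets of [itp g m \Po f]. *)
Lemma filled_boundary_chain g f x y e : G g -> with_id G f -> 0 < e ->
  cboundary (filled g f) x -> cboundary (filled g f) y -> chain (cboundary (filled g f)) e x y.
Proof.
move=> Gg Wf e0 bx by_; pose F m := itp g m \Po f.
have e3 : 0 < e / 3 by rewrite divr_gt0.
have near z : cboundary (filled g f) z -> exists m0, forall m, (m0 <= m)%N ->
    exists2 l, cmod (F m).[l] = r0 & cmod (l - z) < e / 3.
  move=> bz; have [_ [p np zp]] := bz _ e3; have [m0 hm0] := not_filled Gg np.
  exists m0 => m /hm0 lt; have [t t01 E] := poly_seg_ivt (filled_boundary_in bz m) (ltW lt).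
  by exists (seg z p t) => //; apply: le_lt_trans (seg_dist_l _ _ t01) _; rewrite cmodBC.
(* Level sets of high index lie close to the boundary: otherwise level points of growing index, all
   far from it, would cluster at some [l] that turns out to be a boundary point. *)
have [m1 hm1] : exists m1, forall m l, (m1 <= m)%N -> cmod (F m).[l] = r0 ->
    exists2 b, cboundary (filled g f) b & cmod (b - l) < e / 3.
  apply: contrapT => ne.
  have /choice[ml hml] : forall k : nat, exists ml : nat * C, [/\ (k <= ml.1)%N, cmod (F ml.1).[ml.2] = r0 &
      forall b, cboundary (filled g f) b -> e / 3 <= cmod (b - ml.2)].
    move=> k; apply: contrapT => h; apply: ne; exists k => m l km E; apply: contrapT => h1.
    apply: h; exists (m, l); split => // b bb; rewrite leNgt; apply/negP => lt; apply: h1; by exists b.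
  have bd n : cmod ((ml n).2 - 0) <= r0.
    rewrite subr0 leNgt; apply/negP => lt; have [_ E _] := hml n.
    have h1 := withG_double Wf (ltW lt).
    have := withG_double (withG_itp (ml n).1 Gg) (le_trans (ltW lt) h1).
    by rewrite -horner_comp E; lra.
  have [phi ip [l _ hl]] := ccompact_seq (ball_compact 0 r0) bd.
  have Kl : filled g f l.
    move=> n; apply: poly_preim_closed => d /hl[N hN]; pose k := maxn N n.
    exists (ml (phi k)).2; last by apply: hN; apply: leq_maxl.
    have [h1 E _] := hml (phi k); rewrite leNgt; apply/negP => lt.
    have nk : (n <= (ml (phi k)).1)%N.
      by apply: leq_trans h1; apply: leq_trans (incr_ge _ ip); apply: leq_maxr.
    rewrite horner_comp in lt; have := itp_stay Gg lt nk; rewrite -horner_comp E ltxx //.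
  (* One more application of [g] at least doubles the modulus [r0] of a level point, so level points
     are never filled and [l] is not interior. *)
  have bl : cboundary (filled g f) l.
    apply: boundaryP => // -[d d0 hd]; have [N hN] := hl d d0.
    have [_ E _] := hml (phi N); have := hd _ (hN N (leqnn _)) (ml (phi N)).1.+1.
    rewrite itpS -comp_polyA horner_comp => h.
    have := @esc_double g (F (ml (phi N)).1).[(ml (phi N)).2] Gg; rewrite E => /(_ (lexx _)) h2.
    by have := le_trans h2 h; have := esc_r0; lra.
  have [N hN] := hl _ e3; have [_ _ /(_ l bl)] := hml (phi N).
  by rewrite leNgt cmodBC hN.
have [mx hx] := near x bx; have [my hy] := near y by_.
pose m := (maxn m1 (maxn mx my)).+1.
have mm1 : (m1 <= m)%N by rewrite /m; lia.
have [lx Ex dx] := hx m (ltac:(rewrite /m; lia)); have [ly Ey dy] := hy m (ltac:(rewrite /m; lia)).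
have GF : G (F m) by apply: withG_comp' (G_itpS _ Gg) Wf.
have := lconn_chain (level_G GF) e3 Ex Ey.
(* A chain in the level set is shadowed by boundary points, each step costing three times
   [e / 3]. *)
have main v : chain (fun x => cmod (F m).[x] = r0) (e / 3) lx v ->
    forall b, cboundary (filled g f) b -> cmod (b - v) < e / 3 -> chain (cboundary (filled g f)) e x b.
  elim=> [_ b bb bl|{}v z cv IH Lz vz b bb bz].
    by apply: chain1 => //; have := cmod_tri lx b x; lra.
  have [_ Lv] := chain_in cv; have [b' bb' b'v] := hm1 m v mm1 Lv.
  apply: chain_step (IH b' bb' b'v) bb _.
  have := cmod_tri z b b'; have := cmod_tri v z b'; rewrite (cmodBC v b'); lra.
by move=> /main; apply => //; rewrite cmodBC.
Qed.

Lemma segment_filled g f x y : filled g f x -> ~ filled g f y ->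
  exists2 z, cboundary (filled g f) z & cmod (z - x) <= cmod (y - x) /\ cmod (z - y) <= cmod (y - x).
Proof.
move=> Kx nKy; have [t t01 bt] := segment_boundary Kx nKy.
by exists (seg x y t) => //; rewrite seg_dist_l ?seg_dist_r.
Qed.

(** [z] is on the boundary of [Khat G], so some point near it is sent beyond [r0] by a single [g];
    on the way there the segment from [z] leaves [filled g 'X]. *)
Lemma near_filled_boundary z e : 0 < e -> J z -> Khat G z ->
  exists g j, [/\ G g, cboundary (filled g 'X) j & cmod (j - z) < e].
Proof.
move=> e0 Jz Kz; have WX : with_id G 'X by right.
have bz := julia_Khat_boundary Jz Kz; have [_ [p np zp]] := bz e e0.
have [g Gg gp] : exists2 g, G g & r0 < cmod g.[p].
  apply: contrapT => h; apply: np; apply/KhatP => g Gg.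
  by rewrite leNgt; apply/negP => lt; apply: h; exists g.
have nf : ~ filled g 'X p by move=> /(_ 1%N); rewrite /= !comp_polyXr leNgt gp.
have [j bj [j1 _]] := segment_filled (Khat_filled Gg WX Kz) nf.
by exists g, j; split => //; apply: le_lt_trans j1 _; rewrite cmodBC.
Qed.

(* The sets [filled g 'X] are nested whenever their boundaries are disjoint. *)
Lemma julia_Khat_chain x y e : 0 < e -> J x -> Khat G x -> J y -> Khat G y -> chain J e x y.
Proof.
move=> e0 Jx Kx Jy Ky; apply: contrapT => nc.
have WX : with_id G 'X by right.
have [g [j [Gg bj jx]]] := near_filled_boundary e0 Jx Kx; have [g' [j' [Gg' bj' jy]]] := near_filled_boundary e0 Jy Ky.
have chJ h a b : G h -> cboundary (filled h 'X) a -> cboundary (filled h 'X) b -> chain J e a b.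
  by move=> Gh ba bb; apply: chain_sub (filled_boundary_chain Gh WX e0 ba bb) => z; apply: filled_boundary_julia.
have far a b : cboundary (filled g 'X) a -> cboundary (filled g' 'X) b -> e <= cmod (b - a).
  move=> ba bb; rewrite leNgt; apply/negP => lt; apply: nc.
  apply: chain_trans (_ : chain J e x j) _.
    by apply: chain1 => //; exact: filled_boundary_julia bj.
  apply: chain_trans (chJ g j a Gg bj ba) _.
  apply: chain_trans (_ : chain J e a b) _.
    by apply: chain1 => //; [exact: filled_boundary_julia ba | exact: filled_boundary_julia bb].
  apply: chain_trans (chJ g' b j' Gg' bb bj') _.
  by apply: chain1; rewrite 1?cmodBC //; exact: filled_boundary_julia bj'.
(* Start near [z], which lies in both filled sets, and follow a chain along the boundary of
   [filled h 'X]. A step leaving [filled h' 'X] would cross its boundary within distance [e],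
   against [fr]. *)
have inc h h' z k : G h -> G h' ->
   (forall a b, cboundary (filled h 'X) a -> cboundary (filled h' 'X) b -> e <= cmod (b - a)) ->
   Khat G z -> cboundary (filled h 'X) k -> cmod (k - z) < e ->
   forall a, cboundary (filled h 'X) a -> filled h' 'X a.
  move=> Gh Gh' fr Kz bk kz a ba.
  have Kk : filled h' 'X k.
    apply: contrapT => nK; have [c bc [_ c2]] := segment_filled (Khat_filled Gh' WX Kz) nK.
    by have := fr k c bk bc; lra.
  have := filled_boundary_chain Gh WX e0 bk ba; elim=> [//|u v cu Ku bv uv].
  apply: contrapT => nK; have [c bc [c1 _]] := segment_filled Ku nK.
  by have [_ bu] := chain_in cu; have := fr u c bu bc; lra.
have inc2 h h' : G h -> G h' -> (forall a, cboundary (filled h 'X) a -> filled h' 'X a) ->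
   forall a, filled h 'X a -> filled h' 'X a.
  move=> Gh Gh' ih a Ka n; have [b Kb [nb le]] := max_principle (itp h' n \Po 'X) (filled_compact h WX) Ka.
  by apply: le_trans le _; apply: ih; apply: boundaryP.
have far' a b : cboundary (filled g' 'X) a -> cboundary (filled g 'X) b -> e <= cmod (b - a).
  by move=> ba bb; rewrite cmodBC; apply: far.
have i1 := inc2 g g' Gg Gg' (inc g g' x j Gg Gg' far Kx bj jx).
have i2 := inc2 g' g Gg' Gg (inc g' g y j' Gg' Gg far' Ky bj' jy).
(* Inclusion holds both ways, so the two boundaries coincide, and [far] fails at distance zero. *)
have E : filled g 'X = filled g' 'X by apply/funext => a; apply/propext; split; auto.
have bb : cboundary (filled g' 'X) j by rewrite -E.
by have := far j j bj bb; rewrite subrr cmod0; lra.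
Qed.

End EscapeSemigroup.

(** * Images of the smallest filled Julia set *)

Section Growth.
Variable R : realType.
Local Notation C := R[i].
Implicit Types (x y z u a c : C) (f : {poly C}) (d r t : R) (n m : nat).

Lemma zeros_lower f r x : (1 < size f)%N -> 0 < r -> (forall z, f.[z] = 0 -> cmod z <= r) ->
  r <= cmod x -> cmod (lead_coef f) * (cmod x - r) ^+ (size f).-1 <= cmod f.[x].
Proof.
move=> sf r0 zr xr; have [s [sz rt hs]] := subC_split 0 sf.
rewrite -[f.[x]]subr0 hs -sz ler_wpM2l ?cmod_ge0 //; apply: prod_ge_exp; first by rewrite subr_ge0.
by move=> z /rt/zr zr'; have := cmod_le_sub x z; lra.
Qed.

Lemma zeros_upper f r x : (1 < size f)%N -> 0 < r -> (forall z, f.[z] = 0 -> cmod z <= r) ->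
  cmod x <= r -> cmod f.[x] <= cmod (lead_coef f) * (2 * r) ^+ (size f).-1.
Proof.
move=> sf r0 zr xr; have [s [sz rt hs]] := subC_split 0 sf.
rewrite -[f.[x]]subr0 hs -sz ler_wpM2l ?cmod_ge0 //; apply: prod_le_exp => z /rt/zr zr'.
by rewrite cmod_ge0 /=; have := cmodB x z; lra.
Qed.

(** The uncontrolled leading coefficient is eliminated between the bounds at [x] and at [y]; only
    the degree remains. *)
Lemma zeros_growth f r c x y : (1 < size f)%N -> 0 < r -> (forall z, f.[z] = 0 -> cmod z <= r) ->
  cmod y <= r -> r <= cmod x ->
  cmod f.[y] * ((cmod x - r) / (2 * r)) ^+ (size f).-1 <= cmod f.[x].
Proof.
move=> sf r0 zr yr xr; apply: le_trans (zeros_lower sf r0 zr xr).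
have h := zeros_upper sf r0 zr yr; rewrite expr_div_n mulrA ler_pdivrMr ?exprn_gt0 ?mulr_gt0 //.
rewrite mulrAC; apply: ler_wpM2r h; by rewrite exprn_ge0 // subr_ge0.
Qed.

Lemma superlinear f t : (2 < size f)%N -> exists2 r, 0 < r & forall x, r <= cmod x -> t * cmod x <= cmod f.[x].
Proof.
move=> sf; have sf1 : (1 < size f)%N by apply: ltn_trans sf.
have [K K0 hK] := poly_infty 1 sf1.
have zK z : f.[z] = 0 -> cmod z <= K.
  by move=> fz; rewrite leNgt; apply/negP => /ltW/hK; rewrite fz cmod0 ler10.
have a0 := lead_gt0 sf1; set a := cmod _ in a0.
have t0 := normr_ge0 t.
(* [2 * K] makes [cmod x - K] at least half of [cmod x], [2] makes it at least one, for the surplus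
   factors, and the last term pays for [t]. *)
exists (2 * K + 2 + 4 * `|t| / a).
  by rewrite ltr_wpDr ?divr_ge0 ?mulr_ge0 ?(ltW a0) //; lra.
move=> x hx; have u0 : 0 <= 4 * `|t| / a by rewrite divr_ge0 ?mulr_ge0 ?(ltW a0).
have Kx : K <= cmod x by lra.
apply: le_trans (zeros_lower sf1 K0 zK Kx); rewrite -/a.
have [n nE] : exists n, (size f).-1 = n.+2 by exists (size f - 3)%N; lia.
have y1 : 1 <= cmod x - K by lra.
rewrite nE exprS exprS.
have h1 : 1 <= (cmod x - K) ^+ n by rewrite exprn_ege1.
have h2 : cmod x / 2 <= cmod x - K by lra.
have h3 : `|t| * 4 <= a * cmod x.
  have : 4 * `|t| / a <= cmod x by lra.
  by rewrite ler_pdivrMr //; lra.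
have h4 : t * cmod x <= `|t| * cmod x by rewrite ler_wpM2r ?cmod_ge0 ?ler_norm.
apply: le_trans h4 _.
apply: (@le_trans _ _ (a * (cmod x / 2 * (cmod x / 2)))).
  have := cmod_ge0 x; nra.
rewrite ler_wpM2l ?(ltW a0) // ler_pM //; try by rewrite divr_ge0 ?cmod_ge0.
by apply: le_trans h2 _; rewrite ler_peMr //; lra.
Qed.

(* The constant makes the growth factor [(|x| - r) / (2 r)] of [zeros_growth] at least [4 r + 1]. *)
Lemma uniform_escape (F : {poly C} -> Prop) r : 1 <= r -> (forall f, F f -> (2 < size f)%N) ->
  (forall f x, F f -> r <= cmod x -> 1 <= cmod f.[x]) ->
  forall f x, F f -> r + 2 * r * (4 * r + 1) <= cmod x -> 2 * cmod x <= cmod f.[x].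
Proof.
move=> r1 sF F1 f x Ff xr; have sf := sF f Ff; have sf1 : (1 < size f)%N by apply: ltn_trans sf.
have r0 : 0 < r by lra.
have zr z : f.[z] = 0 -> cmod z <= r.
  by move=> fz; rewrite leNgt; apply/negP => /ltW/(F1 f z Ff); rewrite fz cmod0 ler10.
have cr : cmod (r%:C%C : C) = r by rewrite cmodC ger0_norm // ltW.
have rx : r <= cmod x by apply: le_trans xr; rewrite lerDl !mulr_ge0 //; lra.
have := @zeros_growth f r 0 x r%:C%C sf1 r0 zr; rewrite cr => /(_ (lexx _) rx).
have fr : 1 <= cmod f.[r%:C%C] by apply: F1 => //; rewrite cr.
apply: le_trans; set u := (cmod x - r) / (2 * r).
have u1 : 4 * r + 1 <= u by rewrite /u ler_pdivlMr ?mulr_gt0 //; lra.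
have xE : cmod x = 2 * r * u + r by rewrite /u mulrC divfK ?subrK // gt_eqF ?mulr_gt0.
have [n nE] : exists n, (size f).-1 = n.+2 by exists (size f - 3)%N; lia.
have u10 : 1 <= u by lra.
rewrite nE !exprS; have h1 : 1 <= u ^+ n by rewrite exprn_ege1.
have h2 : u <= u * u ^+ n by rewrite ler_peMr //; lra.
apply: (@le_trans _ _ (u * u)); first by rewrite xE; nra.
apply: (@le_trans _ _ (1 * (u * (u * u ^+ n)))); first by rewrite mul1r ler_wpM2l //; lra.
have u0 : 0 <= u by lra.
exact: (ler_wpM2r (mulr_ge0 u0 (mulr_ge0 u0 (exprn_ge0 n u0))) fr).
Qed.

Lemma bernoulli_upper t n : 0 <= t -> n%:R * t <= 1 / 2 -> (1 + t) ^+ n <= 2.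
Proof.
move=> t0 nt; have h : (1 + t) ^+ n * (1 - n%:R * t) <= 1.
  elim: n {nt} => [|n IH]; first by rewrite mul0r subr0 mul1r.
  apply: le_trans IH; rewrite exprSr -mulrA ler_wpM2l ?exprn_ge0 ?addr_ge0 //.
  rewrite -subr_ge0 -natr1 (_ : _ - _ = (n%:R + 1) * t ^+ 2); last by ring.
  by rewrite mulr_ge0 ?sqr_ge0 // addr_ge0.
have h1 : 1 / 2 <= 1 - n%:R * t by lra.
have p0 : 0 <= (1 + t) ^+ n by rewrite exprn_ge0 // addr_ge0.
nra.
Qed.

(** The number [n * d + 1] of averaging points is chosen for this: [2 ^ (n * d)] dominates [d ^ n],
    so the averaging error stays below a power depending on [m] only. *)
Lemma tail_bound (d n m : nat) : (1 + 2 ^- (n * d).+1) ^+ (m * d ^ n) <= 2 ^+ m :> R.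
Proof.
rewrite [(m * _)%N]mulnC exprM; apply: lerXn2r; rewrite ?nnegrE ?exprn_ge0 ?addr_ge0 ?invr_ge0 ?exprn_ge0 //.
apply: bernoulli_upper; first by rewrite invr_ge0 exprn_ge0.
have hh : (d ^ n)%:R * 2 <= 2 ^+ (n * d).+1 :> R.
  rewrite -natrX -natrM ler_nat expnS mulnC leq_pmul2l // mulnC expnM.
  by case: n => // n'; rewrite leq_exp2r // ltnW // ltn_expl.
rewrite ler_pdivrMr ?exprn_gt0 //; move: hh; set X := 2 ^+ _; lra.
Qed.

(** Collected, the powers of [r] on both sides agree, so an [m]-th root can be taken and the degree
    [m] of the outer map disappears. *)
Lemma root_compare r B X (n m : nat) : 0 < r -> 0 <= X -> 0 <= B -> (0 < m)%N ->
  r * X ^+ m * r ^+ n <= (r * B ^+ m) ^+ n.+1 * 2 ^+ m -> X <= 2 * B ^+ n.+1.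
Proof.
move=> r0 X0 B0 m0 H; rewrite -(@ler_pXn2r _ m) ?nnegrE ?mulr_ge0 ?exprn_ge0 //.
have rn : 0 < r ^+ n.+1 by rewrite exprn_gt0.
rewrite -(ler_pM2l rn).
have -> : r ^+ n.+1 * X ^+ m = r * X ^+ m * r ^+ n by rewrite exprS -mulrA [r ^+ n * _]mulrC mulrA.
apply: le_trans H _.
by rewrite exprMn [(2 * _) ^+ m]exprMn -!exprM [(m * n.+1)%N]mulnC -mulrA [2 ^+ m * _]mulrC.
Qed.

(** [B ^ (d * k)] is common to both sides; what remains is [2 ^ k] against a quantity independent of
    [k], and this fixes [k]. *)
Lemma geometric_exceeds r B (c : R) (d n k : nat) : 0 <= r -> 1 <= B -> 1 <= c ->
  k = Num.bound (5 * r * B ^+ (n * d).+1) ->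
  5 * r * B ^+ ((k + n) * d).+1 < c * (2 * B ^+ d) ^+ k.
Proof.
move=> r0 B1 c1 kE; have B0 : 0 <= B by apply: le_trans B1.
have -> : ((k + n) * d).+1 = (d * k + (n * d).+1)%N by lia.
rewrite exprD exprMn -exprM.
have b0 : 0 < B ^+ (d * k) by rewrite exprn_gt0 // (lt_le_trans ltr01).
set A := B ^+ (d * k) in b0 *; set A' := B ^+ (n * d).+1 in kE *.
rewrite [A * A']mulrC mulrA [c * _]mulrA ltr_pM2r //.
have q0 : 0 <= 5 * r * A' by rewrite !mulr_ge0 ?exprn_ge0.
apply: lt_le_trans (archi_boundP q0) _; rewrite -kE.
have k3 : k%:R <= 2 ^+ k :> R by rewrite -natrX ler_nat ltnW // ltn_expl.
by apply: le_trans k3 _; rewrite ler_peMl ?exprn_ge0.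
Qed.

End Growth.

(** * Pulled-back boundaries approach every boundary point of [filled g 'X] *)

Section Blowup.
Variable R : realType.
Local Notation C := R[i].
Implicit Types (x y z u v w p q a b l : C) (f g : {poly C}) (e d r t : R) (n m : nat).
Variables (G : {poly C} -> Prop) (r0 : R).
Hypothesis esc : escaping G r0.
Local Notation J := (fun x => Julia G (Some x)).
Local Notation filled := (filled r0).

Lemma size_itp g n : (size (itp g n)).-1 = ((size g).-1 ^ n)%N.
Proof. by elim: n => [|n IH]; rewrite ?size_polyX // itpS size_comp_poly IH expnS. Qed.

Lemma G_zeros g z : with_id G g -> g.[z] = 0 -> cmod z <= r0.
Proof.
move=> Wg gz; rewrite leNgt; apply/negP => lt; have := withG_double esc Wg (ltW lt).
by rewrite gz cmod0; have := esc_r0 esc; lra.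
Qed.

(** The power [n] is fixed before [h] is known. If the pulled-back boundary missed the disc at [j],
    the whole disc would escape, and some [F], an iterate of [h] after the [n]-th iterate of [g],
    would have no zero on the half disc. [circle_average] compares [F] at [j], bounded through [b1],
    [b2] and [lead_bound], with [F] at an escaping point [p]; this caps the [n]-th iterate of [g] at
    [p] by a quantity that [n] was chosen to exceed. *)
Lemma boundary_meets g j e b1 b2 : G g -> cboundary (filled g 'X) j -> 0 < e ->
  Khat G b1 -> Khat G b2 -> b1 != b2 ->
  exists n, forall h, G h -> exists2 b, cboundary (filled h (itp g n)) b & cmod (b - j) < e.
Proof.
move=> Gg bj e0 K1 K2 b12; have [R1 R0] : 1 <= r0 /\ 0 < r0 by have := esc_r0 esc; split; lra.
have e4 : 0 < e / 4 by rewrite divr_gt0.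
have [_ [p np jp]] := bj _ e4; rewrite cmodBC in jp.
have [n0 hn0] := not_filled esc Gg np.
set d := (size g).-1.
have sg : (2 < size g)%N by case: esc => _ _ [h _] _ _; apply: h.
have D0 : 0 < cmod (b2 - b1) by rewrite cmod_gt0 subr_eq0 eq_sym.
set D := cmod (b2 - b1) in D0.
(* [8] from [lead_bound] times [2 * r0] from [zeros_upper], over the distance of two points of
   [Khat G]; this is the base in [Fj]. *)
pose B := 16 * r0 / D.
have B8 : 1 <= B.
  rewrite /B ler_pdivlMr // mul1r; have := cmodB b2 b1; have := Khat_lt esc K1; have := Khat_lt esc K2.
  by rewrite -/D; lra.
(* Per step the orbit of [p] gains twice the factor [B ^+ d] by which the upper bound [TB] grows. *)
have [rho rho0 hrho] := superlinear (2 * B ^+ d) sg.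
pose rho1 := Num.max rho (r0 + 1).
pose n1 := (Num.bound rho1 + n0)%N.
have rho10 : 1 <= rho1 by rewrite le_max; apply/orP; right; lra.
have grow k : rho1 * (2 * B ^+ d) ^+ k <= cmod (itp g (k + n1)).[p].
  have c1 : 1 <= 2 * B ^+ d by have := exprn_ege1 d B8; lra.
  elim: k => [|k IH].
    rewrite expr0 mulr1 add0n /n1 itp_add horner_comp.
    have h := hn0 n0 (leqnn _); rewrite horner_comp hornerX in h.
    apply: le_trans (itp_grow esc _ Gg (ltW h)).
    by apply: ltW; apply: archi_boundP; lra.
  rewrite addSn horner_itpS exprS mulrCA.
  apply: le_trans (hrho _ _).
    by rewrite ler_wpM2l //; lra.
  apply: le_trans IH; apply: (@le_trans _ _ rho1); first by rewrite le_max lexx.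
  by rewrite ler_peMr ?exprn_ege1 //; lra.
pose k := Num.bound (5 * r0 * B ^+ (n1 * d).+1).
pose n := (k + n1)%N; exists n => h Gh; apply: contrapT => nb.
pose T := cmod (itp g n).[p].
have Tr : r0 < T.
  apply: lt_le_trans (grow k); apply: (@lt_le_trans _ _ rho1).
    by rewrite lt_max; apply/orP; right; lra.
  rewrite ler_peMr ?exprn_ege1 //; try lra.
  by have := exprn_ege1 d B8; lra.
have npn : ~ filled h (itp g n) p by move=> /(_ 0%N); rewrite comp_polyX leNgt -/T Tr.
(* Between a filled point of the disc and the escaping [p] the segment, which stays in the disc,
   would contain a boundary point. *)
have dis u : cmod (u - j) < e -> ~ filled h (itp g n) u.
  move=> uj Ku; apply: nb; have [t t01 bt] := segment_boundary Ku npn.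
  by exists (seg u p t) => //; apply: seg_ball => //; lra.
have [m hm] : exists m, forall q, cmod (q - j) <= e / 2 -> r0 < cmod (itp h m \Po itp g n).[q].
  apply: contrapT => ne.
  have /choice[q hq] : forall m, exists q, cmod (q - j) <= e / 2 /\ cmod (itp h m \Po itp g n).[q] <= r0.
    move=> m; apply: contrapT => h1; apply: ne; exists m => q qj; rewrite ltNge; apply/negP => le.
    by apply: h1; exists q.
  have [phi ip [l lj hl]] := ccompact_seq (ball_compact j (e / 2)) (fun m => (hq m).1).
  apply: (dis l); first by apply: le_lt_trans lj _; lra.
  move=> i; apply: poly_preim_closed => dd /hl[N hN].
  exists (q (phi (maxn N i))); last by apply: hN; apply: leq_maxl.
  have [_ le] := hq (phi (maxn N i)); rewrite leNgt; apply/negP => lt.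
  rewrite horner_comp in lt; have := itp_stay esc Gh lt (leq_trans (leq_maxr N i) (incr_ge _ ip)).
  by rewrite -horner_comp ltNge le.
pose f := itp h m.+1; have Gf : G f by apply: (G_itpS esc).
have sf := esc_size esc Gf.
pose F := f \Po itp g n.
have WF : with_id G F by left; apply: (withG_comp' esc Gf); apply: (withG_itp esc).
have hF q : cmod (q - j) <= e / 2 -> r0 < cmod F.[q].
  move=> /hm lt; rewrite /F /f itpS -comp_polyA horner_comp; exact: (esc_stay esc).
set M := (size f).-1.
have M0 : (0 < M)%N by rewrite /M; case: size sf => [|[]].
have sF : (size F).-1 = (M * d ^ n)%N by rewrite /F size_comp_poly; congr (_ * _)%N; exact: size_itp.
pose N := (n * d).+1.
have := @circle_average R F j p r0 N (withG_size esc WF) (ltn0Sn _) R0.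
have -> : (forall z, F.[z] = 0 -> 2 * cmod (p - j) <= cmod (z - j)) <-> True.
  split=> // _ z Fz; rewrite leNgt; apply/negP => lt.
  by have := hF z; rewrite Fz cmod0; have := esc_r0 esc; lra.
have -> : (forall q, cmod (q - j) = cmod (p - j) -> r0 <= cmod F.[q]) <-> True.
  by split=> // _ q E; apply/ltW/hF; rewrite E; lra.
move=> /(_ I I).
have vj : cmod (itp g n).[j] <= r0.
  by have := filled_boundary_in bj n; rewrite comp_polyXr.
have Fj : cmod F.[j] <= r0 * B ^+ M.
  rewrite /F horner_comp; apply: le_trans (zeros_upper sf R0 _ vj) _.
    by move=> z; apply: G_zeros; left.
  have := @lead_bound R f r0 b1 b2 sf (level_G esc Gf).
  have /(KhatP esc) h1 := K1; have /(KhatP esc) h2 := K2.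
  move=> /(_ (h1 f Gf) (h2 f Gf)); rewrite -/D -/M => lb.
  rewrite /B expr_div_n mulrA ler_pdivlMr ?exprn_gt0 // mulrAC.
  apply: le_trans (ler_wpM2r _ lb) _; first by rewrite exprn_ge0 // mulr_ge0 // ltW.
  rewrite (_ : 16 * r0 = 8 * (2 * r0)); last by ring.
  by rewrite [in leRHS]exprMn mulrA [r0 * _]mulrC.
have Fp : r0 * ((T - r0) / (2 * r0)) ^+ M <= cmod F.[p].
  rewrite /F horner_comp.
  have cr : cmod (r0%:C%C : C) = r0 by rewrite cmodC ger0_norm // ltW.
  have := @zeros_growth R f r0 0 (itp g n).[p] r0%:C%C sf R0 (fun z => @G_zeros f z (or_introl Gf)).
  rewrite cr => /(_ (lexx _) (ltW Tr)); apply: le_trans.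
  rewrite ler_wpM2r ?exprn_ge0 ?divr_ge0 ?mulr_ge0 ?subr_ge0 ?(ltW Tr) ?(ltW R0) //.
  by have := @withG_double R G r0 esc f r0%:C%C (or_introl Gf); rewrite cr => ->.
have tail := tail_bound R d n M; rewrite -sF -/N in tail.
have X0 : 0 <= (T - r0) / (2 * r0) by rewrite divr_ge0 ?mulr_ge0 ?subr_ge0 ?(ltW Tr) ?(ltW R0).
have B0 : 0 <= B by apply: le_trans B8.
move=> H; have XB : (T - r0) / (2 * r0) <= 2 * B ^+ N.
  apply: (root_compare R0 X0 B0 M0); apply: le_trans (ler_wpM2r (exprn_ge0 _ (ltW R0)) Fp) _.
  apply: le_trans H _; apply: ler_pM => //.
  - by rewrite exprn_ge0 ?cmod_ge0.
  - by rewrite exprn_ge0 // addr_ge0 // invr_ge0 exprn_ge0.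
  by apply: lerXn2r => //; rewrite ?nnegrE ?cmod_ge0 // mulr_ge0 ?exprn_ge0 ?(ltW R0).
have BN : 1 <= B ^+ N by rewrite exprn_ege1.
(* [T] is at most [r0 + 4 * r0 * B ^+ N], and [B ^+ N] is at least one. *)
have TB : T <= 5 * r0 * B ^+ N.
  have : T - r0 <= 2 * B ^+ N * (2 * r0) by rewrite -ler_pdivrMr ?mulr_gt0.
  clear -BN R0; set A := B ^+ N in BN *; nra.
have := geometric_exceeds (d := d) (n := n1) (ltW R0) B8 rho10 (erefl k); rewrite -/n -/N.
by rewrite ltNge (le_trans (grow k) TB).
Qed.

Lemma boundary_preimage g f z : with_id G f -> cboundary (filled g 'X) f.[z] -> cboundary (filled g f) z.
Proof.
move=> Wf bz; have Kz := filled_boundary_in bz.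
have fE x : filled g f x <-> filled g 'X f.[x] by rewrite filled_comp comp_polyX.
apply: boundaryP; first exact/fE.
move=> [d d0 hd]; apply: (boundary_interior bz).
have [e e0 op] := open_map (withG_size esc Wf) d0.
by exists e => // y; rewrite cmodBC => /op[q <- qz]; apply/fE/hd.
Qed.

Lemma boundary_image g f z : cboundary (filled g f) z -> cboundary (filled g 'X) f.[z].
Proof.
move=> bz; have Kz := filled_boundary_in bz.
have fE x : filled g f x <-> filled g 'X f.[x] by rewrite filled_comp comp_polyX.
apply: boundaryP; first exact/fE.
move=> [d d0 hd]; apply: (boundary_interior bz).
have [e e0 ct] := poly_cont f z d0.
by exists e => // y /ct/hd/fE.
Qed.

(** As [x] and [g.[x]] are joined by fine chains, so are [g.[u]] and [g.[x]]. Lifting from [u] ends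
    at some [x'] over [g.[x]], perhaps not [x]; the two are linked along the boundary of
    [filled h g], where [h] is such that the boundary of [filled h 'X] passes near [g.[x]]. *)
Lemma chain_pullback g x e : G g -> Khat G x -> J g.[x] -> 0 < e ->
  exists2 d, 0 < d & forall u, chain J d x g.[u] -> chain J e x u.
Proof.
move=> Gg Kx Jy e0; have Wg : with_id G g by left.
have [d d0 op] := open_map (esc_size esc Gg) e0.
exists d => // u cu; have Ky := Khat_forward esc Gg Kx.
have Jx := julia_backward esc Gg Jy.
have cy : chain J d g.[u] g.[x].
  exact: chain_trans (chain_sym cu) (julia_Khat_chain esc d0 Jx Kx Jy Ky).
have [x' x'y cx'] : exists2 x', g.[x'] = g.[x] & chain J e u x'.
  elim: cy => [Jgu|v w _ [x' x'v cx'] Jw vw].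
    by exists u => //; apply/chain_refl/(julia_backward esc Gg).
  have [|q qw qx'] := op x' w; first by rewrite x'v cmodBC.
  exists q => //; apply: chain_step cx' _ qx'.
  by apply: (julia_backward esc Gg); rewrite qw.
apply: chain_trans (_ : chain J e x x') (chain_sym cx').
have [h [j [Gh bj jy]]] := near_filled_boundary esc d0 Jy Ky.
have [|q qj qx] := op x j; first by rewrite cmodBC.
have [|q' q'j qx'] := op x' j; first by rewrite x'y cmodBC.
have bq : cboundary (filled h g) q by apply: boundary_preimage; rewrite ?qj.
have bq' : cboundary (filled h g) q' by apply: boundary_preimage; rewrite ?q'j.
have Jq a : cboundary (filled h g) a -> J a by apply: filled_boundary_julia.
apply: chain_trans (chain1 Jx (Jq q bq) qx) _.
apply: chain_trans (chain_sub Jq (filled_boundary_chain esc Gh Wg e0 bq bq')) _.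
apply: chain1; [exact: Jq | | by rewrite cmodBC].
by have [] := chain_in cx'.
Qed.

Lemma chain_pullback_iter g x n : G g -> Khat G x -> J g.[x] ->
  forall e, 0 < e -> exists2 d, 0 < d & forall u, chain J d x (itp g n).[u] -> chain J e x u.
Proof.
move=> Gg Kx Jy; elim: n => [|n IH] e e0; first by exists e => // u; rewrite hornerX.
have [d d0 hd] := IH e e0; have [d' d'0 hd'] := chain_pullback Gg Kx Jy d0.
by exists d' => // u; rewrite horner_itpS => /hd'/hd.
Qed.

(** Suppose [g.[x]] is a Julia point. Close to any boundary point [j] of [filled g 'X] there is a
    [b] whose [n]-th image lies on the boundary of [filled h 'X], which also passes near [x].
    Pulling the resulting chain back [n] times joins [x] to [b] and then to [j], against [sep]. *)
Lemma image_Khat_fatou g x b1 b2 : G g -> Khat G b1 -> Khat G b2 -> b1 != b2 ->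
  (forall z, J z -> Khat G z -> exists2 e, 0 < e & forall j, cboundary (filled g 'X) j -> ~ chain J e z j) ->
  Khat G x -> ~ J g.[x].
Proof.
move=> Gg K1 K2 b12 sep Kx Jy; have Jx := julia_backward esc Gg Jy.
have WX : with_id G 'X by right.
have [e e0 he] := sep x Jx Kx.
have [cl [M hM]] := filled_compact esc g WX.
have [j Kj nj] := bounded_has_boundary (Khat_filled esc Gg WX Kx) hM cl.
have bj : cboundary (filled g 'X) j by apply: boundaryP.
have [n hn] := boundary_meets Gg bj e0 K1 K2 b12.
have [d d0 hd] := chain_pullback_iter n Gg Kx Jy e0.
have [h [a [Gh ba ax]]] := near_filled_boundary esc d0 Jx Kx.
have [b bb bj'] := hn h Gh.
have Ja z : cboundary (filled h 'X) z -> J z by apply: filled_boundary_julia.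
have cb : chain J e x b.
  apply: hd; apply: chain_trans (chain1 Jx (Ja a ba) ax) _.
  exact: chain_sub Ja (filled_boundary_chain esc Gh WX d0 ba (boundary_image bb)).
apply: (he j bj); apply: chain_step cb _ _; last by rewrite cmodBC.
by apply: (filled_boundary_julia esc Gg WX).
Qed.

(** * The case where [Khat G] is a single point *)

Section SinglePoint.
Variable p : C.
Hypothesis Kp : Khat G p.
Hypothesis Kuniq : forall z, Khat G z -> z = p.

Lemma single_fixed f : G f -> f.[p] = p.
Proof. by move=> Gf; apply/Kuniq/(Khat_forward esc). Qed.

(** All critical values equal [p], so every small level set of [f - p] is connected. It comes close
    to each point of the fibre and stays close to the fibre, so the fibre cannot have a second
    point. *)
Lemma single_fibre f z : G f -> f.[z] = p -> z = p.
Proof.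
move=> Gf fz; have fp := single_fixed Gf; have sf := esc_size esc Gf.
apply: contrapT => /eqP zp.
have [s [sz rt hs]] := subC_split p sf.
(* Other fibre points are at least [3 * k] from [p], so a step below [k] cannot pass from the
   [k]-disc at [p] to another one. *)
have [k k0 hk] : exists2 k, 0 < k & forall r : C, r \in z :: s -> r != p -> 3 * k <= cmod (r - p).
  elim: (z :: s) => [|a l [k k0 IH]]; first by exists 1.
  have [->|ap] := eqVneq a p.
    by exists k => // r; rewrite inE => /orP[/eqP->|/IH//]; rewrite eqxx.
  exists (Num.min k (cmod (a - p) / 3)); first by rewrite lt_min k0 divr_gt0 // cmod_gt0 subr_eq0.
  move=> r; rewrite inE => /orP[/eqP-> _|rl rp].
    have : Num.min k (cmod (a - p) / 3) <= cmod (a - p) / 3 by rewrite ge_min lexx orbT.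
    by lra.
  have : Num.min k (cmod (a - p) / 3) <= k by rewrite ge_min lexx.
  by have := IH r rl rp; lra.
pose e := cmod (lead_coef f) * k ^+ (size f).-1.
have e0 : 0 < e by rewrite mulr_gt0 ?lead_gt0 ?exprn_gt0.
have cL : lconn (fun x => cmod (f.[x] - p) = e / 2).
  apply: level_connected_at => //; first by rewrite divr_gt0.
  move=> x fx; have -> : f.[x] = p by apply/Kuniq/(crit_Khat esc) => //; left.
  by rewrite subrr cmod0 divr_gt0.
have on x : cmod (f.[x] - p) = e / 2 -> exists2 r, r \in s & cmod (x - r) < k.
  move=> E; apply: prod_lt_exists; first exact: ltW.
  have := hs x; rewrite E sz => h; rewrite -(ltr_pM2l (lead_gt0 sf)) -h -/e; lra.
have pt (r : C) : f.[r] = p -> exists2 x, cmod (f.[x] - p) = e / 2 & cmod (x - r) < k.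
  move=> fr; have [|x fx xr] := @root_close R f r (p + (e / 2)%:C%C) k sf (ltW k0).
    by rewrite fr opprD addNKr cmodN cmodC ger0_norm -/e; lra.
  by exists x => //; rewrite fx addrC addKr cmodC ger0_norm //; lra.
have [x1 E1 d1] := pt p fp; have [x2 E2 d2] := pt z fz.
have : cmod (x2 - p) < k.
  apply: (cL (fun x => cmod (x - p) < k) _ x1 x2) => // x Ex; exists k => // y Ey yx.
  have main u v : cmod (f.[v] - p) = e / 2 -> cmod (v - u) < k -> cmod (u - p) < k -> cmod (v - p) < k.
    move=> Ev vu up; have [r rs vr] := on v Ev.
    have [rp|rp] := eqVneq r p; first by rewrite -rp.
    have := hk r; rewrite inE rs orbT => /(_ isT rp).
    by have := cmod_tri v r p; have := cmod_tri u v p; rewrite (cmodBC r v); lra.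
  by split; apply: main => //; rewrite cmodBC.
move=> d3; have := hk z; rewrite mem_head => /(_ isT zp).
by have := cmod_tri x2 z p; rewrite (cmodBC z x2); lra.
Qed.

Lemma single_form f : G f ->
  (forall x, cmod (f.[x] - p) = cmod (lead_coef f) * cmod (x - p) ^+ (size f).-1) /\
  locdeg f (Some p) = (size f).-1.
Proof.
move=> Gf; have sf := esc_size esc Gf; have fp := single_fixed Gf; split.
  have [s [sz rt hs]] := subC_split p sf => x; rewrite hs -sz; congr (_ * _).
  rewrite big_seq (eq_bigr (fun=> cmod (x - p))); last by move=> z /rt/(single_fibre Gf) ->.
  by rewrite -big_seq big_const_seq count_predT -Monoid.iteropE.
have f0 : f - p%:P != 0 by rewrite -size_poly_eq0 size_subC //; case: size sf.
have [s [sE sz]] := poly_split f0.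
have sp : all (pred1 p) s.
  apply/allP => z /(root_split sE)/eqP; rewrite !hornerE subr_eq0 => /eqP/(single_fibre Gf) ->.
  by rewrite /= eqxx.
rewrite /= fp sE -mul_polyC mupMr ?rootC ?lead_coef_eq0 // mu_prod_XsubC.
by rewrite -(size_subC p sf) -sz; apply/eqP; rewrite -all_count.
Qed.

End SinglePoint.
End Blowup.

(** * Fibres and small components of preimages *)

Section Multiplicity.
Variable F : fieldType.
Implicit Types (x y u : F) (f g p q : {poly F}).

Lemma mup_exp x p n : p != 0 -> mup x (p ^+ n) = (n * mup x p)%N.
Proof.
move=> p0; elim: n => [|n IH]; first by rewrite expr0 mul0n mupNroot // root1.
by rewrite exprS mupM ?expf_neq0 // IH mulSn.
Qed.

Lemma subC_neq0 f u : (1 < size f)%N -> f - u%:P != 0.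
Proof.
move=> sf; rewrite -size_poly_eq0 size_polyDl; first by case: size sf.
by rewrite size_polyN; apply: leq_ltn_trans (size_polyC_leq1 u) sf.
Qed.

Lemma mup_comp f g x u : (1 < size f)%N -> (1 < size g)%N ->
  mup x ((f \Po g) - u%:P) = (mup g.[x] (f - u%:P) * mup x (g - g.[x]%:P))%N.
Proof.
move=> sf sg; have f0 := subC_neq0 u sf.
have [m [q]] := multiplicity_XsubC (f - u%:P) g.[x]; rewrite f0 /= => qr fE.
have q0 : q != 0 by apply: contraNneq qr => ->; rewrite root0.
have -> : f \Po g - u%:P = (q \Po g) * (g - g.[x]%:P) ^+ m.
  rewrite -(comp_polyC u g) -comp_polyB fE comp_polyM; congr (_ * _).
  by rewrite rmorphXn /= comp_polyB comp_polyX comp_polyC.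
have r1 : ~~ root (q \Po g) x by rewrite rootE horner_comp -rootE.
rewrite (mupMr _ r1) mup_exp ?subC_neq0 // fE mupMr // mup_XsubCX eqxx //.
Qed.

Lemma mup_simple f x : f^`().[x] != 0 -> mup x (f - f.[x]%:P) = 1%N.
Proof.
move=> d0; have /factor_theorem[q qE] : root (f - f.[x]%:P) x by rewrite rootE !hornerE subrr.
have qx : q.[x] = f^`().[x].
  have := congr1 (fun h : {poly F} => h^`().[x]) qE; rewrite /= !derivE !hornerE subr0 subrr mulr0 add0r.
  by move=> ->.
have qr : ~~ root q x by rewrite rootE qx.
by rewrite qE mupMr // -[X in mup x X]expr1 mup_XsubCX eqxx.
Qed.

Lemma sum_partition (s : seq F) (g : F -> F) (w : F -> nat) :
  (\sum_(x <- s) w x = \sum_(y <- undup (map g s)) \sum_(x <- s | g x == y) w x)%N.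
Proof.
rewrite (exchange_big_dep xpredT) //=; rewrite big_seq [RHS]big_seq; apply: eq_bigr => x xs.
rewrite (eq_bigl (pred1 (g x))); last by move=> y /=; rewrite eq_sym.
by rewrite -big_filter filter_pred1_uniq ?undup_uniq ?mem_undup ?map_f // big_seq1.
Qed.

End Multiplicity.

Section FibreDegree.
Variable R : realType.
Local Notation C := R[i].
Implicit Types (x y z u v w q a b l c : C) (f g h : {poly C}) (e d r t M : R) (n N : nat).

(** [deg_le] over one finite value with [V] in the plane, so that infinity is out of the way. *)
Definition fibre_le f (V : C -> Prop) u N := forall s : seq C, uniq s ->
  (forall v, v \in s -> V v /\ f.[v] = u) -> (\sum_(v <- s) mup v (f - u%:P) <= N)%N.

Lemma count_sum (s l : seq C) : uniq s -> (\sum_(x <- s) count_mem x l <= size l)%N.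
Proof.
elim: l => [|a l IH] us; first by rewrite big1.
rewrite /= (eq_bigr (fun x => (a == x) + count_mem x l)%N) // big_split /= -add1n leq_add ?IH //.
rewrite -big_mkcond /= sum1_count; have := count_uniq_mem a us.
rewrite (eq_count (a2 := pred1 a)) => [->|x /=]; [by case: (_ \in _)|by rewrite eq_sym].
Qed.

Lemma fibre_le_size f V u : (1 < size f)%N -> fibre_le f V u (size f).-1.
Proof.
move=> sf s us _; have f0 := subC_neq0 u sf; have [l [lE sl]] := poly_split f0.
rewrite -(size_subC u sf) -sl; apply: leq_trans (count_sum l us).
apply: leq_sum => x _; rewrite {1}lE -mul_polyC mupMr ?rootC ?lead_coef_eq0 // mu_prod_XsubC //.
Qed.

Lemma fibre_le_comp f g V u N D : (1 < size f)%N -> (1 < size g)%N -> fibre_le f V u N ->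
  ((size g).-1 <= D)%N -> fibre_le (f \Po g) (fun x => V g.[x]) u (N * D).
Proof.
move=> sf sg fN gD s us hs.
rewrite (eq_bigr (fun x => mup g.[x] (f - u%:P) * mup x (g - g.[x]%:P))%N); last first.
  by move=> x _; rewrite mup_comp.
rewrite (sum_partition s (horner g)).
apply: (@leq_trans (\sum_(y <- undup (map (horner g) s)) mup y (f - u%:P) * D)%N).
  apply: leq_sum => y _; rewrite (eq_bigr (fun x => mup y (f - u%:P) * mup x (g - y%:P))%N); last first.
    by move=> x /eqP ->.
  rewrite -big_distrr leq_mul2l; apply/orP; right; apply: leq_trans gD.
  rewrite -big_filter; apply: (fibre_le_size (V := xpredT)) => //; first exact: filter_uniq.
  by move=> x; rewrite mem_filter => /andP[/eqP].
rewrite -big_distrl leq_mul2r; apply/orP; right; apply: fN; first exact: undup_uniq.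
by move=> y; rewrite mem_undup => /mapP[x /hs[Vx E] ->]; rewrite horner_comp in E.
Qed.

Lemma fibre_le_inj f g (V W : C -> Prop) u N : (1 < size f)%N -> (1 < size g)%N -> fibre_le f V u N ->
  (forall x, W x -> V g.[x] /\ g^`().[x] != 0) ->
  (forall x y, W x -> W y -> g.[x] = g.[y] -> x = y) -> fibre_le (f \Po g) W u N.
Proof.
move=> sf sg fN WV inj s us hs.
rewrite big_seq (eq_bigr (fun x => mup g.[x] (f - u%:P))); last first.
  by move=> x /hs[/WV[_ d0] _]; rewrite mup_comp // mup_simple // muln1.
rewrite -big_seq -(big_map (horner g) xpredT (fun y => mup y (f - u%:P))).
apply: fN.
  rewrite map_inj_in_uniq // => x y /hs[Wx _] /hs[Wy _]; exact: inj.
by move=> y /mapP[x /hs[Wx E] ->]; rewrite horner_comp in E; split => //; have [] := WV x Wx.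
Qed.

Lemma deg_le_fibre f (V U : sphere R -> Prop) N : ~ V None ->
  (forall u, U (Some u) -> fibre_le f (fun v => V (Some v)) u N) -> deg_le f V U N.
Proof.
move=> nV fN w Uw s us hs.
have [t sE] : exists t : seq C, s = map Some t.
  elim: s {us} hs => [|[a|] s IH] hs; first by exists [::].
    have [|t ->] := IH; last by exists (a :: t).
    by move=> v vs; apply: hs; rewrite inE vs orbT.
  by have [/nV] := hs None (mem_head _ _).
move: us hs; rewrite sE => us hs; rewrite big_map.
case: t {sE} us hs => [|a t] us hs; first by rewrite big_nil.
have [_ wE] := hs (Some a) (mem_head _ _).
move: Uw; rewrite -wE /= => Uw.
rewrite big_seq (eq_bigr (fun v => mup v (f - f.[a]%:P))).
  rewrite -big_seq; apply: (fN _ Uw).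
    by move: us; rewrite map_inj_uniq //; apply: Some_inj.
  move=> v vt; have [] : V (Some v) /\ peval f (Some v) = w by apply: hs; rewrite map_f.
  by rewrite -wE /= => ? [->].
move=> v vt; have [_] : V (Some v) /\ peval f (Some v) = w by apply: hs; rewrite map_f.
by rewrite -wE /= => -[->].
Qed.

Lemma fibre_deg_le f (V U : sphere R -> Prop) N u : deg_le f V U N -> U (Some u) ->
  fibre_le f (fun v => V (Some v)) u N.
Proof.
move=> dN Uu s us hs; have := dN (Some u) Uu (map Some s).
rewrite map_inj_uniq => [/(_ us) H|]; last exact: Some_inj.
have {}H := H _; rewrite big_map in H.
rewrite big_seq (eq_bigr (fun v => locdeg f (Some v))); last by move=> v /hs[_ E]; rewrite /= E.
by rewrite -big_seq; apply: H => _ /mapP[v /hs[Vv E] ->]; rewrite /= E.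
Qed.

Lemma fibre_le_sub f (V W : C -> Prop) u N : (forall x, W x -> V x) -> fibre_le f V u N -> fibre_le f W u N.
Proof. by move=> WV fN s us hs; apply: fN => // v /hs[/WV]. Qed.

Lemma fibre_le_mono f V u N N' : (N <= N')%N -> fibre_le f V u N -> fibre_le f V u N'.
Proof. by move=> NN fN s us hs; apply: leq_trans (fN s us hs) NN. Qed.

Definition ccomp (A : C -> Prop) x y :=
  exists B : C -> Prop, [/\ lconn B, (forall v, B v -> A v), B x & B y].

Lemma ccomp_sub A x y : ccomp A x y -> A y.
Proof. by move=> [B [_ BA _ /BA]]. Qed.

Lemma ccomp_ball A x y e : ccomp A x y -> 0 < e -> (forall v, cmod (v - y) < e -> A v) ->
  forall v, cmod (v - y) < e -> ccomp A x v.
Proof.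
move=> [B [cB BA Bx By]] e0 bA v vy; exists (fun w => B w \/ cmod (w - y) < e); split.
- by apply: (lconn_union cB (@ball_lconn R y e) By); rewrite subrr cmod0.
- by move=> w [/BA|/bA].
- by left.
- by right.
Qed.

Lemma ccomp_refl A x : A x -> ccomp A x x.
Proof.
by move=> Ax; exists (fun y => y = x); split => // [P _ y z -> ->|y ->].
Qed.

(** The values attained on the component form a set open and closed in the disc: uniform openness of
    [h] continues any preimage by a fixed step, inside the component. *)
Lemma ccomp_onto h z r x u : (1 < size h)%N -> cmod (h.[x] - z) < r -> cmod (u - z) < r ->
  exists2 v, ccomp (fun y => cmod (h.[y] - z) < r) x v & h.[v] = u.
Proof.
move=> sh xr ur; pose A y := cmod (h.[y] - z) < r.
suff : exists2 v, ccomp A x v & h.[v] = u by [].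
suff lc : locconst (fun u => cmod (u - z) < r) (fun u => exists2 v, ccomp A x v & h.[v] = u).
  apply: (@ball_lconn R z r _ lc h.[x] u) => //.
  by exists x => //; apply: ccomp_refl.
move=> {ur}u ur; have [_ [M hM]] := preim_disc_compact z r sh.
pose k := (r - cmod (u - z)) / 3.
have k0 : 0 < k by rewrite divr_gt0 // subr_gt0.
have [d d0 hd] := poly_unif h M k0; have [n n0 op] := open_map sh d0.
have main a b : cmod (a - u) < k -> cmod (b - a) < n ->
    (exists2 v, ccomp A x v & h.[v] = a) -> exists2 v, ccomp A x v & h.[v] = b.
  move=> au ba [v cv E]; have [|q qb qv] := op v b; first by rewrite E cmodBC.
  exists q => //; apply: (ccomp_ball cv d0) qv => y yv.
  have vM : cmod v <= M by apply/hM/ltW/(ccomp_sub cv).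
  have := hd v y vM yv; rewrite E /A.
  by have := cmod_tri a h.[y] z; have := cmod_tri u a z; rewrite /k in au * => *; lra.
exists (Num.min k n); first by rewrite lt_min k0.
move=> u' _; rewrite lt_min => /andP[u1 u2].
split; apply: main => //; rewrite 1?subrr ?cmod0 // cmodBC //.
Qed.

(** Split off from [h - z] its roots [s] in the component. The cofactor [phi] has no zero on the
    closure, so the minimum principle bounds it below by its values at boundary points, where
    [h - z] has modulus at least [r]. *)
Lemma ccomp_estimate h z r x N M : (1 < size h)%N -> 0 < r -> cmod (h.[x] - z) < r ->
  (forall y, cmod (h.[y] - z) < r -> cmod y <= M) ->
  fibre_le h (ccomp (fun y => cmod (h.[y] - z) < r) x) z N ->
  exists2 s : seq C, (size s <= N)%N & forall v, ccomp (fun y => cmod (h.[y] - z) < r) x v ->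
    r * \prod_(a <- s) cmod (v - a) <= cmod (h.[v] - z) * (2 * M) ^+ size s.
Proof.
move=> sh r0 xr hM fN; set A := fun y => cmod (h.[y] - z) < r in hM fN *.
have h0 := subC_neq0 z sh; have [l [lE sl]] := poly_split h0.
pose V v := `[< ccomp A x v >].
pose s := filter V l; pose l' := filter (predC V) l.
pose k := lead_coef (h - z%:P); have k0 : k != 0 by rewrite lead_coef_eq0.
pose phi := k *: \prod_(b <- l') ('X - b%:P).
have hE v : cmod (h.[v] - z) = \prod_(a <- s) cmod (v - a) * cmod phi.[v].
  have -> : h.[v] - z = (h - z%:P).[v] by rewrite !hornerE.
  rewrite (horner_split v lE) /phi hornerZ cmodM horner_prod cmod_prod mulrCA; congr (_ * _).
  rewrite (eq_bigr (fun b => cmod (v - b)) (r := l')); last by move=> b _; rewrite hornerXsubC.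
  by rewrite -big_cat; apply: perm_big; rewrite perm_sym (perm_filterC V l).
have opV v : ccomp A x v -> interior_pt (ccomp A x) v.
  move=> cv; have Av := ccomp_sub cv; have k1 : 0 < r - cmod (h.[v] - z) by rewrite subr_gt0.
  have [d d0 hd] := poly_cont h v k1; exists d => // y yv; apply: (ccomp_ball cv d0) yv => w /hd.
  by rewrite /A; have := cmod_tri h.[v] h.[w] z; lra.
(* The closure of the component, where the minimum principle is applied. *)
pose K y := forall e, 0 < e -> exists2 v, ccomp A x v & cmod (v - y) < e.
have VK v : ccomp A x v -> K v by move=> cv e e0; exists v => //; rewrite subrr cmod0.
have KV y : K y -> cmod (h.[y] - z) < r -> ccomp A x y.
  move=> Ky yr; have k1 : 0 < r - cmod (h.[y] - z) by rewrite subr_gt0.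
  have [d d0 hd] := poly_cont h y k1.
  have [v cv vy] := Ky _ (divr_gt0 d0 (ltr0n R 2)).
  apply: (ccomp_ball cv (divr_gt0 d0 (ltr0n R 2))); last by rewrite cmodBC.
  move=> w wv; have /hd : cmod (w - y) < d by have := cmod_tri v w y; lra.
  by rewrite /A; have := cmod_tri h.[y] h.[w] z; lra.
have cK : ccompact K.
  split.
    move=> y hy e e0; have e20 : 0 < e / 2 by rewrite divr_gt0.
    have [u Ku uy] := hy _ e20; have [v cv vu] := Ku _ e20; exists v => //.
    by have := cmod_tri u v y; lra.
  exists (M + 1) => y /(_ 1 ltr01)[v cv vy].
  by have := hM v (ccomp_sub cv); have := cmod_le_sub y v; rewrite cmodBC; lra.
have KM y : K y -> cmod y <= M.
  move=> Ky; rewrite leNgt; apply/negP => lt.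
  have e0 : 0 < cmod y - M by rewrite subr_gt0.
  have [v cv vy] := Ky _ e0; have := hM v (ccomp_sub cv); have := cmod_le_sub y v.
  by rewrite cmodBC; lra.
have sV a : a \in s -> ccomp A x a by rewrite mem_filter => /andP[/asboolP].
have nz y : K y -> phi.[y] != 0.
  move=> Ky; have [yr|yr] := ltP (cmod (h.[y] - z)) r.
    have Vy := KV y Ky yr; rewrite /phi hornerZ mulf_neq0 // -rootE root_prod_XsubC.
    by rewrite mem_filter /= negb_and negbK; apply/orP; left; apply/asboolP.
  by apply: contraTneq yr => E; rewrite hE E cmod0 mulr0 -ltNge.
have M0 : 0 <= M by apply: le_trans (cmod_ge0 x) (hM x xr).
have pr y : cmod y <= M -> \prod_(a <- s) cmod (y - a) <= (2 * M) ^+ size s.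
  move=> yM; apply: prod_le_exp => a /sV/ccomp_sub/hM aM; rewrite cmod_ge0 /=.
  by have := cmodB y a; lra.
exists s.
  have us := undup_uniq s; have := fN (undup s) us; have -> // : (\sum_(v <- undup s) mup v (h - z%:P) = size s)%N.
    rewrite -(sum1_size s) -[RHS](big_undup_iterop_count addn) big_seq [RHS]big_seq; apply: eq_bigr => v.
    rewrite mem_undup => vs; rewrite {1}lE -mul_polyC mupMr ?rootC ?lead_coef_eq0 // mu_prod_XsubC.
    rewrite Monoid.iteropE /= iter_addn_0 mul1n /s count_filter; apply: eq_in_count => w wl /=.
    by case: eqP => //= ->; symmetry; apply/asboolP/sV.
  apply=> v; rewrite mem_undup => vs; split; first exact: sV.
  have : v \in l by move: vs; rewrite mem_filter => /andP[].
  by move=> /(root_split lE)/eqP; rewrite !hornerE subr_eq0 => /eqP.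
move=> v cv.
have [b Kb [nb le]] := @min_principle R K phi v cK (VK v cv) (fun y Ky _ => nz y Ky).
have br : r <= cmod (h.[b] - z).
  rewrite leNgt; apply/negP => lt; apply: nb; have [e e0 he] := opV b (KV b Kb lt).
  by exists e => // y /he/VK.
rewrite hE in br; rewrite hE mulrC -mulrA; apply: ler_wpM2l; first by rewrite prodr_ge0 // => *; apply: cmod_ge0.
apply: le_trans br _; rewrite mulrC; apply: ler_pM => //; first exact: cmod_ge0.
  by rewrite prodr_ge0 // => *; apply: cmod_ge0.
exact/pr/KM.
Qed.

(** Over so small a disc [ccomp_estimate] brings every point within [rho] of one of at most [N]
    roots, and a connected set covered by [N] balls has small diameter. The degree of [h] does not
    enter. *)
Lemma small_components h z r N M rho (S : C -> Prop) : (1 < size h)%N -> 0 < r -> 0 < rho -> rho <= 2 * M ->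
  (forall y, cmod (h.[y] - z) < r -> cmod y <= M) ->
  (forall x, cmod (h.[x] - z) < r -> fibre_le h (ccomp (fun y => cmod (h.[y] - z) < r) x) z N) ->
  lconn S -> (forall x, S x -> cmod (h.[x] - z) < r * (rho / (2 * M)) ^+ N) ->
  forall x y, S x -> S y -> cmod (y - x) < 2 * rho * N.+1%:R.
Proof.
move=> sh r0 p0 pM hM fN cS Sr x y Sx Sy.
have M0 : 0 < 2 * M by apply: lt_le_trans pM.
have q1 : rho / (2 * M) <= 1 by rewrite ler_pdivrMr // mul1r.
have q0 : 0 <= rho / (2 * M) by rewrite divr_ge0 ?ltW.
have Sr' v : S v -> cmod (h.[v] - z) < r.
  by move=> /Sr lt; apply: lt_le_trans lt _; rewrite ler_piMr ?exprn_ile1 // ltW.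
have [s sN hs] := ccomp_estimate sh r0 (Sr' x Sx) hM (fN x (Sr' x Sx)).
apply: (@lt_le_trans _ _ (2 * rho * (size s).+1%:R)); last first.
  by rewrite ler_pM2l ?mulr_gt0 // ler_nat.
apply: (@le_lt_trans _ _ (2 * rho * (size s)%:R)); last by rewrite ltr_pM2l ?mulr_gt0 // ltr_nat.
apply/ltW/(@lconn_covered_diam R S s rho cS p0) => // v Sv.
have cv : ccomp (fun y => cmod (h.[y] - z) < r) x v by exists S; split => // w /Sr'.
apply: prod_lt_exists; first exact: ltW.
rewrite -(ltr_pM2l r0); apply: le_lt_trans (hs v cv) _.
have M0n : 0 < (2 * M) ^+ size s by rewrite exprn_gt0.
apply: (@lt_le_trans _ _ (r * (rho / (2 * M)) ^+ N * (2 * M) ^+ size s)); first by rewrite ltr_pM2r ?Sr.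
rewrite -mulrA ler_wpM2l ?(ltW r0) //.
apply: (@le_trans _ _ ((rho / (2 * M)) ^+ size s * (2 * M) ^+ size s)); last by rewrite -exprMn divfK ?gt_eqF.
by rewrite ler_wpM2r ?(ltW M0n) // ler_wiXn2l.
Qed.

Lemma small_preimage g c (a rho : R) (D : nat) (S : C -> Prop) x y : (1 < size g)%N -> 0 < a -> a <= cmod (lead_coef g) ->
  ((size g).-1 <= D)%N -> 0 < rho -> rho <= 1 -> lconn S ->
  (forall x, S x -> cmod (g.[x] - c) < a * rho ^+ D) -> S x -> S y -> cmod (y - x) < 2 * rho * D.+1%:R.
Proof.
move=> sg a0 al sD p0 p1 cS Sr Sx Sy; have [s [sz _ hs]] := subC_split c sg.
apply: (@lt_le_trans _ _ (2 * rho * (size s).+1%:R)); last first.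
  by rewrite ler_pM2l ?mulr_gt0 // ler_nat sz ltnS.
apply: (@lt_trans _ _ (2 * rho * (size s)%:R)); last by rewrite ltr_pM2l ?mulr_gt0 // ltr_nat.
apply: (@lconn_covered_diam R S s rho cS p0) => // v Sv.
apply: prod_lt_exists; first exact: ltW.
have l0 := lead_gt0 sg; rewrite -(ltr_pM2l l0) -hs; apply: lt_le_trans (Sr v Sv) _.
apply: ler_pM => //; try by rewrite ?exprn_ge0 // ltW.
by rewrite sz ler_wiXn2l // ltW.
Qed.

Lemma ccomp_join A x y z : ccomp A x y -> ccomp A x z ->
  exists B : C -> Prop, [/\ lconn B, (forall v, B v -> A v), B y & B z].
Proof.
move=> [B [cB BA Bx By]] [B' [cB' BA' Bx' Bz]]; exists (fun v => B v \/ B' v); split; [|by move=> v []; auto|by left|by right].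
exact: lconn_union cB cB' Bx Bx'.
Qed.

Lemma local_degree (G : {poly C} -> Prop) z e N : 0 < e -> (forall g, G g -> (1 < size g)%N) ->
  (forall g x u, G g -> cmod (g.[x] - z) < e -> cmod (u - z) < e ->
    fibre_le g (ccomp (fun y : C => cmod (g.[y] - z) < e) x) u N) ->
  exists (U : sphere R -> Prop) (k : nat), [/\ sopen U, U (Some z) &
      forall g, G g -> forall V, is_component (fun v : sphere R => U (peval g v)) V -> deg_le g V U k].
Proof.
move=> e0 sG hN; pose U := emb (fun x : C => cmod (x - z) < e); exists U, N; split; first exact: emb_ball_open.
  by rewrite /= subrr cmod0.
move=> g Gg V [x Ax ->]; have nA : ~ U (peval g None) by rewrite /= leqNgt sG.
case: x Ax => [x|] // Ax; apply: deg_le_fibre; first by move=> /scomponent_sub.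
move=> u Uu; apply: fibre_le_sub (hN g x u Gg Ax Uu) => v Vv.
pose A (v : sphere R) := U (peval g v).
have [B [cB BA Bx Bv]] := scomponent_lconn (A := A) nA (scomponent_refl (A := A) Ax) Vv; by exists B.
Qed.

End FibreDegree.

(** * Generated semigroups and compact families *)

Section Generation.
Variable R : realType.
Local Notation C := R[i].
Implicit Types (f g h p q w : {poly C}) (H Gam S : {poly C} -> Prop).

Lemma gen_incl S f : S f -> gen S f.
Proof. by move=> Sf T h _; apply: h. Qed.

Lemma gen_closed S : closed_comp (gen S).
Proof. by move=> f g Gf Gg T ST cT; exact: cT (Gf _ ST cT) (Gg _ ST cT). Qed.

Lemma gen_ind S (P : {poly C} -> Prop) : (forall f, S f -> P f) ->
  (forall f g, P f -> P g -> P (f \Po g)) -> forall f, gen S f -> P f.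
Proof. by move=> h1 h2 f /(_ P h1); apply. Qed.

Section Words.
Variables H Gam : {poly C} -> Prop.
Hypothesis cH : closed_comp H.
Let G := gen (fun p => H p \/ Gam p).

(** Isolates the last applied letter from [Gam]; after it only [H] acts, so semi-hyperbolicity of
    [H] controls the preimages. *)
Lemma gen_left f : G f -> H f \/ exists h g w,
  [/\ with_id H h, Gam g, with_id G w & f = h \Po (g \Po w)].
Proof.
pose P f := G f /\ (H f \/ exists h g w,
  [/\ with_id H h, Gam g, with_id G w & f = h \Po (g \Po w)]).
move=> Gf; suff [] : P f by []; apply: (gen_ind _ _ Gf) => [p Sp|p q [Gp hp] [Gq hq]]; split; first exact: gen_incl.
- case: Sp; first by left.
  by move=> gp; right; exists 'X, p, 'X; rewrite comp_polyXr comp_polyX; split=> //; right.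
- exact: gen_closed.
case: hp => [Hp|[h [g [w [Hh gg Ww ->]]]]].
  case: hq => [Hq|[h [g [w [Hh gg Ww ->]]]]]; first by left; apply: cH.
  right; exists (p \Po h), g, w; rewrite comp_polyA; split=> //.
  by left; apply: with_id_comp.
right; exists h, g, (w \Po q); rewrite -!comp_polyA; split=> //.
by left; apply: with_id_comp' Ww Gq; exact: gen_closed.
Qed.

(** Isolates the first applied letter from [Gam]; before it only [H] acts, so normality of [H]
    controls the images. *)
Lemma gen_right f : G f -> H f \/ exists w g h,
  [/\ with_id G w, Gam g, with_id H h & f = w \Po (g \Po h)].
Proof.
pose P f := G f /\ (H f \/ exists w g h,
  [/\ with_id G w, Gam g, with_id H h & f = w \Po (g \Po h)]).
move=> Gf; suff [] : P f by []; apply: (gen_ind _ _ Gf) => [p Sp|p q [Gp hp] [Gq hq]]; split; first exact: gen_incl.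
- case: Sp; first by left.
  by move=> gp; right; exists 'X, p, 'X; rewrite comp_polyXr comp_polyX; split=> //; right.
- exact: gen_closed.
case: hq => [Hq|[w [g [h [Ww gg Hh ->]]]]].
  case: hp => [Hp|[w [g [h [Ww gg Hh ->]]]]]; first by left; apply: cH.
  right; exists w, g, (h \Po q); rewrite -!comp_polyA; split=> //.
  by left; apply: with_id_comp'.
right; exists (p \Po w), g, h; rewrite comp_polyA; split=> //.
by left; apply: with_id_comp Gp Ww; exact: gen_closed.
Qed.

End Words.
End Generation.

Section CompactFamilies.
Variable R : realType.
Local Notation C := R[i].
Implicit Types (x y z q a l c : C) (f g : {poly C}) (e d r M : R) (s : sphere R).
Variable Gam : {poly C} -> Prop.
Hypothesis cG : poly_compact Gam.

Lemma compact_equicont s : equicont Gam s.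
Proof.
move=> e e0; apply: contrapT => ne.
have /choice[fs hfs] : forall n : nat, exists fs : {poly C} * sphere R, [/\ Gam fs.1, chord s fs.2 < n.+1%:R^-1 &
    e <= chord (peval fs.1 s) (peval fs.1 fs.2)].
  move=> n; apply: contrapT => h; apply: ne; exists n.+1%:R^-1; first exact: inv_nat_gt0.
  move=> f s' Sf lt; rewrite ltNge; apply/negP => le; apply: h; by exists (f, s').
have Gn n : Gam (fs n).1 by have [] := hfs n.
have [phi [ip [g _ hg]]] := cG Gn.
have e3 : 0 < e / 3 by rewrite divr_gt0.
have [N hN] := hg _ e3; have [d d0 hd] := peval_cont g s e3; have [N' hN'] := inv_small d0.
pose k := maxn N N'; have [_ h1 h2] := hfs (phi k).
have a1 := hN k (leq_maxl _ _) s; have a2 := hN k (leq_maxl _ _) (fs (phi k)).2.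
have a3 : chord (peval g s) (peval g (fs (phi k)).2) < e / 3.
  apply: hd; apply: lt_trans h1 _; apply: hN'; apply: leq_trans (incr_ge _ ip); exact: leq_maxr.
move: a1 a2 a3 h2; set A := peval (fs (phi k)).1 s; set A' := peval (fs (phi k)).1 _.
set B := peval g s; set B' := peval g _ => a1 a2 a3 h2.
have := chord_tri B A A'; have := chord_tri B' B A'; rewrite (chordC B' A'); lra.
Qed.

Lemma compact_family_seq A (f : nat -> {poly C}) (x : nat -> C) : ccompact A ->
  (forall n, Gam (f n)) -> (forall n, A (x n)) ->
  exists2 phi, incr phi & exists g l, [/\ Gam g, A l, ccvg (x \o phi) l &
    forall e, 0 < e -> exists d N, 0 < d /\ forall n y, (N <= n)%N -> cmod (y - l) < d ->
      cmod ((f (phi n)).[y] - g.[l]) < e].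
Proof.
move=> cA Gf Ax; have [phi [ip [g Gg hg]]] := cG Gf.
have [psi ips [l Al hl]] := ccompact_seq cA (fun n => Ax (phi n)).
exists (phi \o psi); first exact: incr_comp.
exists g, l; split => // e e0; have [r r0 hr] := chord_small (cmod g.[l]) e0.
have r20 : 0 < r / 2 by rewrite divr_gt0.
have [d d0 hd] := peval_cont g (Some l) r20; have [N hN] := hg _ r20.
exists (d / 2), N; split; first by rewrite divr_gt0.
move=> n y Nn yl; have [||c [->]//] := hr g.[l] (Some (f (phi (psi n))).[y]); first exact: lexx.
have h1 := hN (psi n) (leq_trans Nn (incr_ge _ ips)) (Some y).
have h2 : chord (peval g (Some l)) (peval g (Some y)) < r / 2.
  by apply: hd; apply: le_lt_trans (chord_le _ _) _; rewrite cmodBC; lra.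
by have := chord_tri (Some g.[y]) (Some g.[l]) (Some (f (phi (psi n))).[y]); rewrite chordC in h1; move: h1 h2 => /=; lra.
Qed.

Lemma compact_unif_equicont A e : ccompact A -> 0 < e -> exists2 d, 0 < d &
  forall f x y, Gam f -> A x -> cmod (y - x) < d -> cmod (f.[y] - f.[x]) < e.
Proof.
move=> cA e0; apply: contrapT => ne.
have /choice[q hq] : forall n : nat, exists q : {poly C} * C * C, [/\ Gam q.1.1, A q.1.2,
    cmod (q.2 - q.1.2) < n.+1%:R^-1 & e <= cmod (q.1.1.[q.2] - q.1.1.[q.1.2])].
  move=> n; apply: contrapT => h; apply: ne; exists n.+1%:R^-1; first exact: inv_nat_gt0.
  move=> f x y Gf Ax lt; rewrite ltNge; apply/negP => le; apply: h; by exists (f, x, y).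
have Gn n : Gam (q n).1.1 by have [] := hq n.
have An n : A (q n).1.2 by have [] := hq n.
have [phi ip [g [l [_ _ cv un]]]] := compact_family_seq cA Gn An.
have [d [N [d0 hd]]] := un _ (divr_gt0 e0 (ltr0n R 2)).
have [N' hN'] := ccvg_inv cv (divr_gt0 d0 (ltr0n R 2)).
pose k := maxn N N'; have [h1 h2] := hN' k (leq_maxr _ _).
have [_ _ h3 h4] := hq (phi k).
have h5 : cmod ((q (phi k)).2 - (q (phi k)).1.2) < d / 2.
  by apply: lt_trans h3 _; apply: le_lt_trans h2; apply/inv_nat_le/incr_ge.
move: h1 h4 h5 => /=; set x := (q (phi k)).1.2; set y := (q (phi k)).2 => h1 h4 h5.
have a1 := hd k x (leq_maxl _ _); have a2 := hd k y (leq_maxl _ _).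
have {}a1 := a1 (ltac:(lra)); have {}a2 := a2 (ltac:(have := cmod_tri x y l; lra)).
have := cmod_tri g.[l] (q (phi k)).1.1.[y] (q (phi k)).1.1.[x].
by rewrite (cmodBC g.[l]); move: a1 a2 h4 => /=; lra.
Qed.

Lemma compact_family_bounded A : ccompact A -> exists M, forall f x, Gam f -> A x -> cmod f.[x] <= M.
Proof.
move=> cA; apply: contrapT => ne.
have /choice[q hq] : forall n : nat, exists q : {poly C} * C, [/\ Gam q.1, A q.2 & n%:R < cmod q.1.[q.2]].
  move=> n; apply: contrapT => h; apply: ne; exists n%:R => f x Gf Ax.
  by rewrite leNgt; apply/negP => lt; apply: h; exists (f, x).
have Gn n : Gam (q n).1 by have [] := hq n.
have An n : A (q n).2 by have [] := hq n.
have [phi ip [g [l [_ _ cv un]]]] := compact_family_seq cA Gn An.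
have [d [N [d0 hd]]] := un _ ltr01; have [N' hN'] := cv d d0.
pose k := maxn (maxn N N') (Num.bound (cmod g.[l] + 1)).
have kN : (N <= k)%N by rewrite /k; lia.
have kN' : (N' <= k)%N by rewrite /k; lia.
have kB : (Num.bound (cmod g.[l] + 1) <= k)%N by rewrite /k; lia.
have h1 := hd k _ kN (hN' k kN'); have [_ _ h2] := hq (phi k).
have h3 : (Num.bound (cmod g.[l] + 1))%:R <= (phi k)%:R :> R.
  by rewrite ler_nat; apply: leq_trans kB (incr_ge _ ip).
have g0 : 0 <= cmod g.[l] + 1 by rewrite addr_ge0 ?cmod_ge0.
have := archi_boundP g0; have := cmod_le_sub (q (phi k)).1.[(q (phi k)).2] g.[l].
by move: h1 h2 => /=; lra.
Qed.

(** Values at radius [5 * r] are at least [2 ^ n] for degree [n], while compactness bounds them over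
    the family; this caps the degree. The leading coefficient is then bounded below because the
    value at [r] is at least one. *)
Lemma compact_degree_lead r : 1 <= r -> (forall f, Gam f -> (1 < size f)%N) ->
  (forall f x, Gam f -> r <= cmod x -> 1 <= cmod f.[x]) ->
  exists (D : nat) (a : R), [/\ (0 < D)%N, 0 < a & forall f, Gam f -> ((size f).-1 <= D)%N /\ a <= cmod (lead_coef f)].
Proof.
move=> r1 sG low; have r0 : 0 < r by lra.
have [M hM] := compact_family_bounded (ball_compact 0 (5 * r)).
pose D := (Num.bound `|M|).+1.
exists D, ((2 * r) ^+ D)^-1; split => //; first by rewrite invr_gt0 exprn_gt0 // mulr_gt0.
move=> f Gf; have sf := sG f Gf.
have zr z : f.[z] = 0 -> cmod z <= r.
  by move=> fz; rewrite leNgt; apply/negP => /ltW/(low f z Gf); rewrite fz cmod0 ler10.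
have cr : cmod (r%:C%C : C) = r by rewrite cmodC ger0_norm // ltW.
have c5 : cmod ((5 * r)%:C%C : C) = 5 * r by rewrite cmodC ger0_norm //; lra.
have f1 : 1 <= cmod f.[r%:C%C] by apply: low => //; rewrite cr.
have nD : ((size f).-1 <= D)%N.
  have := @zeros_growth R f r 0 (5 * r)%:C%C r%:C%C sf r0 zr; rewrite cr c5 => /(_ (lexx _)).
  have -> : (5 * r - r) / (2 * r) = 2 by field; rewrite gt_eqF.
  move=> h; have {}h := h (ltac:(lra)).
  have h2 := hM f (5 * r)%:C%C Gf; rewrite subr0 c5 in h2.
  have h3 : 2 ^+ (size f).-1 <= M.
    apply: le_trans (h2 (lexx _)); apply: le_trans h; by rewrite ler_peMl ?exprn_ge0.
  have h4 : ((size f).-1 < 2 ^ (size f).-1)%N by apply: ltn_expl.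
  rewrite /D ltnW // ltnS ltnW // -(ltr_nat R); apply: lt_le_trans (_ : (2 ^ (size f).-1)%:R <= _); first by rewrite ltr_nat.
  rewrite natrX; apply: le_trans h3 _; apply: le_trans (ler_norm M) _.
  exact: ltW (archi_boundP (normr_ge0 M)).
split => //.
have := zeros_upper sf r0 zr (x := r%:C%C); rewrite cr => /(_ (lexx _)) h.
have r2 : 1 <= 2 * r by lra.
have r20 : 0 < (2 * r) ^+ D by rewrite exprn_gt0 //; lra.
rewrite -div1r ler_pdivrMr //; apply: le_trans f1 (le_trans h _).
by rewrite ler_wpM2l ?cmod_ge0 // ler_weXn2l.
Qed.

End CompactFamilies.

(** * Dynamics near infinity *)

Section NearInfinity.
Variable R : realType.
Local Notation C := R[i].
Implicit Types (x y z v p q a : C) (f g h : {poly C}) (e d r t M : R) (s : sphere R) (n N : nat).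

(* The local degree of the iterates at [s] would be unbounded. *)
Lemma totally_ramified_fatou (H : {poly C} -> Prop) h s : closed_comp H -> semi_hyperbolic H -> H h ->
  (2 < size h)%N ->
  (forall f, H f -> (1 < size f)%N -> peval f s = s /\ locdeg f s = (size f).-1) -> ~ Julia H s.
Proof.
move=> cH sH Hh sh hs /sH[U [N [_ Us hU]]].
(* The degree of this iterate exceeds [N + 1], and all of it is concentrated at the fixed point
   [s]. *)
pose f := itp h N.+1; have Hf : H f by apply: closed_itp.
have sE : (size f).-1 = ((size h).-1 ^ N.+1)%N by apply: size_itp.
have big : (N.+1 < (size f).-1)%N by rewrite sE ltn_expl //; lia.
have [fs fl] := hs f Hf (ltac:(lia)).
have Vs : scomponent (fun v : sphere R => U (peval f v)) s s by apply: scomponent_refl; rewrite fs.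
have cV : is_component (fun v : sphere R => U (peval f v)) (scomponent (fun v : sphere R => U (peval f v)) s).
  by exists s => //; rewrite fs.
have := hU f Hf _ cV s Us [:: s] isT; rewrite big_seq1 fl => h1.
have := h1 (ltac:(by move=> v; rewrite inE => /eqP ->)); lia.
Qed.

Lemma equicont_none_large (F : {poly C} -> Prop) : (forall f, F f -> (1 < size f)%N) -> equicont F None ->
  exists T, forall f x, F f -> T <= cmod x -> 1 <= cmod f.[x].
Proof.
move=> sF eq; have [e e0 he] := @chord_inf_big R 1; have [d d0 hd] := eq e e0.
have [T _ hT] := big_chord_inf d0; exists T => f x Ff /hT xT.
have := hd f (Some x) Ff; rewrite chordC => /(_ xT).
by rewrite /= leqNgt sF //= => h; apply/ltW/he.
Qed.

Lemma pow_chord (t : R) n : 0 <= t <= 1 -> (1 + t) ^+ n - 1 <= t * 2 ^+ n.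
Proof.
move=> /andP[t0 t1]; suff : (1 + t) ^+ n <= 1 + t * (2 ^+ n - 1) by lra.
elim: n => [|n IH]; first by rewrite !expr0 subrr mulr0 addr0.
rewrite !exprS; apply: le_trans (ler_wpM2l _ IH) _; first lra.
have : 1 <= 2 ^+ n :> R by rewrite exprn_ege1 // ler1n.
set A := 2 ^+ n => A1; rewrite -subr_ge0.
rewrite (_ : _ - _ = t * (1 - t) * (A - 1)); last by ring.
by rewrite !mulr_ge0 // subr_ge0.
Qed.

Lemma prod_perturb (s : seq C) x y t : 0 <= t -> (forall z, z \in s -> cmod (y - x) <= t * cmod (x - z)) ->
  cmod (\prod_(z <- s) (y - z) - \prod_(z <- s) (x - z)) <=
  cmod (\prod_(z <- s) (x - z)) * ((1 + t) ^+ size s - 1).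
Proof.
move=> t0; elim: s => [|a s IH] hs; first by rewrite !big_nil !subrr cmod0 mulr0.
rewrite !big_cons /= exprS; have {}IH := IH (fun z zs => hs z (mem_behead (s := a :: s) zs)).
have ha := hs a (mem_head _ _).
move: IH; set A := \prod_(z <- s) (y - z); set B := \prod_(z <- s) (x - z); set T := _ ^+ _ => IH.
have -> : (y - a) * A - (x - a) * B = (y - a) * (A - B) + (y - x) * B by ring.
have h1 : cmod (y - a) <= (1 + t) * cmod (x - a) by have := cmod_tri x y a; lra.
apply: le_trans (cmodD _ _) _; rewrite !cmodM.
apply: (@le_trans _ _ ((1 + t) * cmod (x - a) * (cmod B * (T - 1)) + t * cmod (x - a) * cmod B)).
  by apply: lerD; [apply: ler_pM => //; apply: cmod_ge0 | apply: ler_wpM2r => //; apply: cmod_ge0].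
by rewrite le_eqVlt; apply/orP; left; apply/eqP; ring.
Qed.

Section Escaping.
Variables (G : {poly C} -> Prop) (r0 : R).
Hypothesis esc : escaping G r0.

(** The [7] makes the growth factor [(cmod x - r0) / (2 * r0)] at least [3]. *)
Lemma esc_lower f x : G f -> 7 * r0 <= cmod x -> 3 ^+ (size f).-1 <= cmod f.[x].
Proof.
move=> Gf xr; have r1 := esc_r0 esc; have r00 : 0 < r0 by lra.
have cr : cmod (r0%:C%C : C) = r0 by rewrite cmodC ger0_norm // ltW.
have zr z : f.[z] = 0 -> cmod z <= r0 by apply: (G_zeros esc); left.
have h1 := esc_double esc Gf (x := r0%:C%C); rewrite cr in h1; have {}h1 := h1 (lexx _).
have h2 := @zeros_growth R f r0 0 x r0%:C%C (esc_size esc Gf) r00 zr; rewrite cr in h2.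
apply: le_trans (h2 (lexx _) (ltac:(lra))).
have h3 : 3 <= (cmod x - r0) / (2 * r0) by rewrite ler_pdivlMr ?mulr_gt0 //; lra.
have h4 : 3 ^+ (size f).-1 <= ((cmod x - r0) / (2 * r0)) ^+ (size f).-1 by apply: lerXn2r; rewrite ?nnegrE //; lra.
apply: le_trans h4 _; rewrite ler_peMl //; last lra.
by apply: exprn_ge0; lra.
Qed.

(** The relative change of [f] is at most [t * 2 ^ n] for degree [n], and the chordal metric divides
    by a modulus of at least [3 ^ n]. The degree cancels, which gives equicontinuity over all of
    [G]. *)
Lemma esc_chord f x y t : G f -> 0 <= t <= 1 -> 7 * r0 <= cmod x -> 7 * r0 <= cmod y ->
  cmod (y - x) <= t * (cmod x - r0) -> chord (Some f.[x]) (Some f.[y]) <= 2 * t.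
Proof.
move=> Gf t01 xr yr yx; have /andP[t0 _] := t01; have r1 := esc_r0 esc.
have sf := esc_size esc Gf; have f0 : f != 0 by rewrite -size_poly_eq0; case: size sf.
have [s [sE sz]] := poly_split f0.
have pb : cmod (\prod_(z <- s) (y - z) - \prod_(z <- s) (x - z)) <=
    cmod (\prod_(z <- s) (x - z)) * (t * 2 ^+ size s).
  apply: le_trans (prod_perturb t0 _) _; last by rewrite ler_wpM2l ?cmod_ge0 // pow_chord.
  move=> z /(root_split sE)/eqP/eqP fz; apply: le_trans yx _; rewrite ler_wpM2l //.
  have zr : cmod z <= r0 by apply: (G_zeros esc) fz; left.
  by have := cmod_le_sub x z; lra.
have fE v : f.[v] = lead_coef f * \prod_(z <- s) (v - z).
  by rewrite {1}sE hornerZ horner_prod; congr (_ * _); apply: eq_bigr => z _; rewrite hornerXsubC.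
have h1 : cmod (f.[x] - f.[y]) <= cmod f.[x] * (t * 2 ^+ size s).
  rewrite cmodBC !fE -mulrBr !cmodM -mulrA.
  by rewrite ler_wpM2l ?cmod_ge0.
have h2 : 2 ^+ size s <= cmod f.[y].
  by rewrite sz; apply: le_trans (esc_lower Gf yr); apply: lerXn2r; rewrite ?nnegrE ?ler_nat.
rewrite chordE ler_pdivrMr ?mulr_gt0 ?sq1_pos // -mulrA ler_pM2l //; apply: le_trans h1 _.
rewrite mulrCA ler_wpM2l //; apply: ler_pM; rewrite ?cmod_ge0 ?exprn_ge0 ?sq1_ge //.
exact: le_trans h2 (sq1_ge _).
Qed.

Lemma esc_fatou_none : Fatou G None.
Proof.
(* [8 * r0] leaves room for a displacement by [r0] within the range of [esc_chord]. *)
have r1 := esc_r0 esc; have [r rr hr] := @chord_inf_big R (8 * r0).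
apply: (equicont_fatou rr) => -[x|] xr.
  rewrite chordC in xr; have {xr}hx := hr x xr; apply: equicont_fin => e e0.
  pose t := Num.min 1 (e / 4).
  have t0 : 0 < t by rewrite /t lt_min ltr01 divr_gt0.
  have t1 : t <= 1 by rewrite /t ge_min lexx.
  have te : t <= e / 4 by rewrite /t ge_min lexx orbT.
  pose d := Num.min r0 (t * (cmod x - r0)).
  have d0 : 0 < d by rewrite /d lt_min (lt_le_trans ltr01 r1) mulr_gt0 //; lra.
  exists d => // f y Gf; rewrite lt_min => /andP[y1 y2].
  apply: (@le_lt_trans _ _ (2 * t)); last lra.
  apply: esc_chord => //; first by rewrite (ltW t0).
  - lra.
  - by have := cmod_le_sub x y; rewrite cmodBC; lra.
  - exact: ltW.
move=> e e0; have [T T0 hT] := big_chord_inf e0.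
have [d d0 hd] := @chord_inf_big R (T + r0); exists d => // f [x|] Gf; last first.
  by rewrite /= leqNgt (esc_size esc Gf) /=.
rewrite (chordC None) => /hd xT; have -> : peval f None = None by rewrite /= leqNgt (esc_size esc Gf).
rewrite chordC; apply: (hT f.[x]).
by have := esc_double esc Gf (x := x); lra.
Qed.

Lemma julia_compact : ccompact (fun x => Julia G (Some x)).
Proof.
split.
  move=> x hx /fatou_ball[r rr hr]; have [y Jy yx] := hx _ (divr_gt0 rr (ltr0n R 2)).
  by apply/Jy/hr/(le_lt_trans (chord_le _ _)); rewrite cmodBC; lra.
have [r rr hr] := fatou_ball esc_fatou_none; have [M _ hM] := big_chord_inf rr.
exists M => x Jx; rewrite leNgt; apply/negP => lt; apply/Jx/hr; rewrite chordC; apply: hM; exact: ltW.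
Qed.

End Escaping.

(** Normality at infinity gives one radius beyond which all generators have modulus at least one,
    that is, no zeros; [uniform_escape] upgrades this to doubling, which passes to compositions. *)
Lemma escaping_gen (H Gam : {poly C} -> Prop) : in_calG H -> poly_compact Gam ->
  in_calG (gen (fun p : {poly C} => H p \/ Gam p)) -> semi_hyperbolic H ->
  exists r0 : R, escaping (gen (fun p : {poly C} => H p \/ Gam p)) r0.
Proof.
set G := gen _; move=> [[[h Hh] _ cH] sH _] cG [[ex _ cGG] sG [M hM]] hypH.
have HG f : H f \/ Gam f -> G f by move=> hf; apply: gen_incl.
have sF f : H f \/ Gam f -> (1 < size f)%N by move=> /HG/sG; apply: ltn_trans.
have nJ : ~ Julia H None.
  apply: totally_ramified_fatou hypH Hh (sH _ Hh) _ => // f _ sf; by rewrite /= leqNgt sf.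
have /fatou_equicont eH := contrapT nJ.
have [T1 hT1] := equicont_none_large (fun f Hf => sF f (or_introl Hf)) eH.
have [T2 hT2] := equicont_none_large (fun f Hf => sF f (or_intror Hf)) (compact_equicont cG None).
pose r := Num.max 1 (Num.max T1 T2).
have rE : [/\ 1 <= r, T1 <= r & T2 <= r] by rewrite /r !le_max !lexx !orbT.
have [r1 rT1 rT2] := rE.
have low f x : H f \/ Gam f -> r <= cmod x -> 1 <= cmod f.[x].
  by move=> [/hT1 h1|/hT2 h1] rx; apply: h1; apply: le_trans rx.
have up := uniform_escape r1 (fun f hf => sG f (HG f hf)) low.
set r0 := (r + _) in up; have r01 : 1 <= r0.
  by have : 0 <= 2 * r * (4 * r + 1); [rewrite !mulr_ge0 ?addr_ge0 ?mulr_ge0 //; lra | rewrite /r0; lra].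
have dbl f : G f -> forall x, r0 <= cmod x -> 2 * cmod x <= cmod f.[x].
  move=> Gf; apply: (gen_ind (P := fun f => forall x, r0 <= cmod x -> 2 * cmod x <= cmod f.[x]) _ _ Gf).
    by move=> p hp x; apply: up.
  move=> p q hp hq x rx; have h1 := hq x rx; have h2 := hp q.[x]; rewrite horner_comp.
  by have := h2 (ltac:(lra)); lra.
exists r0; split => // [g x Gg rx|g x Gg gx].
  exact: dbl.
(* The image under [f] of a critical value of [g] is a critical value of [f \Po g], hence
   postcritical. *)
exists M => f Gf; apply: hM => e e0; exists (Some f.[g.[x]]); last by rewrite chord_refl.
exists (f \Po g); first exact: cGG.
by left; exists x; rewrite ?horner_comp // deriv_comp hornerM gx mulr0.
Qed.

End NearInfinity.

(** * Semi-hyperbolicity of the generated semigroup *)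

Section Main.
Variable R : realType.
Local Notation C := R[i].
Implicit Types (x y z u v w p q a b l c : C) (f g h : {poly C}) (e d r t M : R) (n N : nat).
Variables (H Gam : {poly C} -> Prop) (r0 : R).
Let G := gen (fun p : {poly C} => H p \/ Gam p).
Local Notation J := (fun x => Julia G (Some x)).
Hypothesis esc : escaping G r0.
Hypothesis cH : closed_comp H.
Hypothesis hypH : semi_hyperbolic H.
Hypothesis exH : exists h, H h.
Hypothesis cG : poly_compact Gam.
Hypothesis Jmin_disjoint : forall K, is_Jmin G K -> forall f, Gam f -> forall z : sphere R, Julia1 f z -> K z -> False.

Lemma HG f : H f -> G f. Proof. by move=> Hf; apply: gen_incl; left. Qed.

Lemma GamG f : Gam f -> G f. Proof. by move=> Hf; apply: gen_incl; right. Qed.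

Lemma withHG f : with_id H f -> with_id G f.
Proof. by move=> [/HG|]; [left | right]. Qed.

(** Otherwise some boundary point [l] of [filled g 'X], a point of the Julia set of [g], lies in the
    quasi-component of [z], hence in its component. That component contains the boundary point [z]
    of [Khat G], so it is [J_min] and must avoid [l]. *)
Lemma boundary_separated g z : Gam g -> J z -> Khat G z ->
  exists2 e, 0 < e & forall j, cboundary (filled r0 g 'X) j -> ~ chain J e z j.
Proof.
move=> gg Jz Kz; have Gg := GamG gg; have WX : with_id G 'X by right.
apply: contrapT => ne.
have cB : ccompact (cboundary (filled r0 g 'X)).
  split; last by exists r0 => x bx; apply: (filled_bound esc WX (filled_boundary_in bx)).
  move=> x hx e e0; have e20 : 0 < e / 2 by rewrite divr_gt0.
  have [y by_ yx] := hx _ e20; have [[a Fa ya] [b Fb yb]] := by_ _ e20.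
  by split; [exists a | exists b] => //; [have := cmod_tri y x a | have := cmod_tri y x b]; rewrite (cmodBC x y); lra.
have [|l bl hl] := compact_cluster (P := fun e j => chain J e z j) cB.
  move=> e e0; apply: contrapT => h; apply: ne; exists e => // j bj cj; apply: h; by exists j.
have cJ := julia_compact esc.
have [B [lB BJ BP]] := chain_lconn cJ Jz.
have Jl : J l := filled_boundary_julia esc Gg WX bl.
have Bl : B l.
  apply/BP => d d0; have [e [x [e0 ed xl bx cx]]] := hl d d0.
  by apply: chain_step (chain_le (ltW ed) cx) Jl _; rewrite cmodBC.
have Bz : B z by apply/BP => d d0; apply: chain_refl.
have K : is_Jmin G (scomponent (Julia G) (Some z)).
  split; first by exists (Some z).
  - by move=> /scomponent_sub; apply; apply: esc_fatou_none esc.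
  - by exists z; [exact: (julia_Khat_boundary esc Jz Kz) | exact: scomponent_refl].
apply: (Jmin_disjoint K gg (filled_boundary_julia1 esc Gg bl)).
exact: lconn_scomponent lB BJ Bz Bl.
Qed.

(** Total ramification puts [p] in the Fatou set of [H]. Equicontinuity of all generators at [p]
    then bounds their leading coefficients, which makes a small disc around [p] part of [Khat G]. *)
Lemma single_point_absurd p : Khat G p -> (forall z, Khat G z -> z = p) -> False.
Proof.
move=> Kp Ku; have [h Hh] := exH; have sG f : G f -> (2 < size f)%N by case: esc => _ _ [hs _] _ _; apply: hs.
have nJ : ~ Julia H (Some p).
  apply: (totally_ramified_fatou cH hypH Hh (sG _ (HG Hh))) => f Hf _; split.
    by rewrite /= (single_fixed esc Kp Ku (HG Hf)).
  by have [_ ->] := single_form esc Kp Ku (HG Hf).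
have fix_ f : G f -> f.[p] = p := single_fixed esc Kp Ku (f := f).
have bH f : H f -> cmod f.[p] <= cmod p by move=> /HG/fix_ ->.
have bG f : Gam f -> cmod f.[p] <= cmod p by move=> /GamG/fix_ ->.
have [d1 d10 h1] := equicont_bounded (fatou_equicont (contrapT nJ)) bH ltr01.
have [d2 d20 h2] := equicont_bounded (compact_equicont cG _) bG ltr01.
pose t := Num.min 1 (Num.min (d1 / 2) (d2 / 2)).
have t0 : 0 < t by rewrite /t !lt_min ltr01 !divr_gt0.
have [t1 td1 td2] : [/\ t <= 1, t <= d1 / 2 & t <= d2 / 2].
  by rewrite /t !ge_min !lexx !orbT.
have ct : cmod (p + t%:C%C - p) = t by rewrite addrC addKr cmodC ger0_norm // ltW.
have lead f : H f \/ Gam f -> cmod (lead_coef f) * t ^+ (size f).-1 <= 1.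
  move=> hf; have Gf : G f by apply: gen_incl.
  have [fE _] := single_form esc Kp Ku Gf; have := fE (p + t%:C%C); rewrite ct => <-.
  rewrite -{2}(fix_ f Gf); case: hf => [Hf|gf]; apply: ltW; [apply: h1 | apply: h2] => //; rewrite ct; lra.
have inv f : G f -> forall y, cmod (y - p) <= t ^+ 2 -> cmod (f.[y] - p) <= cmod (y - p).
  move=> Gf; apply: (gen_ind (P := fun f => forall y, cmod (y - p) <= t ^+ 2 -> cmod (f.[y] - p) <= cmod (y - p)) _ _ Gf).
    move=> {Gf}f hf y yt; have Gf : G f by apply: gen_incl.
    have [-> _] := single_form esc Kp Ku Gf.
    have [n nE] : exists n, (size f).-1 = n.+2 by exists (size f - 3)%N; have := sG f Gf; lia.
    (* With radius [t ^ 2] one has [s <= t]; the bound [lead] leaves [s] to the degree, at most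
       [s ^ 2], hence at most [s * t]. *)
    pose s := cmod (y - p) / t; have yE : cmod (y - p) = s * t by rewrite /s divfK // gt_eqF.
    have s0 : 0 <= s by rewrite /s divr_ge0 ?cmod_ge0 // ltW.
    have st : s <= t by rewrite -(ler_pM2r t0) -yE -expr2.
    have := lead f hf; rewrite yE exprMn mulrCA => l1.
    apply: (@le_trans _ _ (s ^+ (size f).-1)); first by rewrite ler_piMr ?exprn_ge0.
    rewrite nE !exprS; have : s ^+ n <= 1 by rewrite exprn_ile1 //; lra.
    move=> sn; rewrite ler_wpM2l //; apply: le_trans st; rewrite ler_piMr //.
  move=> {Gf}f g hf hg y yt; rewrite horner_comp.
  by apply: le_trans (hf _ (le_trans (hg y yt) yt)) (hg y yt).
have ct2 : cmod (p + (t ^+ 2)%:C%C - p) = t ^+ 2 by rewrite addrC addKr cmodC ger0_norm // exprn_ge0 // ltW.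
have : Khat G (p + (t ^+ 2)%:C%C).
  exists (cmod p + t ^+ 2) => f Gf; have := inv f Gf (p + (t ^+ 2)%:C%C); rewrite ct2 => /(_ (lexx _)).
  by have := cmod_le_sub f.[p + (t ^+ 2)%:C%C] p; lra.
move=> /Ku E; move: ct2; rewrite E subrr cmod0 => /esym/eqP; rewrite expf_eq0 /=; by rewrite gt_eqF.
Qed.

Lemma image_fatou g x : Gam g -> Khat G x -> ~ J g.[x].
Proof.
move=> gg Kx; have [[b Kb bx]|h] := pselect (exists2 b, Khat G b & b != x).
  apply: (image_Khat_fatou esc (GamG gg) Kb Kx bx) => // z Jz Kz; exact: boundary_separated.
case: (single_point_absurd Kx) => z Kz; apply: contrapT => /eqP zx; apply: h; by exists z.
Qed.

(** A point of [Khat G] outside [J] is interior, by [boundary_Khat_julia]; compactness of [Gam] and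
    of [Khat G] makes the margin uniform. *)
Lemma image_margin : exists2 d, 0 < d & forall g x y, Gam g -> Khat G x -> cmod (y - g.[x]) < d -> Khat G y.
Proof.
apply: contrapT => ne.
have /choice[q hq] : forall n : nat, exists q : {poly C} * C * C, [/\ Gam q.1.1, Khat G q.1.2,
    cmod (q.2 - q.1.1.[q.1.2]) < n.+1%:R^-1 & ~ Khat G q.2].
  move=> n; apply: contrapT => h; apply: ne; exists n.+1%:R^-1; first exact: inv_nat_gt0.
  move=> g x y gg Kx lt; apply: contrapT => nK; apply: h; by exists (g, x, y).
have gn n : Gam (q n).1.1 by have [] := hq n.
have Kn n : Khat G (q n).1.2 by have [] := hq n.
have [phi ip [g [l [gg Kl cv un]]]] := compact_family_seq cG (Khat_compact esc) gn Kn.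
have [r rr hr] : interior_pt (Khat G) g.[l].
  have Kgl : Khat G g.[l] := Khat_forward esc (GamG gg) Kl.
  apply: contrapT => nI; apply: (image_fatou gg Kl); apply: (boundary_Khat_julia esc); exact: boundaryP.
have r20 : 0 < r / 2 by rewrite divr_gt0.
have [d [N [d0 hd]]] := un _ r20; have [N' hN'] := ccvg_inv cv (ltac:(by rewrite lt_min d0 r20) : 0 < Num.min d (r / 2)).
pose k := maxn N N'; have [] := hN' k (leq_maxr _ _); rewrite !lt_min => /andP[k1 _] /andP[_ k2].
have k3 := hd k _ (leq_maxl _ _) k1.
have [_ _ k4 nK] := hq (phi k); apply/nK/hr.
have k5 : (phi k).+1%:R^-1 <= k.+1%:R^-1 :> R by apply/inv_nat_le/incr_ge.
have k6 := lt_trans (lt_le_trans k4 k5) k2.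
have := cmod_tri (q (phi k)).1.1.[(q (phi k)).1.2] (q (phi k)).2 g.[l].
by move: k3 k6 {k2 k4 k5} => /=; lra.
Qed.

(** If [H] is normal at [x], the part of a word before its first letter from [Gam] moves nearby
    points only slightly off [Khat G], and that letter brings them back by [image_margin]. So [x]
    would be interior to [Khat G]. *)
Lemma julia_sub x : J x -> Khat G x -> Julia H (Some x).
Proof.
move=> Jx Kx /fatou_equicont eqH; apply: Jx; apply: (fatou_interior (A := Khat G) (M := r0)).
  by move=> f y Gf /(KhatP esc); apply.
have bH f : H f -> cmod f.[x] <= r0 by move=> /HG; move/(KhatP esc): Kx; apply.
have [d d0 hd] := image_margin; have [e e0 he] := compact_unif_equicont cG (Khat_compact esc) d0.
have [d1 d10 h1] := equicont_bounded eqH bH (ltac:(by rewrite lt_min e0 ltr01) : 0 < Num.min e 1).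
exists (Num.min d1 e); first by rewrite lt_min d10.
move=> y; rewrite lt_min => /andP[y1 y2]; exists (r0 + 1) => f Gf.
have [Hf|[w [g [h [Ww gg Wh ->]]]]] := gen_right cH Gf.
  have := h1 f y Hf y1; rewrite lt_min => /andP[_]; have := bH f Hf.
  by have := cmod_le_sub f.[y] f.[x]; lra.
have hy : cmod (h.[y] - h.[x]) < e.
  by case: Wh => [Hh|->]; [have := h1 h y Hh y1; rewrite lt_min => /andP[] | rewrite !hornerX].
have Khx : Khat G h.[x] := withG_Khat esc (withHG Wh) Kx.
have Kgy : Khat G g.[h.[y]] := hd g _ _ gg Khx (he g _ _ gg Khx hy).
by rewrite !horner_comp; have := Khat_lt esc (withG_Khat esc Ww Kgy); lra.
Qed.

(** A disc at [z] off the closed set [Khat G] carries no critical value of any element, so each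
    component over it maps injectively. *)
Lemma off_Khat_degree z : ~ Khat G z -> exists2 e, 0 < e &
  forall g x u, G g -> cmod (g.[x] - z) < e -> cmod (u - z) < e ->
    fibre_le g (ccomp (fun y : C => cmod (g.[y] - z) < e) x) u 1.
Proof.
move=> nK; have [e e0 he] : exists2 e, 0 < e & forall y, cmod (y - z) <= e -> ~ Khat G y.
  apply: contrapT => ne; apply: nK; apply: (Khat_closed esc) => e e0.
  have e20 : 0 < e / 2 by rewrite divr_gt0.
  apply: contrapT => h; apply: ne; exists (e / 2) => // y ye Ky; apply: h; exists y => //; lra.
exists e => // g x u Gg xe ue; have sg := esc_size esc Gg.
have nz y : cmod (g.[y] - z) <= e -> g^`().[y] != 0.
  by move=> /he nKy; apply/eqP => /(crit_Khat esc (or_introl Gg)).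
have -> : g = 'X \Po g by rewrite comp_polyX.
apply: (@fibre_le_inj _ _ _ (fun=> True)) => //.
- by rewrite size_polyX.
- by have := @fibre_le_size R 'X (fun=> True) u; rewrite size_polyX; apply.
- move=> y /ccomp_sub; rewrite comp_polyX => /ltW/nz; by split.
move=> y y'; rewrite comp_polyX => cy cy'; have [B [cB BA By By']] := ccomp_join cy cy'.
apply: (injective_over_disc sg nz cB _ By By') => v /BA; exact: ltW.
Qed.

Lemma on_Khat_degree z : J z -> Khat G z -> exists e (k : nat), 0 < e /\
  forall g x u, G g -> cmod (g.[x] - z) < e -> cmod (u - z) < e ->
    fibre_le g (ccomp (fun y : C => cmod (g.[y] - z) < e) x) u k.
Proof.
move=> Jz Kz; have [U [N0 [oU Uz hU]]] := hypH (julia_sub Jz Kz).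
have r01 := esc_r0 esc; have zr := Khat_lt esc Kz.
have [r1 r10 hr1] := sopen_interior oU Uz.
(* The second bound keeps the disc inside radius [r0], so that its preimages stay there too
   ([bd]). *)
pose r := Num.min r1 (r0 - cmod z).
have r_gt0 : 0 < r by rewrite /r lt_min r10 subr_gt0.
have [rr1 rr0] : r <= r1 /\ r <= r0 - cmod z by rewrite /r !ge_min !lexx orbT.
have rU x : cmod (x - z) < r -> U (Some x) by move=> h; apply: hr1; apply: lt_le_trans rr1.
(* One more than the bound from [H], so that the identity, of degree one, is covered as well. *)
pose N := N0.+1.
have bd h y : with_id H h -> cmod (h.[y] - z) < r -> cmod y <= r0.
  move=> Wh hy; rewrite leNgt; apply/negP => lt.
  have := withG_double esc (withHG Wh) (ltW lt).
  by have := cmod_le_sub h.[y] z; lra.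
have sW h : with_id H h -> (1 < size h)%N by move=> Wh; exact: (withG_size esc (withHG Wh)).
have fib h x u : with_id H h -> cmod (h.[x] - z) < r -> cmod (u - z) < r ->
    fibre_le h (ccomp (fun y : C => cmod (h.[y] - z) < r) x) u N.
  move=> [Hh|->] xr ur; last first.
    apply: (@fibre_le_mono _ _ _ _ 1) => //.
    by have := @fibre_le_size R 'X; rewrite size_polyX; apply.
  apply: (@fibre_le_mono _ _ _ _ N0) => //; pose A (v : sphere R) := U (peval h v).
  have cV : is_component A (scomponent A (Some x)) by exists (Some x) => //; apply: rU.
  have := fibre_deg_le (hU h Hh _ cV) (rU u ur); apply: fibre_le_sub => y [B [cB BA Bx By]].
  by apply: (lconn_scomponent cB _ Bx By) => v /BA/rU.
have [d d0 hd] := image_margin.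
have d20 : 0 < d / 2 by rewrite divr_gt0.
have [d2 d2_gt0 hd2] := compact_unif_equicont cG (Khat_compact esc) d20.
have sG f : Gam f -> (1 < size f)%N by move=> /GamG/(esc_size esc).
have low f x : Gam f -> r0 <= cmod x -> 1 <= cmod f.[x].
  by move=> /GamG Gf xr; have := esc_double esc Gf xr; lra.
have [D [a [D0 a0 ha]]] := compact_degree_lead cG r01 sG low.
have small (k : nat) (c : R) : 0 < c -> exists p : R, [/\ 0 < p, p <= 1 & 2 * p * k.+1%:R <= c].
  move=> c0; exists (Num.min 1 (c / (2 * k.+1%:R))).
  have k0 : 0 < 2 * k.+1%:R :> R by rewrite mulr_gt0.
  split; [by rewrite lt_min ltr01 divr_gt0 | by rewrite ge_min lexx |].
  rewrite mulrAC mulrC -ler_pdivlMr //; by rewrite ge_min lexx orbT.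
(* Three scales: [p1] keeps components under [h] below [d / 2], [p2] keeps preimages under [Gam]
   below [d2 / 2], and [p3] makes components under [h] small enough for the latter. *)
have [p1 [p10 p11 hp1]] := small N _ d20.
have [p2 [p20 p21 hp2]] := small D _ (ltac:(by rewrite divr_gt0) : 0 < d2 / 2).
have [p3 [p30 p31 hp3]] := small N _ (ltac:(by rewrite mulr_gt0 ?exprn_gt0) : 0 < a * p2 ^+ D).
pose E (p : R) := r * (p / (2 * r0)) ^+ N.
have E0 (p : R) : 0 < p -> 0 < E p by move=> h; rewrite mulr_gt0 ?exprn_gt0 ?divr_gt0 //; lra.
have Er (p : R) : 0 < p -> p <= 1 -> E p <= r.
  move=> h h'; rewrite /E ler_piMr ?(ltW r_gt0) // exprn_ile1 ?divr_ge0 ?(ltW h) //; first lra.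
  by rewrite ler_pdivrMr; lra.
have diam h (S : C -> Prop) (p : R) x y : with_id H h -> 0 < p -> p <= 1 -> lconn S ->
    (forall v, S v -> cmod (h.[v] - z) < E p) -> S x -> S y -> cmod (y - x) < 2 * p * N.+1%:R.
  move=> Wh h1 h2 cS Sp Sx Sy.
  apply: (small_components (sW h Wh) r_gt0 h1 _ _ _ cS Sp Sx Sy); first lra.
    by move=> v; apply: bd.
  by move=> v vr; apply: fib => //; rewrite subrr cmod0.
(* Some [b] off [Khat G] lies close to the boundary point [z]. It has a preimage in the component of
   [q], within [d / 2] of [q]; if that were in [Khat G], so would be [b]. *)
have far h q : with_id H h -> cmod (h.[q] - z) < E p1 -> (forall y, cmod (y - q) < d / 2 -> Khat G y) -> False.
  move=> Wh qE Kq; have [_ [b nb zb]] := julia_Khat_boundary esc Jz Kz (E0 p1 p10).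
  rewrite cmodBC in zb; have [v [B [cB BA Bq Bv]] hv] := ccomp_onto (sW h Wh) qE zb.
  have vq := diam h B p1 q v Wh p10 p11 cB BA Bq Bv.
  apply: nb; rewrite -hv; apply: (withG_Khat esc (withHG Wh)); apply: Kq; lra.
pose e := Num.min (E p1) (E p3).
have e0 : 0 < e by rewrite /e lt_min !E0.
have [e1 e3] : e <= E p1 /\ e <= E p3 by rewrite /e !ge_min !lexx orbT.
have er : e <= r by apply: le_trans e1 (Er _ p10 p11).
exists e, (N * D)%N; split => // g x u Gg xe ue.
have ur : cmod (u - z) < r by apply: lt_le_trans er.
have [Hg|[h [f [w [Wh ff Ww gE]]]]] := gen_left cH Gg.
  apply: (@fibre_le_mono _ _ _ _ N); first by rewrite leq_pmulr.
  apply: fibre_le_sub (fib g x u (or_introl Hg) (lt_le_trans xe er) ur) => y [B [cB BA Bx By]].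
  by exists B; split => // v /BA h; apply: lt_le_trans er.
have gx y : g.[y] = h.[f.[w.[y]]] by rewrite gE !horner_comp.
have sw := withG_size esc Ww.
(* A critical value of [w] lies in [Khat G], so its image under [f] is deep inside; [f.[w.[v]]]
   would then have a [d / 2]-disc in [Khat G], against [far]. *)
have nocrit y v : cmod (g.[v] - z) < e -> cmod (w.[y] - w.[v]) <= d2 / 2 -> w^`().[y] != 0.
  move=> ve yv; apply/eqP => /(crit_Khat esc Ww) Ky.
  apply: (far h f.[w.[v]] Wh); first by rewrite -gx; apply: lt_le_trans e1.
  move=> q qv; apply: (hd f w.[y] q ff Ky).
  have := hd2 f w.[y] w.[v] ff Ky; rewrite cmodBC => /(_ (ltac:(lra))).
  by have := cmod_tri f.[w.[v]] q f.[w.[y]]; lra.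
have fx : cmod (h.[f.[w.[x]]] - z) < r by rewrite -gx; apply: lt_le_trans er.
have [fD fa] := ha f ff.
(* The degree is at most [N] for [h] and [D] for [f]; [w] is unramified and injective on the
   component, so it adds nothing. *)
rewrite gE comp_polyA.
apply: (fibre_le_inj _ sw (fibre_le_comp (sW h Wh) (sG f ff) (fib h _ u Wh fx ur) fD)).
- exact: (esc_size esc (withG_comp esc (withHG Wh) (GamG ff))).
- move=> y; rewrite -comp_polyA -gE => cy; split; last first.
    by apply: (nocrit y y (ccomp_sub cy)); rewrite subrr cmod0; lra.
  have [B [cB BA Bx By]] := cy; exists (fun v => exists2 t, B t & v = f.[w.[t]]); split.
  - have := lconn_poly_image (f := f \Po w) cB; congr lconn; apply/funext => v; apply/propext.
    by split=> -[t Bt ->]; exists t; rewrite ?horner_comp.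
  - by move=> v [t /BA Bt ->]; rewrite -gx; apply: lt_le_trans er.
  - by exists x.
  - by exists y.
move=> y y'; rewrite -comp_polyA -gE => cy cy'; have [B [cB BA By By']] := ccomp_join cy cy'.
pose T v := exists2 t, B t & v = w.[t].
(* The image of [B] under [f \Po w] is small by [diam], so [T] is small by [small_preimage]: it fits
   in a disc at [w.[y]] over which [nocrit] excludes critical points of [w]. *)
have cT : lconn T by have := lconn_poly_image (f := w) cB.
have cfT : lconn (fun v => exists2 t, T t & v = f.[t]) by have := lconn_poly_image (f := f) cT.
apply: (injective_over_disc (c := w.[y]) sw _ cB _ By By').
  move=> v; exact: nocrit (BA y By).
move=> v Bv; apply/ltW; apply: lt_le_trans hp2.
apply: (small_preimage (c := f.[w.[y]]) (sG f ff) a0 fa fD p20 p21 cT); last 2 first.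
- by exists y.
- by exists v.
move=> t [s Bs ->]; apply: lt_le_trans hp3.
apply: (diam h _ p3 _ _ Wh p30 p31 cfT).
- move=> t' [t'' [s' Bs' ->] ->]; rewrite -gx; apply: lt_le_trans e3; exact: BA.
- by exists w.[y] => //; exists y.
- by exists w.[s] => //; exists s.
Qed.

Lemma semi_hyperbolic_gen : semi_hyperbolic G.
Proof.
have sG g : G g -> (1 < size g)%N := esc_size esc (g := g).
move=> [z|] Jz; last by case: Jz; exact: esc_fatou_none esc.
have [Kz|nK] := pselect (Khat G z).
  by have [e [k [e0 he]]] := on_Khat_degree Jz Kz; apply: local_degree e0 sG he.
by have [e e0 he] := off_Khat_degree nK; apply: local_degree e0 sG he.
Qed.

End Main.

Theorem theorem1p26 (R : realType) (H Gam : {poly R[i]} -> Prop) :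
  in_calG H ->
  poly_compact Gam ->
  let G := gen (fun p => H p \/ Gam p) in
  in_calG_dis G ->
  (forall K, is_Jmin G K -> forall gam, Gam gam ->
     forall z, Julia1 gam z -> K z -> False) ->
  semi_hyperbolic H ->
  semi_hyperbolic G.
Proof.
move=> calH cG G [calG _] Jmin_disjoint hypH.
have [r0 esc] := escaping_gen calH cG calG hypH.
case: calH => -[exH _ cH] _ _.
exact: (semi_hyperbolic_gen esc cH hypH exH cG Jmin_disjoint).
Qed.
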